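(* Let $\kappa>0$, $\bar\lambda>0$, $\eta\ge0$, $a>0$, let $\lambda_0>0$ be deterministic, and let $g(y)=1-e^{-ay^2}$. Let $\mathcal N(dt,dy,d\gamma)$ be a Poisson random measure on $[0,\infty)\times\mathbb R_0\times[0,\infty)$ with intensity measure $dt\,\bar\nu(dy;\vartheta)\,d\gamma$, as described in the context. Then the coupled system $$\mu(dt,dy)=\int_0^\infty\mathbf 1_{\{\gamma\le\lambda_{t-}\}}\,\mathcal N(dt,dy,d\gamma),\qquad d\lambda_t=\kappa(\bar\lambda-\lambda_t)\,dt+\eta\int_{\mathbb R_0}g(y)\,\mu(dt,dy),$$ with initial value $\lambda_0$, admits a pathwise unique solution $(\lambda,\mu)$, where $\lambda$ is a nonnegative c\`adl\`ag adapted process and $\mu$ is the associated thinned jump measure. Moreover, for every $T<\infty$, $$\int_0^T\lambda_s\,ds<\infty\ \text{ a.s.},\qquad\text{and}\qquad \mathbb E\left[\int_0^T\lambda_s\,ds\right]<\infty .$$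
   Context: $\mathbb R_0=\mathbb R\setminus\{0\}$. For $\vartheta=(p,M,G,\alpha)$ with $p\in(0,1)$, $M,G>0$, $\alpha\in(0,2)$, $\bar\nu(dy;\vartheta)$ is the L\'evy measure $$\bar\nu(dy;\vartheta)=\left[p\frac{M^{2-\alpha}}{\Gamma(2-\alpha)}\frac{e^{-My}}{y^{1+\alpha}}\mathbf 1_{\{y>0\}}+(1-p)\frac{G^{2-\alpha}}{\Gamma(2-\alpha)}\frac{e^{-G|y|}}{|y|^{1+\alpha}}\mathbf 1_{\{y<0\}}\right]dy,$$ which satisfies $\int y^2\,\bar\nu(dy;\vartheta)=1$; since $0\le g(y)\le ay^2$, $\bar g:=\int_{\mathbb R_0}g\,d\bar\nu<\infty$. The filtered probability space $(\Omega,\mathcal F,\mathbb F=(\mathcal F_t)_{t\ge0},\mathbb Q)$ satisfies the usual conditions and carries an $\mathbb F$-Brownian motion $W$ and an independent $\mathbb F$-Poisson random measure $\mathcal N$ on $[0,\infty)\times\mathbb R_0\times[0,\infty)$ with intensity $dt\,\bar\nu(dy;\vartheta)\,d\gamma$. Expectations are under $\mathbb Q$. Pathwise uniqueness means that any two solutions on this space driven by the same $\mathcal N$ with the same $\lambda_0$ are indistinguishable. *)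

(* Defs.v *)
From HB Require Import structures.
From mathcomp Require Import all_boot all_order all_algebra.
From mathcomp Require Import all_classical all_reals all_analysis.
From mathcomp Require Import measurable_realfun normal_distribution poisson_distribution.
Import Order.TTheory GRing.Theory Num.Theory.
Import numFieldNormedType.Exports.

Set Implicit Arguments.
Unset Strict Implicit.
Unset Printing Implicit Defensive.

Local Open Scope classical_set_scope.
Local Open Scope ring_scope.

Section levy_measure.
Context {R : realType}.
Implicit Types (p M G alpha z y : R).

Definition Gamma z : R :=
  \int[lebesgue_measure]_(x in `]0, +oo[) (x `^ (z - 1) * expR (- x)).

Definition levy_density p M G alpha y : R :=
  if 0 < y then
    p * (M `^ (2 - alpha) / Gamma (2 - alpha))
      * (expR (- (M * y)) / y `^ (1 + alpha))
  else if y < 0 then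
    (1 - p) * (G `^ (2 - alpha) / Gamma (2 - alpha))
      * (expR (- (G * `|y|)) / `|y| `^ (1 + alpha))
  else 0.

Definition levy_measure p M G alpha (A : set R) : \bar R :=
  (\int[lebesgue_measure]_(y in A) (levy_density p M G alpha y)%:E)%E.

(* A point of [0,oo) x R_0 x [0,oo) is ((t, y), gamma).  The intensity is a
   set function on the whole of R^3 and vanishes off that set: both Lebesgue
   factors are restricted to [0,oo), and levy_measure has no mass at 0. *)
Definition intensity p M G alpha : set (R * R * R) -> \bar R :=
  (mrestr lebesgue_measure (measurable_itv `[0%R, +oo[) \x
   levy_measure p M G alpha \x
   mrestr lebesgue_measure (measurable_itv `[0%R, +oo[))%E.

Definition mark_space : set (R * R * R) :=
  [set z | [/\ 0 <= z.1.1, z.1.2 != 0 & 0 <= z.2]].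

Definition gfun (a y : R) : R := 1 - expR (- (a * y ^+ 2)).

End levy_measure.

Section filtered_space.
Context {d : measure_display} {Omega : measurableType d} {R : realType}.
Variable Q : probability Omega R.

(* Time is indexed by R; only F t with 0 <= t is meaningful, and likewise for
   all processes below. *)
Variable F : R -> set (set Omega).

Definition filtration : Prop :=
  [/\ forall t : R, 0 <= t -> sigma_algebra setT (F t),
      forall t : R, 0 <= t -> F t `<=` measurable &
      forall s t : R, 0 <= s -> s <= t -> F s `<=` F t].

Definition usual_conditions : Prop :=
  [/\ filtration,
      forall t : R, 0 <= t -> F t = \bigcap_(s in `]t, +oo[) F s &
      forall A, Q.-negligible A -> F 0 A].

Definition measurable_wrt {d'} {T : measurableType d'} (H : set (set Omega))
    (X : Omega -> T) : Prop :=
  forall B, measurable B -> H (X @^-1` B).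

Definition adapted {d'} {T : measurableType d'} (X : R -> Omega -> T) : Prop :=
  forall t : R, 0 <= t -> measurable_wrt (F t) (X t).

Definition independent (H K : set (set Omega)) : Prop :=
  forall A B, H A -> K B -> Q (A `&` B) = (Q A * Q B)%E.

Definition sigma_of {d'} {T : measurableType d'} {I : Type} (D : set I)
    (X : I -> Omega -> T) : set (set Omega) :=
  <<s \bigcup_(i in D) preimage_set_system setT (X i) measurable >>.

Definition brownian_motion (W : R -> Omega -> R) : Prop :=
  [/\ adapted W,
      {ae Q, forall w, W 0 w = 0},
      {ae Q, forall w, {within `[0, +oo[, continuous (W ^~ w)}},
      forall (s t : R) (B : set R), 0 <= s -> s < t -> measurable B ->
        Q ((fun w => W t w - W s w) @^-1` B)
        = normal_prob 0 (Num.sqrt (t - s)) B &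
      forall s t : R, 0 <= s -> s < t ->
        independent (F s)
          (sigma_of [set: unit] (fun=> fun w => W t w - W s w))].

Implicit Types N : Omega -> {measure set (R * R * R) -> \bar R}.

Definition integer_valued N : Prop :=
  forall w A, measurable A ->
    N w A = +oo%E \/ exists k : nat, N w A = (k%:R)%:E.

(* The second argument of poisson_prob is a dummy.  poisson_prob 0 is the
   Dirac mass at 0, so null sets of m carry no point of N almost surely. *)
Definition poisson_random_measure (m : set (R * R * R) -> \bar R) N : Prop :=
  [/\ integer_valued N,
      forall w, N w (~` mark_space) = 0%E,
      forall (A : set (R * R * R)) (k : nat), measurable A -> (m A < +oo)%E ->
        Q [set w | N w A = (k%:R)%:E] = poisson_prob (fine (m A)) 0 [set k] &
      forall n (A : 'I_n -> set (R * R * R)) (B : 'I_n -> set (\bar R)),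
        (forall i, measurable (A i)) -> (forall i, measurable (B i)) ->
        trivIset setT A ->
        Q (\bigcap_i [set w | B i (N w (A i))])
        = (\prod_(i < n) Q [set w | B i (N w (A i))])%E].

Definition adapted_poisson_random_measure (m : set (R * R * R) -> \bar R) N :
    Prop :=
  [/\ poisson_random_measure m N,
      forall (t : R) (A : set (R * R * R)),
        0 <= t -> measurable A -> A `<=` [set z | z.1.1 <= t] ->
        measurable_wrt (F t) (fun w => N w A) &
      forall s : R, 0 <= s ->
        independent (F s)
          (sigma_of [set A : set (R * R * R) | measurable A /\ A `<=` [set z | s < z.1.1]]
             (fun A w => N w A))].

Definition cadlag (x : R -> R) : Prop :=
  (forall t : R, 0 <= t -> x s @[s --> t^'+] --> x t) /\
  (forall t : R, 0 < t -> cvg (x s @[s --> t^'-])).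

(* x_{t-}, with the convention x_{0-} = x_0. *)
Definition left_limit (x : R -> R) (t : R) : R :=
  if t <= 0 then x 0 else lim (x s @[s --> t^'-]).

Definition thinning (lambda : R -> R)
    (n : {measure set (R * R * R) -> \bar R}) (A : set (R * R)) : \bar R :=
  (\int[n]_(z in [set z | A z.1 /\ (0 <= z.2)%R])
     (\1_[set z' : R * R * R | z'.2 <= left_limit lambda z'.1.1] z)%:E)%E.

(* The differential equation is read in integrated form, jumps being collected
   over ]0, t] x R_0.  Nonnegativity is not part of this notion. *)
Definition solution (kappa lbar eta a lambda0 : R) N (lambda : R -> Omega -> R)
    (mu : Omega -> {measure set (R * R) -> \bar R}) : Prop :=
  [/\ adapted lambda,
      forall w, cadlag (lambda ^~ w),
      {ae Q, forall w, forall A, measurable A ->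
        mu w A = thinning (lambda ^~ w) (N w) A} &
      {ae Q, forall w, forall t : R, 0 <= t ->
        ((lambda t w)%:E
         = lambda0%:E
           + \int[lebesgue_measure]_(s in `[0%R, t])
               (kappa * (lbar - lambda s w))%:E
           + eta%:E * \int[mu w]_(z in [set z | [/\ 0 < z.1, z.1 <= t
                                                  & z.2 != 0]%R])
                        (gfun a z.2)%:E)%E}].

Definition indistinguishable (lambda lambda' : R -> Omega -> R)
    (mu mu' : Omega -> {measure set (R * R) -> \bar R}) : Prop :=
  {ae Q, forall w,
    (forall t : R, 0 <= t -> lambda t w = lambda' t w) /\
    (forall A, measurable A -> mu w A = mu' w A)}.

End filtered_space.

(* Main.v *)
Require Import Defs.
From HB Require Import structures.
From mathcomp Require Import all_boot all_order all_algebra.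
From mathcomp Require Import all_classical all_reals all_analysis.
From mathcomp Require Import measurable_realfun normal_distribution poisson_distribution.
From mathcomp Require Import ring lra.
Import Order.TTheory GRing.Theory Num.Theory.
Import numFieldNormedType.Exports.

Set Implicit Arguments.
Unset Strict Implicit.
Unset Printing Implicit Defensive.

Local Open Scope classical_set_scope.
Local Open Scope ring_scope.

(** The substitution [x t = expR (kappa * t) * lambda t] removes the mean
    reversion: the equation becomes
      x t = drift t + (sum over the kept points of their weights),
    where [drift] is a deterministic nondecreasing function, a point
    [((s, y), gamma)] has weight [expR (kappa * s) * (eta * gfun a y)], and it is
    kept when its level [expR (kappa * s) * gamma] is at most the left limit of
    [x] at [s].  All solutions are now nondecreasing in time, and the right-hand
    side is nondecreasing as a function of the path [x].  The proof rests on this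
    order and on one mean identity.

    The mean identity is [accum_mean].  Let [accum] collect the points whose
    level is strictly below some earlier value of a nondecreasing path.  This
    set of points is the increasing union of dyadic staircases, whose steps only
    use the value of the path at the beginning of each dyadic interval.  For an
    adapted process this value is independent of the points to come, so the mean
    mass of a staircase is [c] times a left Riemann sum of the mean of the
    process, where [c] is [eta] times the integral of [gfun a] against the Levy
    measure ([intensity_sigma_finite], [random_level]).

    The Picard iterates of the monotone operator [drift + accum], started at 0,
    increase to its least fixed point [minimal_solution].  A Gronwall argument on
    the iterates bounds its mean by [2 * A * expR (b * t)] as soon as
    [2 * c <= b] ([minimal_mean]); this gives the two integrability claims, since
    [lambda] at time [s <= T] is at most the value of [x] at [T].

    The least fixed point keeps the points with level strictly below the left
    limit, the equation those with level at most the left limit.  The closed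
    accumulation lies below the accumulation along the path shifted up by any
    [e > 0], and by the mean identity this shift raises the mean of the accumulation
    by at most [c * e * t]; hence the closed and the open accumulations agree almost
    surely ([ae_accum_closed]), and the least fixed point solves the equation.

    Uniqueness: a solution dominates the least fixed point by construction, but
    its mean is not known to be finite.  Truncating it at a level [K] gives a
    process below its own closed image ([truncated_le_operator], which uses
    right continuity at the first passage above [K]); its maximum with the least
    fixed point is within mean distance [K] of it, and the operator halves
    such distances when they are weighted by [expR (b * t)].  So the distance is
    zero ([ae_eq_minimal]), and letting [K] grow every solution equals the least
    fixed point ([ae_unique]).

    The passage between the integrated equation for [lambda] and the equation for
    [x] is a pathwise integration by parts.  Two quantities, each constant in one
    of the formulations, have increments that agree up to the factor
    [expR (kappa * s)] and errors of second order ([integrating_factor]), and a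
    function whose increments are of second order is constant
    ([quadratic_increments]). *)

(** * Measures with a density and mixtures of measures *)

Section density_measure.
Local Open Scope ereal_scope.
Context d (T : measurableType d) (R : realType).
Variables (mu : {measure set T -> \bar R}) (f : T -> \bar R).
Hypotheses (f0 : forall x, 0 <= f x) (mf : measurable_fun setT f).

(** The proofs are arguments so that the measure structure can be attached to the
    term. *)
Definition density_measure of (forall x, 0 <= f x) & measurable_fun setT f :=
  fun A : set T => \int[mu]_(x in A) f x.

Let dens0 : density_measure f0 mf set0 = 0.
Proof. by rewrite /density_measure integral_set0. Qed.

Let dens_ge0 A : 0 <= density_measure f0 mf A.
Proof. exact: integral_ge0. Qed.

Let dens_sigma_additive : semi_sigma_additive (density_measure f0 mf).
Proof. exact: semi_sigma_additive_nng_induced. Qed.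

HB.instance Definition _ := isMeasure.Build _ _ _ (density_measure f0 mf)
  dens0 dens_ge0 dens_sigma_additive.

End density_measure.

Section mixture.
Local Open Scope ereal_scope.
Context d d' (X : measurableType d) (Y : measurableType d') (R : realType).

Import HBNNSimple.

(** Both sides agree on simple functions, by linearity, and are continuous along
    increasing sequences. *)
Lemma integral_mixture (l : X -> {measure set Y -> \bar R})
    (ml : forall U, measurable U -> measurable_fun setT (l ^~ U))
    (mu : {measure set X -> \bar R}) (M : {measure set Y -> \bar R})
    (HM : forall U, measurable U -> M U = \int[mu]_x l x U)
    (f : Y -> \bar R) : (forall y, 0 <= f y) -> measurable_fun setT f ->
  \int[M]_y f y = \int[mu]_x \int[l x]_y f y.
Proof.
move=> f0 mf.
have Hsimple (h : {nnsfun Y >-> R}) :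
    \int[M]_y (h y)%:E = \int[mu]_x \int[l x]_y (h y)%:E.
  have E (m : {measure set Y -> \bar R}) : \int[m]_y (h y)%:E =
      \sum_(r \in range h) r%:E * m (h @^-1` [set r]).
    by rewrite integralT_nnsfun sintegralE.
  rewrite E; under [RHS]eq_integral do rewrite E.
  rewrite ge0_integral_fsum//; last 2 first.
  - move=> r; apply: emeasurable_funM => //.
    by apply: ml; exact: measurable_sfunP.
  - move=> r x _; have [r0|r0] := leP 0%R r; first by rewrite mule_ge0 ?lee_fin.
    by rewrite preimage_nnfun0// measure0 mule0.
  apply: eq_fsbigr => r _.
  have [r0|r0] := leP 0%R r; last first.
    rewrite preimage_nnfun0// measure0 mule0; under eq_integral do rewrite measure0 mule0.
    by rewrite integral0.
  rewrite HM//; first by rewrite ge0_integralZl//; apply: ml.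
pose g := nnsfun_approx measurableT mf.
have lim (m : {measure set Y -> \bar R}) :
    \int[m]_y f y = limn (fun n => \int[m]_y (g n y)%:E).
  rewrite -monotone_convergence//; last 3 first.
  - by move=> n; exact/measurable_EFinP.
  - by move=> n y _; rewrite lee_fin.
  - by move=> y _ a b ab; rewrite lee_fin; exact/lefP/nd_nnsfun_approx.
  by apply: eq_integral => y _; apply/esym/cvg_lim => //; exact: cvg_nnsfun_approx.
rewrite lim; under [RHS]eq_integral do rewrite lim.
rewrite monotone_convergence//.
- by congr (limn _); apply/funext => n; exact: Hsimple.
- move=> n; apply: measurable_fun_integral_kernel => //.
  + by move=> y; rewrite lee_fin.
  + exact/measurable_EFinP.
- by move=> n x _; apply: integral_ge0 => y _; rewrite lee_fin.
- move=> x _ a b ab; apply: ge0_le_integral => //.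
  + by move=> y _; rewrite lee_fin.
  + exact/measurable_EFinP.
  + exact/measurable_EFinP.
  + by move=> y _; rewrite lee_fin; exact/lefP/nd_nnsfun_approx.
Qed.

End mixture.

(** Removing the null term and shifting the index turns [k] times the mass at [k]
    into [r] times the mass at [k - 1]. *)
Lemma poisson_mean (R : realType) (r : R) : 0 <= r ->
  (\sum_(k <oo) (k%:R)%:E * poisson_prob r 0 [set k] = r%:E)%E.
Proof.
rewrite le_eqVlt => /predU1P[<-|r0].
  rewrite eseries0// => k _ _; rewrite /poisson_prob ltxx diracE.
  by case: k => [|k]; rewrite ?mul0e// memNset ?mule0//= => [].
have E k : poisson_prob r 0 [set k] = (poisson_pmf r k)%:E.
  by rewrite /poisson_prob r0 esum_set1 ?lee_fin ?poisson_pmf_ge0.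
under eq_eseriesr do rewrite E.
have pos k : (0 <= (k%:R)%:E * (poisson_pmf r k)%:E :> \bar R)%E.
  by rewrite mule_ge0// lee_fin poisson_pmf_ge0.
have H (F : (\bar R)^nat) : (forall k, 0 <= F k)%E -> F 0%N = 0%E ->
    (\sum_(k <oo) F k = \sum_(k <oo) F k.+1)%E.
  move=> F0 F00; rewrite nneseries_recl// F00 add0e -(nneseries_addn 1)//.
  by apply: eq_eseriesr => k _; rewrite addn1.
rewrite H//; last by rewrite mul0e.
transitivity (\sum_(k <oo) r%:E * (poisson_pmf r k)%:E)%E.
  apply: eq_eseriesr => k _; rewrite -!EFinM /poisson_pmf r0; congr EFin.
  rewrite factS natrM exprS invfM.
  have k1 : k.+1%:R != 0 :> R by rewrite pnatr_eq0.
  by rewrite !mulrA; congr (_ * _); rewrite -!mulrA mulrCA; congr (_ * _);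
    rewrite mulrCA; congr (_ * _); rewrite mulrA mulfV// mul1r.
rewrite nneseriesZl => [|k _]; last by rewrite lee_fin poisson_pmf_ge0.
rewrite -[RHS]mule1; congr (_ * _)%E.
have := probability_setT (poisson_prob r 0).
rewrite [X in X = _]/(poisson_prob r 0 setT) /poisson_prob r0 -nneseries_esumT// => k.
by rewrite lee_fin poisson_pmf_ge0.
Qed.

(** * The mean of a Poisson random measure, conditionally on the past *)

Section restriction.
Local Open Scope ereal_scope.
Context d (T : measurableType d) (R : realType).

Lemma ge0_integral_mrestr (mu : {measure set T -> \bar R}) (D : set T)
    (mD : measurable D) (f : T -> \bar R) :
  (forall x, 0 <= f x) -> measurable_fun setT f ->
  \int[mrestr mu mD]_x f x = \int[mu]_(x in D) f x.
Proof.
move=> f0 mf.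
rewrite (@ge0_negligible_integral _ _ _ (mrestr mu mD) setT (~` D))//; last 2 first.
- exact: measurableC.
- by rewrite /= /mrestr setICl measure0.
rewrite setTD setCK; apply: eq_measure_integral => A mA AD.
by rewrite /= /mrestr setIidl.
Qed.

End restriction.

Section sub_sigma_algebra.
Context d0 {Omega : measurableType d0} d (T : measurableType d).
Variable G : set (set Omega).
Hypothesis sG : sigma_algebra setT G.

Lemma measurable_sub (A : set (g_sigma_algebraType G)) : measurable A = G A.
Proof. by rewrite /measurable/= sigma_algebra_id. Qed.

Lemma measurable_wrtP (X : Omega -> T) :
  measurable_wrt G X <-> measurable_fun setT (X : g_sigma_algebraType G -> T).
Proof.
split=> [mX _ B mB|mX B mB]; first by rewrite setTI measurable_sub; exact: mX.
by rewrite -measurable_sub -[_ @^-1` _]setTI; exact: mX.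
Qed.

End sub_sigma_algebra.

Lemma measurable_wrt_mono d0 (Omega : measurableType d0) d (T : measurableType d)
    (G H : set (set Omega)) (X : Omega -> T) :
  G `<=` H -> measurable_wrt G X -> measurable_wrt H X.
Proof. by move=> GH mX B /mX /GH. Qed.

Section poisson_intensity.
Local Open Scope ereal_scope.
Context d (Omega : measurableType d) (R : realType) (Q : probability Omega R).
Variables (F : R -> set (set Omega)) (fF : filtration F).
Variable m : {sigma_finite_measure set (R * R * R)%type -> \bar R}.
Variable N : Omega -> {measure set (R * R * R)%type -> \bar R}.
Hypothesis prmN : adapted_poisson_random_measure Q F m N.

Let sF (t : R) : (0 <= t)%R -> sigma_algebra setT (F t).
Proof. by case: fF => + _ _; exact. Qed.

Let Fm (t : R) : (0 <= t)%R -> F t `<=` measurable.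
Proof. by case: fF => _ + _; exact. Qed.

Lemma prm_adapted (t : R) (A : set (R * R * R)%type) : (0 <= t)%R -> measurable A ->
  A `<=` [set z | (z.1.1 <= t)%R] -> measurable_wrt (F t) (fun w => N w A).
Proof. by case: prmN => _ + _; apply. Qed.

Lemma prm_measurable (t : R) (A : set (R * R * R)%type) : (0 <= t)%R -> measurable A ->
  A `<=` [set z | (z.1.1 <= t)%R] -> measurable_fun setT (fun w => N w A).
Proof.
by move=> t0 mA At _ B mB; rewrite setTI; apply: (Fm t0); exact: (prm_adapted t0).
Qed.

(* A Poisson variable independent of [E] is integrated over its countably many
   values, whose total probability is one. *)
Let prm_mean_fin (s u : R) E (A : set (R * R * R)%type) : (0 <= s)%R -> (s <= u)%R -> F s E -> measurable A ->
  A `<=` [set z | (s < z.1.1 <= u)%R] -> m A < +oo ->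
  \int[Q]_(w in E) N w A = Q E * m A.
Proof.
move=> s0 su FE mA Asu mAoo.
have mNA : measurable_fun setT (fun w => N w A).
  apply: (prm_measurable (le_trans s0 su)) => // z /Asu.
  by move=> /andP[].
have mE : measurable E := Fm s0 FE.
pose V k := [set w | N w A = (k%:R)%:E].
have mV k : measurable (V k).
  by rewrite -[V k]setTI; exact: (mNA measurableT [set (k%:R)%:E]).
have QV k : Q (V k) = poisson_prob (fine (m A)) 0 [set k].
  by case: prmN => -[_ _ + _] _ _; apply.
have QEV k : Q (E `&` V k) = Q E * Q (V k).
  case: prmN => _ _ /(_ _ s0); apply => //.
  apply: sub_gen_smallest; exists A => /=; first by split => // z /Asu/andP[].
  by exists [set (k%:R)%:E] => //; rewrite setTI.
have tV : trivIset setT V.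
  apply/trivIsetP => i j _ _ ij; apply/seteqP; split => // w [].
  by rewrite /V/= => -> [] /eqP; rewrite eqr_nat (negbTE ij).
have r0 : (0 <= fine (m A))%R by exact: fine_ge0.
have QVT : Q (\bigcup_k V k) = 1.
  rewrite measure_semi_bigcup//; last exact: bigcupT_measurable.
  rewrite (eq_eseriesr (fun k _ => QV k)).
  have tI : trivIset setT (fun k : nat => [set k]).
    by move=> i j _ _ [k [-> ->]].
  rewrite -measure_semi_bigcup//.
  have -> : \bigcup_n [set n] = [set: nat].
    by apply/seteqP; split => // k _; exists k.
  exact: probability_setT.
have mbV : measurable (\bigcup_k V k) by exact: bigcupT_measurable.
have QVC : Q (~` \bigcup_k V k) = 0 by rewrite probability_setC// QVT subee.
rewrite (@ge0_negligible_integral _ _ _ Q E (~` \bigcup_k V k))//; last 2 first.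
- exact: measurableC.
- exact: measurable_funTS.
rewrite setDE setCK setI_bigcupr ge0_integral_bigcup//=; last 3 first.
- by move=> k; exact: measurableI.
- exact: measurable_funTS.
- apply/trivIsetP => i j _ _ ij; rewrite setIACA setIid.
  by move/trivIsetP : tV => -> //; rewrite setI0.
transitivity (\sum_(k <oo) Q E * ((k%:R)%:E * poisson_prob (fine (m A)) 0 [set k])).
  apply: eq_eseriesr => k _; rewrite -QV muleCA -QEV.
  rewrite -integral_cst; last exact: measurableI.
  by apply: eq_integral => w; rewrite inE => -[].
rewrite -(fineK (fin_num_measure Q E mE)) nneseriesZl => [|k _]; last first.
  by rewrite mule_ge0// lee_fin.
have mAfin : m A \is a fin_num by rewrite ge0_fin_numE.
by rewrite poisson_mean// (fineK mAfin).
Qed.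

(** Sigma-finiteness extends the identity to sets of infinite intensity by
    monotone convergence. *)
Lemma prm_intensity (s u : R) E (A : set (R * R * R)%type) : (0 <= s)%R -> (s <= u)%R -> F s E ->
  measurable A -> A `<=` [set z | (s < z.1.1 <= u)%R] ->
  \int[Q]_(w in E) N w A = Q E * m A.
Proof.
move=> s0 su FE mA Asu.
have /sigma_finiteP[C [CT ndC Coo]] := sigma_finiteT m.
have mC k : measurable (A `&` C k) by apply: measurableI => //; case: (Coo k).
have CE : \bigcup_k (A `&` C k) = A by rewrite -setI_bigcupr -CT setIT.
have ndAC : {homo (fun k => A `&` C k) : a b / (a <= b)%N >-> (a <= b)%O}.
  by move=> a b ab; apply/subsetPset; apply: setIS; apply/subsetPset/ndC.
have cvg (mu : {measure set (R * R * R)%type -> \bar R}) :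
    mu (A `&` C k) @[k --> \oo] --> mu A.
  have := @nondecreasing_cvg_mu _ _ _ mu _ mC; rewrite CE => /(_ mA ndAC); exact.
have mE : measurable E := Fm s0 FE.
have mN k : measurable_fun setT (fun w => N w (A `&` C k)).
  apply: (prm_measurable (le_trans s0 su)) => //.
  by move=> z [/Asu/andP[]].
transitivity (\int[Q]_(w in E) limn (fun k => N w (A `&` C k))).
  by apply: eq_integral => w _; apply/esym/cvg_lim => //; exact: cvg.
rewrite monotone_convergence//; last 2 first.
- by move=> k; exact: measurable_funTS (mN k).
- by move=> w _ a b ab; apply: le_measure; rewrite ?inE//; apply/subsetPset/ndAC.
apply/cvg_lim => //.
under eq_fun => k.
  rewrite (prm_mean_fin s0 su)//; last 2 first.
  - by move=> z [/Asu].
  - have [mCk Ck] := Coo k; apply: le_lt_trans Ck.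
    by apply: le_measure; rewrite ?inE.
  over.
apply: cvgeZl; last exact: cvg.
exact: fin_num_measure.
Qed.

Section weighted.
Variables (G : (R * R * R)%type -> \bar R) (G0 : forall z, 0 <= G z).
Hypothesis mG : measurable_fun setT G.

Lemma weighted_prm_adapted (t : R) (A : set (R * R * R)%type) : (0 <= t)%R -> measurable A ->
  A `<=` [set z | (z.1.1 <= t)%R] ->
  measurable_wrt (F t) (fun w => density_measure (N w) G0 mG A).
Proof.
move=> t0 mA At; apply/(measurable_wrtP (sF t0)).
rewrite /density_measure.
under eq_fun do rewrite -(ge0_integral_mrestr _ mA)//.
apply: (@measurable_fun_integral_kernel _ _ (g_sigma_algebraType (F t)) _ _
  (fun w => mrestr (N w) mA)) => // U mU.
apply/(measurable_wrtP (sF t0)); rewrite /mrestr; apply: prm_adapted => //.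
  exact: measurableI.
by move=> z [_ /At].
Qed.

(** Inside the slab, the measure [Q E * m] is the mixture over [E] of the random
    measures [N w], so the identity for sets passes to nonnegative integrands. *)
Lemma weighted_prm_intensity (s u : R) E (A : set (R * R * R)%type) : (0 <= s)%R -> (s <= u)%R -> F s E ->
  measurable A -> A `<=` [set z | (s < z.1.1 <= u)%R] ->
  \int[Q]_(w in E) density_measure (N w) G0 mG A = Q E * \int[m]_(z in A) G z.
Proof.
move=> s0 su FE mA Asu; have mE : measurable E := Fm s0 FE.
have mNA U : measurable U -> measurable_fun setT (fun w => mrestr (N w) mA U).
  move=> mU; rewrite /mrestr; apply: (prm_measurable (le_trans s0 su)).
  - exact: measurableI.
  - by move=> z [_ /Asu/andP[]].
pose q := NngNum (fine_ge0 (measure_ge0 Q E)).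
pose l w : {measure set (R * R * R)%type -> \bar R} := mrestr (N w) mA.
have := @integral_mixture _ _ _ _ _ l mNA (mrestr Q mE) (mscale q (mrestr m mA)) _
  G G0 mG.
rewrite ge0_integral_mscale// ge0_integral_mrestr// ge0_integral_mrestr//; last 2 first.
- by move=> w; exact: integral_ge0.
- exact: measurable_fun_integral_kernel.
rewrite /= fineK ?fin_num_measure// => ->.
  by apply: eq_integral => w _; rewrite ge0_integral_mrestr.
move=> U mU; rewrite ge0_integral_mrestr//; last exact: mNA.
rewrite /mscale/= fineK ?fin_num_measure// -(prm_intensity s0 su FE)//.
  exact: measurableI.
by move=> z [_ /Asu].
Qed.

End weighted.

End poisson_intensity.

(** * The intensity measure: sigma-finiteness and the mean weight of a cell *)

Section sigma_finite_mrestr.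
Local Open Scope ereal_scope.
Context d (T : measurableType d) (R : realType).
Variables (mu : {sigma_finite_measure set T -> \bar R}) (D : set T).
Hypothesis mD : measurable D.

Lemma sigma_finite_mrestr : sigma_finite setT (mrestr mu mD).
Proof.
have [C CT Coo] := sigma_finiteT mu; exists C => // k.
have [mC] := Coo k; split => //; apply: le_lt_trans b.
by apply: le_measure; rewrite ?inE//; exact: measurableI.
Qed.

End sigma_finite_mrestr.

Section half_line.
Context {R : realType}.

Definition half_line_measure : set (measurableTypeR R) -> \bar R :=
  mrestr lebesgue_measure (measurable_itv `[0%R, +oo[).

HB.instance Definition _ := Measure.on half_line_measure.

HB.instance Definition _ := Measure_isSigmaFinite.Build _ _ _ half_line_measure
  (sigma_finite_mrestr lebesgue_measure (measurable_itv `[0%R, +oo[)).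

End half_line.

Section sigma_finite_product.
Local Open Scope ereal_scope.
Context d1 d2 (T1 : measurableType d1) (T2 : measurableType d2) (R : realType).
Variables (m1 : {sigma_finite_measure set T1 -> \bar R}).
Variables (m2 : {sigma_finite_measure set T2 -> \bar R}).

(** A name to which the sigma-finite structure is attached, so that products can
    be iterated. *)
Definition sigma_finite_product : set (T1 * T2)%type -> \bar R := m1 \x m2.

HB.instance Definition _ := Measure.on sigma_finite_product.

Let sf : sigma_finite setT sigma_finite_product.
Proof.
have /sigma_finiteP[F [TF ndF Foo]] := sigma_finiteT m1.
have /sigma_finiteP[G [TG ndG Goo]] := sigma_finiteT m2.
exists (fun n => F n `*` G n).
  rewrite -setXTT TF TG predeqE => -[x y]; split; last first.
    by move=> [n _ []/= ? ?]; split; exists n.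
  move=> [/= [n _ Fnx] [k _ Gky]]; exists (maxn n k) => //; split.
  - by move: x Fnx; exact/subsetPset/ndF/leq_maxl.
  - by move: y Gky; exact/subsetPset/ndG/leq_maxr.
move=> k; have [? ?] := Foo k; have [? ?] := Goo k.
split; first exact: measurableX.
by rewrite /sigma_finite_product product_measure1E// lte_mul_pinfty// ge0_fin_numE.
Qed.

HB.instance Definition _ := Measure_isSigmaFinite.Build _ _ _ sigma_finite_product sf.

End sigma_finite_product.

Section integral_bigcup_geometric.
Local Open Scope ereal_scope.
Context d (T : measurableType d) (R : realType).

Lemma integral_bigcup_geometric (mu : {measure set T -> \bar R})
    (A : (set T)^nat) (f : T -> \bar R) (C rho : R) :
  (forall k, measurable (A k)) -> measurable_fun setT f -> (forall x, 0 <= f x) ->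
  (0 <= C)%R -> (0 < rho < 1)%R ->
  (forall k, \int[mu]_(x in A k) f x <= (C * rho ^+ k)%:E) ->
  \int[mu]_(x in \bigcup_k A k) f x < +oo.
Proof.
move=> mA mf f0 C0 /andP[rho0 rho1] H.
have mDU k : measurable (seqDU A k).
  by apply: measurableD => //; exact: bigsetU_measurable.
rewrite seqDU_bigcup_eq ge0_integral_bigcup//; last exact: measurable_funTS.
apply: (@le_lt_trans _ _ (\sum_(k <oo) (C * rho ^+ k)%:E)).
  apply: lee_nneseries => [k _ _|k _]; first exact: integral_ge0.
  apply: le_trans (H k); apply: ge0_subset_integral => //.
    exact: measurable_funTS.
  by move=> x [].
have rho1' : (`|rho| < 1)%R by rewrite gtr0_norm.
rewrite [ltLHS](_ : _ = (limn (series (geometric C rho)))%:E) ?ltry//.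
rewrite -EFin_lim; last exact: is_cvg_geometric_series.
by congr (limn _); apply/funext => n; rewrite /= /series/= sumEFin.
Qed.

End integral_bigcup_geometric.

Section image_measure.
Local Open Scope ereal_scope.
Context d1 d2 (T1 : measurableType d1) (T2 : measurableType d2) (R : realType).
Variables (mu : {measure set T1 -> \bar R}) (phi : T1 -> T2).
Hypothesis mphi : measurable_fun setT phi.

(** The proof is an argument so that the measure structure can be attached to the
    term. *)
Definition image_measure of measurable_fun setT phi := pushforward mu phi.

Let image0 : image_measure mphi set0 = 0.
Proof. by rewrite /image_measure /pushforward preimage_set0 measure0. Qed.

Let image_ge0 A : 0 <= image_measure mphi A.
Proof. exact: measure_ge0. Qed.

Let mpre A : measurable A -> measurable (phi @^-1` A).
Proof. by move=> mA; rewrite -[X in measurable X]setTI; exact: mphi. Qed.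

Let image_sigma_additive : semi_sigma_additive (image_measure mphi).
Proof.
move=> F mF tF mUF; rewrite /image_measure /pushforward preimage_bigcup.
apply: measure_semi_sigma_additive.
- by move=> n; exact: mpre.
- apply/trivIsetP => /= i j _ _ ij; rewrite -preimage_setI.
  by move/trivIsetP : tF => /(_ _ _ _ _ ij) ->//; rewrite preimage_set0.
- by rewrite -preimage_bigcup; exact: mpre.
Qed.

HB.instance Definition _ := isMeasure.Build _ _ _ (image_measure mphi)
  image0 image_ge0 image_sigma_additive.

Lemma ge0_integral_image (f : T2 -> \bar R) (D : set T2) : measurable D ->
  measurable_fun D f -> (forall y, D y -> 0 <= f y) ->
  \int[image_measure mphi]_(y in D) f y = \int[mu]_(x in phi @^-1` D) f (phi x).
Proof.
move=> mD mf f0; rewrite (ge0_integral_pushforward mphi)// => y.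
by rewrite inE; exact: f0.
Qed.

End image_measure.

Section transport.
Local Open Scope ereal_scope.
Context d1 d2 (T1 : measurableType d1) (T2 : measurableType d2) (R : realType).

(** Used with the identity between two presentations of the same measurable space
    (the Borel sets of the line, the product sets of the space), in order to carry
    a sigma-finite measure from one to the other. *)
Lemma sigma_finite_transport (mu : {sigma_finite_measure set T1 -> \bar R})
    (phi : T1 -> T2) (psi : T2 -> T1) :
  measurable_fun setT phi -> measurable_fun setT psi -> cancel phi psi ->
  exists nu : {sigma_finite_measure set T2 -> \bar R},
    (nu : set T2 -> \bar R) = pushforward mu phi /\
    forall f : T2 -> \bar R, measurable_fun setT f -> (forall x, 0 <= f x) ->
      \int[nu]_x f x = \int[mu]_x f (phi x).
Proof.
move=> mphi mpsi phiK.
have sf : sigma_finite setT (image_measure mu mphi).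
  have [C CT Coo] := sigma_finiteT mu.
  exists (fun n => psi @^-1` C n).
    by rewrite -preimage_bigcup -CT preimage_setT.
  move=> n; have [mC oo] := Coo n; split.
    by rewrite -[X in measurable X]setTI; exact: mpsi.
  rewrite /image_measure /pushforward -comp_preimage.
  rewrite (_ : psi \o phi = id) ?preimage_id//.
  by apply/funext => x /=; rewrite phiK.
pose sfm := Measure_isSigmaFinite.Build _ _ _ (image_measure mu mphi) sf.
pose nu : {sigma_finite_measure set T2 -> \bar R} :=
  HB.pack (image_measure mu mphi) sfm.
exists nu; split => // f mf f0.
by rewrite (ge0_integral_image mu mphi).
Qed.

End transport.

Lemma gfun_ge0 (R : realType) (a y : R) : 0 < a -> 0 <= gfun a y.
Proof.
move=> a0; rewrite /gfun subr_ge0 -expR0 ler_expR oppr_le0.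
by rewrite mulr_ge0 ?sqr_ge0// ltW.
Qed.

Section levy.
Context {R : realType}.
Variables p M G alpha a : R.
Hypotheses (p0 : 0 < p) (p1 : p < 1) (M0 : 0 < M) (G0 : 0 < G).
Hypotheses (alpha0 : 0 < alpha) (alpha2 : alpha < 2) (a0 : 0 < a).

Let dens := levy_density p M G alpha.

Lemma Gamma_ge0 (z : R) : 0 <= Gamma z.
Proof.
rewrite /Gamma /Rintegral fine_ge0// integral_ge0// => x _.
by rewrite lee_fin mulr_ge0// ?powR_ge0// expR_ge0.
Qed.

Lemma levy_density_ge0 y : 0 <= dens y.
Proof.
rewrite /dens /levy_density; case: ifPn => y0.
  by rewrite !mulr_ge0 ?invr_ge0 ?powR_ge0 ?Gamma_ge0 ?expR_ge0// ltW.
by case: ifPn => // y0'; rewrite !mulr_ge0 ?invr_ge0 ?powR_ge0 ?Gamma_ge0 ?expR_ge0//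
  subr_ge0 ltW.
Qed.

Lemma measurable_levy_density : measurable_fun setT dens.
Proof.
have mexp (K : R) : measurable_fun setT (fun y : R => expR (- (K * `|y|))).
  apply: measurableT_comp => //; apply: measurableT_comp => //.
  by apply: measurable_funM => //; exact: normr_measurable.
have mpow : measurable_fun setT (fun y : R => (`|y| `^ (1 + alpha))^-1).
  rewrite (_ : (fun _ => _) = (@powR R ^~ (- (1 + alpha))) \o (@Num.norm _ R)); last first.
    by apply/funext => y /=; rewrite powRN.
  by apply: measurableT_comp => //; exact: measurable_powR.
rewrite (_ : dens = fun y => if 0 < y then
    p * (M `^ (2 - alpha) / Gamma (2 - alpha))
      * (expR (- (M * `|y|)) / `|y| `^ (1 + alpha))
  else if y < 0 then
    (1 - p) * (G `^ (2 - alpha) / Gamma (2 - alpha))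
      * (expR (- (G * `|y|)) / `|y| `^ (1 + alpha))
  else 0); last first.
  by apply/funext => y; rewrite /dens /levy_density; case: ifPn => // y0; rewrite gtr0_norm.
apply: measurable_fun_ifT; first exact: measurable_fun_ltr.
  by do 2! apply: measurable_funM => //.
apply: measurable_fun_ifT => //; first exact: measurable_fun_ltr.
by do 2! apply: measurable_funM => //.
Qed.

(* A common bound for both half-lines of the density, in which the exponential
   factor is dropped. *)
Let levy_const := Num.max (p * (M `^ (2 - alpha) / Gamma (2 - alpha)))
  ((1 - p) * (G `^ (2 - alpha) / Gamma (2 - alpha))).

Let levy_const_ge0 : 0 <= levy_const.
Proof.
rewrite /levy_const le_max; apply/orP; left.
by rewrite !mulr_ge0 ?invr_ge0 ?powR_ge0 ?Gamma_ge0// ltW.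
Qed.

Lemma levy_density_le y : dens y <= levy_const / `|y| `^ (1 + alpha).
Proof.
have le1 (A K y' : R) : 0 <= A -> A <= levy_const -> 0 < K -> 0 <= y' ->
    A * (expR (- (K * y')) / y' `^ (1 + alpha)) <= levy_const / y' `^ (1 + alpha).
  move=> A0 AC K0 y0; apply: ler_pM => //.
    by rewrite divr_ge0 ?expR_ge0 ?powR_ge0.
  rewrite ler_piMl ?invr_ge0 ?powR_ge0// -expR0 ler_expR oppr_le0.
  by rewrite mulr_ge0// ltW.
rewrite /dens /levy_density; case: ifPn => y0.
  rewrite gtr0_norm//; apply: le1 => //; last exact: ltW.
  - by rewrite !mulr_ge0 ?invr_ge0 ?powR_ge0 ?Gamma_ge0// ltW.
  - by rewrite /levy_const le_max lexx.
case: ifPn => y0'; last by rewrite mulr_ge0 ?invr_ge0 ?powR_ge0.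
apply: le1 => //.
- by rewrite !mulr_ge0 ?invr_ge0 ?powR_ge0 ?Gamma_ge0// subr_ge0 ltW.
- by rewrite /levy_const le_max lexx orbT.
Qed.

Let densE0 y : (0 <= (dens y)%:E)%E.
Proof. by rewrite lee_fin levy_density_ge0. Qed.

Let mdensE : measurable_fun setT (fun y => (dens y)%:E).
Proof. by apply/measurable_EFinP; exact: measurable_levy_density. Qed.

Let nu := density_measure lebesgue_measure densE0 mdensE.

Let nu_sigma_finite : sigma_finite setT nu.
Proof.
exists (fun n => `[- n%:R, n%:R] `&` [set y | dens y <= n%:R]).
  apply/seteqP; split => // y _.
  have [n yn] : exists n : nat, `|y| <= n%:R.
    by exists (Num.truncn `|y|).+1; rewrite ltW// truncnS_gt.
  have [k yk] : exists k : nat, dens y <= k%:R.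
    by exists (Num.truncn (dens y)).+1; rewrite ltW// truncnS_gt.
  exists (maxn n k) => //; split => /=.
    rewrite in_itv/= -ler_norml (le_trans yn)// ler_nat leq_maxl//.
  by rewrite (le_trans yk)// ler_nat leq_maxr.
move=> n; have mS : measurable (`[- n%:R, n%:R] `&` [set y | dens y <= n%:R]).
  apply: measurableI => //; rewrite -[X in measurable X]setTI.
  by apply: measurable_fun_le => //; exact: measurable_levy_density.
split => //.
set S := (X in measurable X) in mS *.
have le_nu : (nu S <= (n%:R)%:E * lebesgue_measure S)%E.
  rewrite /nu /density_measure -integral_cst//.
  apply: ge0_le_integral => //; first exact: measurable_funTS.
  by move=> y [_ /=]; rewrite lee_fin.
apply: le_lt_trans le_nu _.
rewrite lte_mul_pinfty ?lee_fin//.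
apply: (@le_lt_trans _ _ (lebesgue_measure (`[- n%:R, n%:R] : set R))).
  by apply: le_measure; rewrite ?inE// => y [].
by rewrite lebesgue_measure_itv/=; case: ifPn => // _; rewrite -EFinB ltry.
Qed.

Let g_ge0 y : 0 <= gfun a y.
Proof. exact: gfun_ge0. Qed.

Let g_le1 y : gfun a y <= 1.
Proof. by rewrite /gfun lerBlDr lerDl expR_ge0. Qed.

Let g_le_sqr y : gfun a y <= a * y ^+ 2.
Proof. by rewrite /gfun lerBlDl -lerBlDr; exact: expR_ge1Dx. Qed.

Lemma measurable_gfun : measurable_fun setT (gfun a).
Proof.
apply: measurable_funB => //; apply: measurableT_comp => //.
apply: measurableT_comp => //; apply: measurable_funM => //.
Qed.

(* The origin belongs to every shell, so that the shells cover the line; the Levy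
   density vanishes there. *)
Let shell (lo hi : R) := [set y : R | y = 0 \/ lo < `|y| <= hi].

Let measurable_shell lo hi : measurable (shell lo hi).
Proof.
rewrite (_ : shell lo hi = [set 0] `|` (@Num.norm _ R) @^-1` `]lo, hi]%classic).
  by apply: measurableU => //; rewrite -[X in measurable X]setTI;
    apply: normr_measurable.
by apply/seteqP; split=> y; rewrite /shell/= in_itv.
Qed.

Let integral_shell lo hi b : 0 < lo -> lo <= hi -> 0 <= b ->
  (forall y, `|y| <= hi -> gfun a y <= b) ->
  (\int[nu]_(y in shell lo hi) (gfun a y)%:E <=
   (b * (levy_const / lo `^ (1 + alpha) * (2 * hi)))%:E)%E.
Proof.
move=> lo0 lohi b0 gb.
have hi0 : 0 <= hi by rewrite (le_trans _ lohi)// ltW.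
have mS := measurable_shell lo hi.
have K0 : 0 <= levy_const / lo `^ (1 + alpha) by rewrite divr_ge0 ?powR_ge0.
have le_nu : (nu (shell lo hi) <=
    (levy_const / lo `^ (1 + alpha))%:E * lebesgue_measure (shell lo hi))%E.
  rewrite /nu /density_measure -integral_cst//.
  apply: ge0_le_integral => //.
  - exact: measurable_funTS.
  move=> y [->|/andP[loy yhi]]; rewrite lee_fin.
    by rewrite /dens /levy_density !ltxx.
  apply: (le_trans (levy_density_le y)); apply: ler_wpM2l => //.
  rewrite lef_pV2 ?posrE ?powR_gt0//; last exact: lt_trans loy.
  by apply: ge0_ler_powR; rewrite ?nnegrE ?(ltW lo0) ?(ltW loy)// ltW// addr_gt0.
have le_leb : (lebesgue_measure (shell lo hi) <= (2 * hi)%:E)%E.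
  apply: (@le_trans _ _ (lebesgue_measure (`[- hi, hi] : set R))).
    apply: le_measure; rewrite ?inE// => y [->|/andP[_]] /=.
      by rewrite in_itv/= oppr_le0 hi0.
    by rewrite in_itv/= -ler_norml.
  rewrite lebesgue_measure_itv/=; case: ifPn => _.
    by rewrite -EFinB lee_fin; lra.
  by rewrite lee_fin mulr_ge0.
apply: (@le_trans _ _ (\int[nu]_(y in shell lo hi) b%:E)%E).
  apply: ge0_le_integral => //.
  - by move=> y _; rewrite lee_fin.
  - by apply: measurable_funTS; apply/measurable_EFinP; exact: measurable_gfun.
  - move=> y [->|/andP[_ yhi]]; rewrite lee_fin gb// normr0//.
rewrite integral_cst// EFinM lee_wpmul2l ?lee_fin//.
by rewrite (le_trans le_nu)// [leRHS]EFinM lee_wpmul2l// lee_fin.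
Qed.

Let exprn_powR (x r : R) k : 0 <= x -> (x ^+ k) `^ r = (x `^ r) ^+ k.
Proof.
move=> x0; elim: k => [|k IH]; first by rewrite !expr0 powR1.
by rewrite !exprS powRM ?exprn_ge0// IH.
Qed.

Let mgE : measurable_fun setT (fun y => (gfun a y)%:E).
Proof. by apply/measurable_EFinP; exact: measurable_gfun. Qed.

(* Near the origin [gfun a y <= a * y ^+ 2], and a dyadic shell of radius [r]
   contributes at most a multiple of [r ^ (2 - alpha)]. *)
Let near0 := \bigcup_k shell (2^-1 ^+ k.+1) (2^-1 ^+ k).

Let integral_near0 : (\int[nu]_(y in near0) (gfun a y)%:E < +oo)%E.
Proof.
set u := (2^-1 : R) `^ (1 + alpha).
have u0 : 0 < u by rewrite powR_gt0.
have uE : 2^-1 ^+ 3 = u * 2^-1 `^ (2 - alpha).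
  rewrite -powRD; last by apply/implyP => _; rewrite gt_eqF.
  by rewrite -powR_mulrn//; congr (_ `^ _); ring.
apply: (@integral_bigcup_geometric _ _ _ nu _ _ (2 * a * levy_const / u)
  (2^-1 `^ (2 - alpha))) => //.
- by move=> k; exact: measurable_shell.
- by rewrite divr_ge0 ?(ltW u0)// !mulr_ge0// ltW.
- rewrite powR_gt0//= [ltRHS](_ : 1 = 1 `^ (2 - alpha)); last by rewrite powR1.
  by apply: gt0_ltr_powR; rewrite ?nnegrE ?subr_gt0// invf_lt1// ltr1n.
move=> k; have h0 n : 0 < (2^-1 : R) ^+ n by rewrite exprn_gt0.
have h01 : (2^-1 : R) <= 1 by rewrite invf_le1// ler1n.
apply: (le_trans (@integral_shell _ _ (a * (2^-1 ^+ k) ^+ 2) _ _ _ _)) => //.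
- by rewrite exprS ler_piMl// ltW.
- by rewrite mulr_ge0 ?sqr_ge0// ltW.
- move=> y yk; apply: (le_trans (g_le_sqr y)); rewrite ler_pM2l//.
  by rewrite -real_normK ?num_real// lerXn2r ?nnegrE// ltW.
rewrite lee_fin exprn_powR// -/u le_eqVlt; apply/orP; left; apply/eqP.
have -> : 2^-1 `^ (2 - alpha) = 2^-1 ^+ 3 / u by rewrite uE mulrAC mulfV ?mul1r ?gt_eqF.
rewrite expr_div_n [u ^+ k.+1]exprS.
have -> : (2^-1 ^+ 3) ^+ k = (2^-1 ^+ k) ^+ 3 :> R by rewrite -!exprM mulnC.
by field; rewrite !gt_eqF ?exprn_gt0.
Qed.

(* Away from the origin [gfun a y <= 1], and a dyadic shell of radius [r]
   contributes at most a multiple of [r ^ - alpha]. *)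
Let far0 := \bigcup_k shell (2 ^+ k) (2 ^+ k.+1).

Let integral_far0 : (\int[nu]_(y in far0) (gfun a y)%:E < +oo)%E.
Proof.
set v := (2 : R) `^ (1 + alpha).
have v0 : 0 < v by rewrite powR_gt0.
have vE : v = 2 * 2 `^ alpha.
  by rewrite /v powRD ?powRr1//; apply/implyP => _; rewrite gt_eqF.
apply: (@integral_bigcup_geometric _ _ _ nu _ _ (4 * levy_const)
  (2 / v)) => //.
- by move=> k; exact: measurable_shell.
- by rewrite mulr_ge0.
- rewrite divr_gt0//= ltr_pdivrMr// mul1r vE ltr_pMr//.
  rewrite [ltLHS](_ : 1 = 1 `^ alpha); last by rewrite powR1.
  by apply: gt0_ltr_powR; rewrite ?nnegrE// ltr1n.
move=> k; have h0 n : 0 < (2 : R) ^+ n by rewrite exprn_gt0.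
apply: (le_trans (@integral_shell _ _ 1 _ _ _ _)) => //.
- by rewrite [leRHS]exprS ler_peMl ?(ltW (h0 k))// ler1n.
rewrite lee_fin exprn_powR// -/v le_eqVlt; apply/orP; left; apply/eqP.
rewrite expr_div_n exprS.
by field; rewrite !gt_eqF ?exprn_gt0.
Qed.

Let near0_far0 y : ~ near0 y -> far0 y.
Proof.
move=> ny; have y1 : 1 < `|y|.
  rewrite ltNge; apply/negP => y1; apply: ny.
  have [->|y0] := eqVneq y 0; first by exists 0%N => //; left.
  have yp : 0 < `|y| by rewrite normr_gt0.
  have exn : exists n, (2^-1 : R) ^+ n.+1 < `|y|.
    exists (Num.truncn `|y|^-1).
    rewrite exprVn -[ltRHS]invrK ltf_pV2 ?posrE ?invr_gt0 ?exprn_gt0//.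
    rewrite (lt_le_trans (truncnS_gt _))// -natrX ler_nat.
    exact/ltnW/ltn_expl.
  case: (ex_minnP exn) => -[|n] Pn nmin.
    by exists 0%N => //; right; rewrite Pn expr0.
  exists n.+1 => //; right; rewrite Pn/=.
  by rewrite leNgt; apply/negP => /nmin; rewrite ltnn.
have exn : exists n, `|y| <= (2 : R) ^+ n.+1.
  exists (Num.truncn `|y|).
  rewrite ltW// (lt_le_trans (truncnS_gt _))// -natrX ler_nat.
  exact/ltnW/ltn_expl.
case: (ex_minnP exn) => -[|n] Pn nmin.
  by exists 0%N => //; right; rewrite Pn expr0 y1.
exists n.+1 => //; right; rewrite Pn andbT.
by rewrite ltNge; apply/negP => /nmin; rewrite ltnn.
Qed.

Lemma levy_integral_gfun : (\int[nu]_y (gfun a y)%:E < +oo)%E.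
Proof.
have mn : measurable near0 by exact: bigcup_measurable.
have mf : measurable far0 by exact: bigcup_measurable.
rewrite -(setUv near0) ge0_integral_setU//; last 4 first.
- exact: measurableC.
- exact: measurable_funTS.
- by move=> y _; rewrite lee_fin.
- by apply/disj_setPCl.
rewrite lte_add_pinfty// (le_lt_trans _ integral_far0)//.
apply: ge0_subset_integral => //.
- exact: measurableC.
- exact: measurable_funTS.
- by move=> y _; rewrite lee_fin.
Qed.

HB.instance Definition _ := Measure_isSigmaFinite.Build _ _ _
  (density_measure lebesgue_measure densE0 mdensE) nu_sigma_finite.

Lemma levy_measure_sigma_finite :
  exists nu : {sigma_finite_measure set R -> \bar R},
    (nu : set R -> \bar R) = levy_measure p M G alpha /\
    (\int[nu]_y (gfun a y)%:E < +oo)%E.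
Proof.
have := @sigma_finite_transport _ _ _ R R
  (density_measure lebesgue_measure densE0 mdensE) id id.
case=> // nu' [nuE nuI]; exists nu'; split => //.
rewrite nuI//; exact: levy_integral_gfun.
Qed.

Variables (kappa eta : R).
Hypothesis eta0 : 0 <= eta.

(** For [x t = expR (kappa * t) * lambda t], the condition that [gamma] is at most
    the left limit of [lambda] says that the level is at most the left limit of
    [x]; the weight is the jump of [x] produced by a kept point. *)
Definition level (z : R * R * R) : R := expR (kappa * z.1.1) * z.2.

Definition weight (z : R * R * R) : \bar R :=
  (expR (kappa * z.1.1) * (eta * gfun a z.1.2))%:E.

Lemma measurable_level : measurable_fun setT level.
Proof.
apply: measurable_funM => //; apply: measurableT_comp => //.
apply: measurable_funM => //; exact: measurableT_comp.
Qed.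

Lemma measurable_weight : measurable_fun setT weight.
Proof.
apply/measurable_EFinP; apply: measurable_funM.
  apply: measurableT_comp => //; apply: measurable_funM => //.
  exact: measurableT_comp.
apply: measurable_funM => //; apply: (measurableT_comp measurable_gfun).
exact: measurableT_comp.
Qed.

Lemma weight_ge0 z : (0 <= weight z)%E.
Proof. by rewrite lee_fin mulr_ge0 ?expR_ge0// mulr_ge0. Qed.

(** In the mean weight of a cell the factor [expR (kappa * s)] of the weight cancels
    against the length [q / expR (kappa * s)] of the range of [gamma] in which the
    level is below [q], so the result does not depend on the position in time. *)
Lemma intensity_sigma_finite :
  exists (m : {sigma_finite_measure set (R * R * R)%type -> \bar R}) (c : R),
    [/\ (m : set (R * R * R) -> \bar R) = intensity p M G alpha, 0 <= c &
      forall s u q, 0 <= s -> s <= u -> 0 <= q ->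
      (\int[m]_(z in [set z | (s < z.1.1 <= u)%R /\ (level z < q)%R]) weight z
       = (c * (u - s) * q)%:E)%E].
Proof.
have [nu' [nuE nuI]] := levy_measure_sigma_finite.
have [leb0 leb0E] : exists l : {sigma_finite_measure set (measurableTypeR R) -> \bar R},
  (l : set (measurableTypeR R) -> \bar R) = half_line_measure by exists half_line_measure.
have := @sigma_finite_transport _ _ _ (R * R * R)%type R
  (sigma_finite_product (sigma_finite_product leb0 nu') leb0) id id.
case => // m [mE mI].
exists m, (eta * fine (\int[nu']_y (gfun a y)%:E)).
have c0 : (0 <= \int[nu']_y (gfun a y)%:E)%E.
  by apply: integral_ge0 => y _; rewrite lee_fin.
split; first by rewrite mE /intensity -nuE -/half_line_measure -leb0E.
  by rewrite mulr_ge0// fine_ge0.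
move=> s u q s0 su q0.
set S := (X in (\int[m]_(z in X) _)%E).
have mS : measurable S.
  rewrite (_ : S = (fun z => z.1.1) @^-1` `]s, u] `&` level @^-1` `]-oo, q[).
    apply: measurableI; rewrite -[X in measurable X]setTI.
      by apply: measurableT_comp.
    by apply: measurable_level.
  by apply/seteqP; split => z; rewrite /S/= !in_itv.
have mf : measurable_fun setT (weight \_ S).
  apply/(measurable_restrictT _ mS); apply: measurable_funTS.
  exact: measurable_weight.
have f0 z : (0 <= (weight \_ S) z)%E.
  by apply: erestrict_ge0 => *; exact: weight_ge0.
rewrite integral_mkcond mI//.
have leb0I (lo hi : R) : 0 <= hi -> 0 <= lo <= hi ->
    leb0 `]lo, hi]%classic = (hi - lo)%:E /\ leb0 `]-oo, hi[%classic = hi%:E.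
  move=> hi0 /andP[lo0 lohi]; rewrite leb0E /half_line_measure /mrestr/=; split.
    rewrite setIidl; last first.
      by move=> x /=; rewrite !in_itv/= andbT => /andP[/ltW + _]; exact: le_trans.
    rewrite lebesgue_measure_itv/= lte_fin; case: ltgtP lohi => // -> _.
    by rewrite subrr.
  rewrite (_ : _ `&` _ = `[0, hi[%classic); last first.
    apply/seteqP; split => x /=; rewrite !in_itv/= ?andbT; first by move=> [-> ->].
    by move=> /andP[-> ->].
  rewrite lebesgue_measure_itv/= lte_fin; case: ltgtP hi0 => // [_|<-] _ //.
  by rewrite oppr0 adde0.
have inner (w : R * R) : fubini_F leb0 (weight \_ S) w =
    ((q * (\1_`]s, u]%classic w.1))%:E * (eta * gfun a w.2)%:E)%E.
  rewrite /fubini_F; set e := expR (kappa * w.1).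
  have e0 : 0 < e by exact: expR_gt0.
  rewrite indicE; case: (boolP (w.1 \in _)) => /= wsu; last first.
    rewrite mulr0 mul0e; under eq_integral.
      move=> g _; rewrite patchE memNset.
        over.
      by move=> [/= h _]; move/negP: wsu; apply; rewrite inE/= in_itv.
    by rewrite integral0.
  have [su1 su2] : s < w.1 /\ w.1 <= u.
    by move: wsu; rewrite inE/= in_itv => /andP[].
  have q1 : 0 <= q / e by rewrite divr_ge0// ltW.
  have q2 : (0 : R) <= 0 <= q / e by apply/andP.
  have [_ leb0q] := leb0I 0 (q / e) q1 q2.
  rewrite mulr1 (_ : (fun g => _) =
      cst (e * (eta * gfun a w.2))%:E \_ `]-oo, (q / e)[%classic); last first.
    apply/funext => g; rewrite !patchE/=; congr (if _ then _ else _).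
    apply/idP/idP; rewrite !inE/= in_itv/= /level/= -/e ltr_pdivlMr// mulrC.
      by case.
    by move=> ?; split => //; apply/andP.
  transitivity ((e * (eta * gfun a w.2))%:E * leb0 `]-oo, (q / e)%R[%classic)%E.
    by rewrite -integral_mkcond integral_cst.
  rewrite leb0q -!EFinM; congr EFin.
  by field; rewrite gt_eqF.
transitivity (\int[sigma_finite_product leb0 nu']_w
    ((q * (\1_`]s, u]%classic w.1))%:E * (eta * gfun a w.2)%:E)%E)%E.
  transitivity (\int[sigma_finite_product leb0 nu']_w
      fubini_F leb0 (weight \_ S) w)%E; last first.
    by apply: eq_integral => w _; exact: inner.
  exact: (@fubini_tonelli1 _ _ _ _ R (sigma_finite_product leb0 nu') leb0
    (weight \_ S) mf f0).
rewrite (@fubini_tonelli1 _ _ _ _ R leb0 nu'); last 2 first.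
- apply: emeasurable_funM; apply/measurable_EFinP.
    apply: measurable_funM => //; exact: measurableT_comp.
  apply: measurable_funM => //; apply: (measurableT_comp measurable_gfun).
  exact: measurable_snd.
- by move=> w; rewrite mule_ge0// lee_fin mulr_ge0.
transitivity (\int[leb0]_x ((q * (\1_`]s, u]%classic x))%:E *
    (eta * fine (\int[nu']_y (gfun a y)%:E))%:E)%E)%E.
  apply: eq_integral => x _; rewrite /fubini_F/= ge0_integralZl//; last 3 first.
  - apply/measurable_EFinP; apply: measurable_funM => //; exact: measurable_gfun.
  - by move=> y _; rewrite lee_fin mulr_ge0.
  - by rewrite lee_fin mulr_ge0.
  congr (_ * _)%E; under eq_integral do rewrite EFinM.
  rewrite ge0_integralZl//; last by move=> y _; rewrite lee_fin.
  by rewrite EFinM fineK// ge0_fin_numE.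
rewrite ge0_integralZr//; last 3 first.
- by apply/measurable_EFinP; apply: measurable_funM.
- by move=> x _; rewrite lee_fin mulr_ge0.
- by rewrite lee_fin mulr_ge0// fine_ge0.
under eq_integral do rewrite EFinM.
rewrite ge0_integralZl//; last exact/measurable_EFinP.
have su' : 0 <= s <= u by rewrite s0.
have [leb0su _] := leb0I s u (le_trans s0 su) su'.
transitivity (q%:E * leb0 `]s, u]%classic *
    (eta * fine (\int[nu']_y (gfun a y)%:E))%:E)%E.
  by rewrite integral_indic// setIT.
rewrite leb0su -!EFinM; congr EFin.
by rewrite mulrC mulrA mulrAC.
Qed.

End levy.

(** * Cells whose threshold depends on the past *)

Section monotone_sequence.
Context {R : realType}.
Implicit Types (u : (\bar R)^nat) (l y : \bar R).

Lemma nondecreasing_cvg_ub u l k : nondecreasing_seq u -> u n @[n --> \oo] --> l ->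
  (u k <= l)%E.
Proof.
move=> ndu ul; have /cvg_lim <- // := ul.
have /cvg_lim -> // := ereal_nondecreasing_cvgn ndu.
by apply: ereal_sup_ubound; exists k.
Qed.

Lemma cvg_gt u l y : u n @[n --> \oo] --> l -> (y < l)%E -> exists k, (y < u k)%E.
Proof.
move=> ul yl; have [k _ uk] := ul _ (open_ereal_gt' yl).
by exists k; exact: (uk k (leqnn k)).
Qed.

End monotone_sequence.

Section cell.
Local Open Scope ereal_scope.
Context d (Omega : measurableType d) (R : realType) (Q : probability Omega R).
Context dT (T : measurableType dT).
Variables (F : R -> set (set Omega)) (fF : filtration F).
Variables (tau lev : T -> R).
Hypotheses (mtau : measurable_fun setT tau) (mlev : measurable_fun setT lev).
Variables (n : Omega -> {measure set T -> \bar R}) (c : R).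

Definition cell (s u q : R) := [set z | (s < tau z <= u)%R /\ (lev z < q)%R].

Definition adapted_random_measure := forall (t : R) (A : set T), (0 <= t)%R ->
  measurable A -> A `<=` [set z | (tau z <= t)%R] ->
  measurable_wrt (F t) (fun w => n w A).

Definition cell_intensity := forall (s u q : R) (E : set Omega),
  (0 <= s)%R -> (s <= u)%R -> (0 <= q)%R -> F s E ->
  \int[Q]_(w in E) n w (cell s u q) = Q E * (c * (u - s) * q)%:E.

Hypotheses (c0 : (0 <= c)%R) (nF : adapted_random_measure) (nc : cell_intensity).

Let sF (t : R) : (0 <= t)%R -> sigma_algebra setT (F t).
Proof. by case: fF => + _ _; exact. Qed.

Let Fm (t : R) : (0 <= t)%R -> F t `<=` measurable.
Proof. by case: fF => _ + _; exact. Qed.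

Let FS (s t : R) : (0 <= s)%R -> (s <= t)%R -> F s `<=` F t.
Proof. by case: fF => _ _; exact. Qed.

Lemma measurable_wrt_fun (t : R) d' (Y : measurableType d') (X : Omega -> Y) :
  (0 <= t)%R -> measurable_wrt (F t) X -> measurable_fun setT X.
Proof. by move=> t0 FX _ B mB; rewrite setTI; apply: (Fm t0); exact: FX. Qed.

Lemma measurable_time (s u : R) : measurable [set z | (s < tau z <= u)%R].
Proof.
rewrite (_ : [set z | _] = tau @^-1` `]s, u]%classic); last first.
  by apply/seteqP; split => z /=; rewrite in_itv.
by rewrite -[X in measurable X]setTI; exact: mtau.
Qed.

Lemma measurable_lev (q : \bar R) : measurable [set z | (lev z)%:E < q].
Proof.
rewrite -[X in measurable X]setTI; apply: emeasurable_fun_infty_o => //.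
exact/measurable_EFinP.
Qed.

Lemma measurable_cell (s u q : R) : measurable (cell s u q).
Proof.
apply: measurableI; first exact: measurable_time.
rewrite (_ : (fun _ => _) = [set z | (lev z)%:E < q%:E]); first exact: measurable_lev.
by apply/seteqP; split => z /=; rewrite lte_fin.
Qed.

Import HBNNSimple.

Section random_level.
Variables (s u : R) (s0 : (0 <= s)%R) (su : (s <= u)%R).

Let u0 : (0 <= u)%R := le_trans s0 su.

Let cell_measurable q : measurable_wrt (F u) (fun w => n w (cell s u q)).
Proof. by apply: nF => //; [exact: measurable_cell|move=> z [/andP[]]]. Qed.

Let cell_simple (phi : {nnsfun g_sigma_algebraType (F s) >-> R}) :
  measurable_wrt (F u) (fun w => n w (cell s u (phi w))) /\
  \int[Q]_w n w (cell s u (phi w)) = (c * (u - s))%:E * \int[Q]_w (phi w)%:E.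
Proof.
have Fphi q : F s (phi @^-1` [set q]).
  by rewrite -(measurable_sub (sF s0)); exact: measurable_sfunP.
have mphi q : measurable (phi @^-1` [set q] : set Omega) by exact: Fm (Fphi q).
have cellE w : n w (cell s u (phi w)) =
    \sum_(q \in range phi) (\1_(phi @^-1` [set q]) w)%:E * n w (cell s u q).
  rewrite (fsbigD1 (phi w)) => [|//|]; last by exists w.
  rewrite indicE mem_set// mul1e fsbig1 => [|q [_ /= qphi]]; first by rewrite /= adde0.
  by rewrite indicE memNset ?mul0e// => /= /esym.
have phiE w : (phi w)%:E =
    \sum_(q \in range phi) (\1_(phi @^-1` [set q]) w)%:E * q%:E.
  rewrite (fsbigD1 (phi w)) => [|//|]; last by exists w.
  rewrite indicE mem_set// mul1e fsbig1 => [|q [_ /= qphi]]; first by rewrite /= adde0.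
  by rewrite indicE memNset ?mul0e// => /= /esym.
split.
  under eq_fun do rewrite cellE.
  apply/(measurable_wrtP (sF u0)).
  apply: (@emeasurable_fsum _ (g_sigma_algebraType (F u))) => // q.
  apply: emeasurable_funM; last exact/(measurable_wrtP (sF u0)).
  apply/measurable_EFinP; apply: measurable_indic.
  by rewrite (measurable_sub (sF u0)); apply: FS (Fphi q).
under eq_integral do rewrite cellE.
rewrite ge0_integral_fsum//; last first.
  move=> q; apply: emeasurable_funM; last exact: (measurable_wrt_fun u0).
  exact/measurable_EFinP/measurable_indic.
under [in RHS]eq_integral do rewrite phiE.
rewrite [in RHS]ge0_integral_fsum//; last 2 first.
- move=> q; apply: emeasurable_funM => //.
  exact/measurable_EFinP/measurable_indic.
- move=> q w _; have [q0|q0] := leP 0%R q; first by rewrite mule_ge0// lee_fin.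
  by rewrite preimage_nnfun0// indic0 mul0e.
rewrite ge0_mule_fsumr; last first.
  move=> q; apply: integral_ge0 => w _.
  have [q0|q0] := leP 0%R q; first by rewrite mule_ge0// lee_fin.
  by rewrite preimage_nnfun0// indic0 mul0e.
apply: eq_fsbigr => q; rewrite inE => -[w _ wq].
have q0 : (0 <= q)%R by rewrite -wq.
transitivity (\int[Q]_(w in phi @^-1` [set q]) n w (cell s u q)).
  rewrite [RHS]integral_mkcond; apply: eq_integral => v _.
  by rewrite patchE indicE; case: ifPn => _; rewrite ?mul1e ?mul0e.
rewrite nc//; transitivity ((c * (u - s))%:E * (Q (phi @^-1` [set q]) * q%:E)).
  by rewrite EFinM muleCA.
congr (_ * _); rewrite ge0_integralZr//; last 1 first.
  exact/measurable_EFinP/measurable_indic.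
by rewrite integral_indic// setIT.
Qed.

(** The deterministic threshold [q] of a cell can be replaced by any variable known
    at the beginning of its time interval: for a simple threshold the mass is that of
    deterministic cells split over events of the past, and a general threshold is an
    increasing limit of simple ones. *)
Lemma random_level (X : Omega -> \bar R) : (forall w, 0 <= X w) ->
    measurable_wrt (F s) X ->
  let V w := n w [set z | (s < tau z <= u)%R /\ (lev z)%:E < X w] in
  measurable_wrt (F u) V /\
  \int[Q]_w V w = (c * (u - s))%:E * \int[Q]_w X w.
Proof.
move=> X0 FX V.
have mX : measurable_fun setT (X : g_sigma_algebraType (F s) -> \bar R).
  exact/(measurable_wrtP (sF s0)).
pose phi := nnsfun_approx measurableT mX.
have phi_nd w : nondecreasing_seq (fun k => phi k w).
  by move=> a b ab; exact/lefP/nd_nnsfun_approx.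
have phi_cvg w : (phi k w)%:E @[k --> \oo] --> X w.
  exact: (cvg_nnsfun_approx measurableT mX (fun w _ => X0 w)).
have V_cvg w : n w (cell s u (phi k w)) @[k --> \oo] --> V w.
  rewrite /V; set D := [set z | _].
  have -> : D = \bigcup_k cell s u (phi k w).
    apply/seteqP; split => [z [zsu zX]|z [k _ [zsu zk]]]; last first.
      split => //; rewrite (@lt_le_trans _ _ (phi k w)%:E) ?lte_fin//.
      apply: nondecreasing_cvg_ub (phi_cvg w) => a b ab.
      by rewrite lee_fin; exact: phi_nd.
    by have [k zk] := cvg_gt (phi_cvg w) zX; exists k => //; split => //;
      rewrite -lte_fin.
  apply: nondecreasing_cvg_mu.
  - by move=> k; exact: measurable_cell.
  - by apply: bigcupT_measurable => k; exact: measurable_cell.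
  - move=> a b ab; apply/subsetPset => z [zsu za]; split => //.
    by rewrite (lt_le_trans za)//; exact: phi_nd.
split.
  apply/(measurable_wrtP (sF u0)).
  apply: (@emeasurable_fun_cvg _ (g_sigma_algebraType (F u)) _ _
    (fun k w => n w (cell s u (phi k w)))) => [k|w _]; last exact: V_cvg.
  by apply/(measurable_wrtP (sF u0)); have [] := cell_simple (phi k).
transitivity (limn (fun k => \int[Q]_w n w (cell s u (phi k w)))).
  rewrite -monotone_convergence//.
  - by apply: eq_integral => w _; apply/esym/cvg_lim => //; exact: V_cvg.
  - by move=> k; apply: (measurable_wrt_fun u0); have [] := cell_simple (phi k).
  - move=> w _ a b ab; apply: le_measure; rewrite ?inE; try exact: measurable_cell.
    by move=> z [zsu za]; split => //; rewrite (lt_le_trans za)//; exact: phi_nd.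
under eq_fun do rewrite (cell_simple (phi _)).2.
have mphi k : measurable_fun setT (fun w : Omega => (phi k w)%:E).
  apply/measurable_EFinP => _ B mB; rewrite setTI; apply: (Fm s0).
  rewrite -(measurable_sub (sF s0)) -[X in measurable X]setTI.
  exact: measurable_funP.
have Xlim : \int[Q]_w (phi k w)%:E @[k --> \oo] --> \int[Q]_w X w.
  rewrite (_ : \int[Q]_w X w = \int[Q]_w limn (fun k => (phi k w)%:E)); last first.
    by apply: eq_integral => w _; apply/esym/cvg_lim.
  apply: cvg_monotone_convergence => //.
  - by move=> k w _; rewrite lee_fin.
  - by move=> w _ a b ab; rewrite lee_fin; exact: phi_nd.
by apply/cvg_lim => //; apply: cvgeZl.
Qed.

End random_level.

End cell.

(** * Mass below a nondecreasing path *)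

Section accumulation.
Local Open Scope ereal_scope.
Context d (Omega : measurableType d) (R : realType) (Q : probability Omega R).
Context dT (T : measurableType dT).
Variables (F : R -> set (set Omega)) (fF : filtration F).
Variables (tau lev : T -> R).
Hypotheses (mtau : measurable_fun setT tau) (mlev : measurable_fun setT lev).
Variables (n : Omega -> {measure set T -> \bar R}) (c : R).
Hypotheses (c0 : (0 <= c)%R) (nF : adapted_random_measure F tau n).
Hypothesis nc : cell_intensity Q F tau lev n c.

Let sF (t : R) : (0 <= t)%R -> sigma_algebra setT (F t).
Proof. by case: fF => + _ _; exact. Qed.

Let FS (s t : R) : (0 <= s)%R -> (s <= t)%R -> F s `<=` F t.
Proof. by case: fF => _ _; exact. Qed.

Definition increasing_process (x : R -> Omega -> \bar R) :=
  [/\ forall t w, (0 <= t)%R -> 0 <= x t w,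
      forall w s t, (0 <= s)%R -> (s <= t)%R -> x s w <= x t w &
      forall t, (0 <= t)%R -> measurable_wrt (F t) (x t)].

(** For a nondecreasing path, these are the points with level strictly below the left
    limit of the path at their time. *)
Definition region (x : R -> \bar R) : set T :=
  [set z | exists r, [/\ (0 <= r)%R, (r < tau z)%R & (lev z)%:E < x r]].

Definition accum (m : {measure set T -> \bar R}) (x : R -> \bar R) (t : R) :=
  m ([set z | (tau z <= t)%R] `&` region x).

Definition grid (t : R) k i : R := (i%:R * (t / 2 ^+ k))%R.

Definition riemann (f : R -> \bar R) t k :=
  \sum_(i < 2 ^ k) (t / 2 ^+ k)%:E * f (grid t k i).

Definition stair (x : R -> \bar R) t k i := [set z |
  (grid t k i < tau z <= grid t k i.+1)%R /\ (lev z)%:E < x (grid t k i)].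

Definition staircase x t k := \big[setU/set0]_(i < 2 ^ k) stair x t k i.

Lemma grid_ge0 t k i : (0 <= t)%R -> (0 <= grid t k i)%R.
Proof. by move=> t0; rewrite mulr_ge0// divr_ge0// exprn_ge0. Qed.

Lemma grid_le t k i j : (0 <= t)%R -> (i <= j)%N -> (grid t k i <= grid t k j)%R.
Proof. by move=> t0 ij; rewrite ler_wpM2r ?ler_nat// divr_ge0// exprn_ge0. Qed.

Lemma grid_last t k : grid t k (2 ^ k) = t.
Proof. by rewrite /grid natrX mulrC divfK// expf_neq0. Qed.

Lemma grid_double t k i : grid t k.+1 i.*2 = grid t k i.
Proof.
rewrite /grid -muln2 natrM exprS; field.
by rewrite expf_neq0.
Qed.

Let mem_staircase x t k z : staircase x t k z <->
  exists2 i, (i < 2 ^ k)%N & stair x t k i z.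
Proof.
by rewrite /staircase -bigcup_mkord; split=> -[i /= ik zi]; exists i.
Qed.

Let measurable_stair x t k i : measurable (stair x t k i).
Proof.
by apply: measurableI; [exact: measurable_time|exact: measurable_lev].
Qed.

Let measurable_staircase x t k : measurable (staircase x t k).
Proof. exact: bigsetU_measurable. Qed.

Let staircase_measure (m : {measure set T -> \bar R}) x t k : (0 <= t)%R ->
  m (staircase x t k) = \sum_(i < 2 ^ k) m (stair x t k i).
Proof.
move=> t0; rewrite /staircase.
rewrite (@measure_semi_additive_ord _ _ _ m (2 ^ k)%N (fun i => stair x t k i))//.
  apply/trivIsetP => i j _ _ ij.
  wlog ltij : i j ij / (i < j)%N.
    move=> H; have := ij; rewrite -val_eqE /= neq_ltn => /orP[|] ltij; first exact: H.
    by rewrite setIC; apply: H => //; rewrite eq_sym.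
  apply/seteqP; split => // z [[/andP[_ zi] _] [/andP[jz _] _]].
  have := lt_le_trans jz zi; rewrite ltNge.
  by rewrite (grid_le _ t0 ltij).
exact: measurable_staircase.
Qed.

Section path.
Variables (x : R -> \bar R).
Hypothesis ndx : forall s t, (0 <= s)%R -> (s <= t)%R -> x s <= x t.

(** Monotonicity allows the intermediate time to be rational. *)
Lemma measurable_region : measurable (region x).
Proof.
rewrite (_ : region x = \bigcup_(q : rat)
    (if (0 <= (ratr q : R))%R then [set z | (ratr q < tau z)%R] `&`
      [set z | (lev z)%:E < x (ratr q)] else set0)).
  apply: bigcupT_measurable_rat => q; case: ifPn => _ //.
  apply: measurableI; last exact: measurable_lev.
  rewrite -[X in measurable X]setTI.
  rewrite (_ : [set z | _] = tau @^-1` `]ratr q, +oo[%classic); first exact: mtau.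
  by apply/seteqP; split => z /=; rewrite in_itv/= andbT.
apply/seteqP; split=> [z [r [r0 rz zx]]|z [q _]]; last first.
  by case: ifPn => // q0 [qz zq]; exists (ratr q).
have [q] := rat_in_itvoo rz; rewrite in_itv/= => /andP[rq qz].
have q0 : (0 <= ratr q :> R)%R by rewrite (le_trans r0)// ltW.
exists q => //; rewrite q0; split => //=.
by rewrite (lt_le_trans zx)// ndx// ltW.
Qed.

Lemma staircase_nd t : (0 <= t)%R -> {homo staircase x t : a b / (a <= b)%N >-> (a <= b)%O}.
Proof.
move=> t0; apply/nondecreasing_seqP => k; apply/subsetPset => z.
move=> /mem_staircase[i ik [/andP[iz zi] zx]]; apply/mem_staircase.
have [zm|mz] := leP (tau z) (grid t k.+1 i.*2.+1).
  exists i.*2; first by rewrite expnS mul2n ltn_double.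
  by rewrite /stair/= grid_double iz zm.
exists i.*2.+1; first by rewrite expnS mul2n ltn_Sdouble.
rewrite /stair/= -doubleS grid_double mz zi; split => //.
rewrite (lt_le_trans zx)//; apply: ndx; first exact: grid_ge0.
by rewrite -grid_double grid_le.
Qed.

(** A point kept by the path because of an earlier time [r] lies in a staircase as
    soon as the mesh is smaller than the delay after [r]: the left end of its
    dyadic interval is then beyond [r]. *)
Lemma staircase_cover t : (0 <= t)%R ->
  \bigcup_k staircase x t k = [set z | (tau z <= t)%R] `&` region x.
Proof.
move=> t0; apply/seteqP; split=> [z [k _ /mem_staircase[i ik [/andP[iz zi] zx]]]|].
  split; first by rewrite /= (le_trans zi)// -[leRHS](grid_last t k) grid_le.
  by exists (grid t k i); split => //; exact: grid_ge0.
move=> z [/= zt [r [r0 rz zx]]].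
have zr : (0 < tau z - r)%R by rewrite subr_gt0.
pose k := Num.truncn (t / (tau z - r)).
have tk : (t / 2 ^+ k < tau z - r)%R.
  rewrite ltr_pdivrMr ?exprn_gt0// mulrC -ltr_pdivrMr//.
  by rewrite (lt_le_trans (truncnS_gt _))// -natrX ler_nat ltn_expl.
have exi : exists i, (tau z <= grid t k i)%R by exists (2 ^ k)%N; rewrite grid_last.
exists k => //; apply/mem_staircase.
case: (ex_minnP exi) => -[|i] zi imin.
  by move: zi; rewrite /grid mul0r leNgt (le_lt_trans r0 rz).
have iz : (grid t k i < tau z)%R.
  by rewrite ltNge; apply/negP => /imin; rewrite ltnn.
exists i; first by apply: imin; rewrite grid_last.
split; first by rewrite iz zi.
rewrite (lt_le_trans zx)//; apply: ndx => //.
move: zi; rewrite /grid -natr1 mulrDl mul1r.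
move: tk; set h := (t / 2 ^+ k)%R; set g := (_ * h)%R; lra.
Qed.

Lemma accum_cvg (m : {measure set T -> \bar R}) t : (0 <= t)%R ->
  m (staircase x t k) @[k --> \oo] --> accum m x t.
Proof.
move=> t0; rewrite /accum -staircase_cover//; apply: nondecreasing_cvg_mu => //.
- exact: bigcupT_measurable.
- exact: staircase_nd.
Qed.

End path.

Section process.
Variables (x : R -> Omega -> \bar R) (Hx : increasing_process x).
Variables (t : R) (t0 : (0 <= t)%R).

Let x_ge0 s w : (0 <= s)%R -> 0 <= x s w.
Proof. by case: Hx => + _ _; exact. Qed.

Let x_nd w : forall s u, (0 <= s)%R -> (s <= u)%R -> x s w <= x u w.
Proof. by case: Hx => _ + _; exact. Qed.

Let Fx s : (0 <= s)%R -> measurable_wrt (F s) (x s).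
Proof. by case: Hx => _ _; exact. Qed.

Let stair_level k i := @random_level _ _ _ Q _ _ F fF tau lev mtau mlev n c nF nc
  (grid t k i) (grid t k i.+1) (grid_ge0 k i t0) (grid_le k t0 (leqnSn i))
  (x (grid t k i)) (fun w => x_ge0 w (grid_ge0 k i t0)) (Fx (grid_ge0 k i t0)).

Let Fstair k (i : 'I_(2 ^ k)) :
  measurable_wrt (F t) (fun w => n w (stair (x ^~ w) t k i)).
Proof.
have [+ _] := stair_level k i; apply: measurable_wrt_mono; apply: FS.
  exact: grid_ge0.
by rewrite -[leRHS](grid_last t k) grid_le.
Qed.

Let Fstaircase k : measurable_wrt (F t) (fun w => n w (staircase (x ^~ w) t k)).
Proof.
apply/(measurable_wrtP (sF t0)).
under eq_fun do rewrite staircase_measure//.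
apply: (@emeasurable_sum _ (g_sigma_algebraType (F t))) => i.
exact/(measurable_wrtP (sF t0)).
Qed.

Lemma accum_adapted : measurable_wrt (F t) (fun w => accum (n w) (x ^~ w) t).
Proof.
apply/(measurable_wrtP (sF t0)).
apply: (@emeasurable_fun_cvg _ (g_sigma_algebraType (F t)) _ _
  (fun k w => n w (staircase (x ^~ w) t k))) => [k|w _].
  exact/(measurable_wrtP (sF t0)).
by apply: accum_cvg => //; exact: x_nd.
Qed.

(** Each step of a staircase is a random cell, whose mean mass is proportional to the
    mean of the process at the left end of the step. *)
Lemma accum_mean :
  c%:E * riemann (fun s => \int[Q]_w x s w) t k @[k --> \oo] -->
  \int[Q]_w accum (n w) (x ^~ w) t.
Proof.
rewrite (_ : (fun k => _) = fun k => \int[Q]_w n w (staircase (x ^~ w) t k)).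
  rewrite (_ : \int[Q]_w accum _ _ _ =
      \int[Q]_w limn (fun k => n w (staircase (x ^~ w) t k))).
    apply: cvg_monotone_convergence => //.
    - by move=> k; apply: (measurable_wrt_fun fF t0).
    - move=> w _ a b ab; apply: le_measure; rewrite ?inE//.
      by apply/subsetPset; apply: staircase_nd => //; exact: x_nd.
  apply: eq_integral => w _; apply/esym/cvg_lim => //; apply: accum_cvg => //.
  exact: x_nd.
apply/funext => k.
under [RHS]eq_integral do rewrite staircase_measure//.
rewrite ge0_integral_sum//; last first.
  by move=> i; apply: (measurable_wrt_fun fF t0).
rewrite /riemann ge0_sume_distrr; last first.
  move=> i _; rewrite mule_ge0// ?lee_fin ?divr_ge0 ?exprn_ge0//.
  by apply: integral_ge0 => w _; apply: x_ge0; exact: grid_ge0.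
apply: eq_bigr => i _; have [_ ->] := stair_level k i.
rewrite muleA -EFinM; congr (_%:E * _).
by rewrite /grid -[i.+1%:R]natr1 mulrDl mul1r addrAC subrr add0r.
Qed.

End process.

End accumulation.

(** * The monotone operator and its least fixed point, path by path *)

Section operator.
Local Open Scope ereal_scope.
Context (R : realType) dT (T : measurableType dT).
Variables (tau lev : T -> R).
Hypotheses (mtau : measurable_fun setT tau) (mlev : measurable_fun setT lev).
Variables (drift : R -> R) (m : {measure set T -> \bar R}).
Hypothesis drift_ge0 : forall t, (0 <= t)%R -> (0 <= drift t)%R.
Hypothesis drift_nd : forall s t, (0 <= s)%R -> (s <= t)%R -> (drift s <= drift t)%R.
Implicit Types x y : R -> \bar R.

Definition nondecreasing_path x :=
  forall s t, (0 <= s)%R -> (s <= t)%R -> x s <= x t.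

Definition le_path x y := forall t, (0 <= t)%R -> x t <= y t.

Definition operator (m : {measure set T -> \bar R}) x t :=
  (drift t)%:E + accum tau lev m x t.

Lemma measurable_before (t : R) : measurable [set z | (tau z <= t)%R].
Proof.
rewrite (_ : [set z | _] = tau @^-1` `]-oo, t]%classic); last first.
  by apply/seteqP; split => z /=; rewrite in_itv.
by rewrite -[X in measurable X]setTI; exact: mtau.
Qed.

Lemma measurable_accum x t : nondecreasing_path x ->
  measurable ([set z | (tau z <= t)%R] `&` region tau lev x).
Proof.
move=> ndx; apply: measurableI; first exact: measurable_before.
exact: measurable_region.
Qed.

Lemma region_mono x y : le_path x y -> region tau lev x `<=` region tau lev y.
Proof.
by move=> xy z [r [r0 rz zx]]; exists r; split => //; exact: lt_le_trans zx (xy r r0).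
Qed.

Lemma accum_mono x y t : nondecreasing_path x -> nondecreasing_path y ->
  le_path x y -> accum tau lev m x t <= accum tau lev m y t.
Proof.
move=> ndx ndy xy; apply: le_measure; rewrite ?inE; try exact: measurable_accum.
by apply: setIS; exact: region_mono.
Qed.

Lemma accum_nd x : nondecreasing_path x -> nondecreasing_path (accum tau lev m x).
Proof.
move=> ndx s t s0 st; apply: le_measure; rewrite ?inE; try exact: measurable_accum.
by apply: setSI => z /= zs; rewrite (le_trans zs).
Qed.

Lemma operator_nd x : nondecreasing_path x -> nondecreasing_path (operator m x).
Proof.
move=> ndx s t s0 st; apply: leeD; last exact: accum_nd.
by rewrite lee_fin drift_nd.
Qed.

Lemma operator_mono x y : nondecreasing_path x -> nondecreasing_path y ->
  le_path x y -> le_path (operator m x) (operator m y).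
Proof. by move=> ndx ndy xy t t0; apply: leeD => //; exact: accum_mono. Qed.

Lemma operator_ge0 x : le_path (fun=> 0) (operator m x).
Proof. by move=> t t0; rewrite adde_ge0// lee_fin drift_ge0. Qed.

Fixpoint picard (m : {measure set T -> \bar R}) k : R -> \bar R :=
  if k is k'.+1 then operator m (picard m k') else fun=> 0.

Lemma picard_path k : nondecreasing_path (picard m k).
Proof. by elim: k => //= k IH; exact: operator_nd. Qed.

Lemma picard_ge0 k : le_path (fun=> 0) (picard m k).
Proof. by case: k => //= k; exact: operator_ge0. Qed.

Lemma picard_le_succ k : le_path (picard m k) (picard m k.+1).
Proof.
elim: k => [|k IH]; first exact: operator_ge0.
apply: (@operator_mono (picard m k) (picard m k.+1)) => //; exact: picard_path.
Qed.

Lemma picard_nd t : (0 <= t)%R -> nondecreasing_seq (fun k => picard m k t).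
Proof. by move=> t0; apply/nondecreasing_seqP => k; exact: picard_le_succ. Qed.

Definition minimal (m : {measure set T -> \bar R}) t := limn (fun k => picard m k t).

Lemma minimal_cvg t : (0 <= t)%R -> picard m k t @[k --> \oo] --> minimal m t.
Proof. by move=> t0; apply: ereal_nondecreasing_is_cvgn; exact: picard_nd. Qed.

Lemma picard_le_minimal k : le_path (picard m k) (minimal m).
Proof.
move=> t t0; apply: (nondecreasing_cvg_ub _ (picard_nd t0) (minimal_cvg t0)).
Qed.

Lemma minimal_path : nondecreasing_path (minimal m).
Proof.
move=> s t s0 st; have t0 := le_trans s0 st.
apply: lee_lim; [by apply/cvg_ex; exists (minimal m s); exact: minimal_cvg|
  by apply/cvg_ex; exists (minimal m t); exact: minimal_cvg|].
by apply: nearW => k; exact: picard_path.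
Qed.

Lemma minimal_ge0 : le_path (fun=> 0) (minimal m).
Proof. by move=> t t0; apply: le_trans (picard_le_minimal 0 t0). Qed.

(** The condition [lev z < x r] is strict, so [region] commutes with increasing
    limits of paths. *)
Lemma minimal_fixpoint t : (0 <= t)%R -> minimal m t = operator m (minimal m) t.
Proof.
move=> t0; apply/cvg_lim => //; rewrite -(cvg_shiftS (fun k => picard m k t))/=.
have H : accum tau lev m (picard m k) t @[k --> \oo] --> accum tau lev m (minimal m) t.
  rewrite /accum.
  have <- : \bigcup_k ([set z | (tau z <= t)%R] `&` region tau lev (picard m k)) =
      [set z | (tau z <= t)%R] `&` region tau lev (minimal m).
    rewrite -setI_bigcupr; congr (_ `&` _); apply/seteqP; split.
      by move=> z [k _]; apply: region_mono; exact: picard_le_minimal.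
    move=> z [r [r0 rz /(cvg_gt (minimal_cvg r0))[k zk]]].
    by exists k => //; exists r.
  apply: nondecreasing_cvg_mu.
  - by move=> k; apply: measurable_accum; exact: picard_path.
  - by apply: bigcupT_measurable => k; apply: measurable_accum; exact: picard_path.
  - move=> a b ab; apply/subsetPset; apply: setIS; apply: region_mono => s s0.
    exact: picard_nd.
by apply: cvgeD; [exact: fin_num_adde_defr|exact: cvg_cst|exact: H].
Qed.

Lemma minimal_least y : nondecreasing_path y -> le_path (fun=> 0) y ->
  le_path (operator m y) y -> le_path (minimal m) y.
Proof.
move=> ndy y0 yP t t0; apply: lime_le.
  by apply/cvg_ex; exists (minimal m t); exact: minimal_cvg.
apply: nearW => k; elim: k t t0 => [|k IH] t t0; first exact: y0.
apply: le_trans (yP t t0); apply: operator_mono => //; exact: picard_path.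
Qed.

(** For a nondecreasing path, these are the points with level at most the left limit
    of the path at their time. *)
Definition region_closed x : set T := [set z | forall e : R, (0 < e)%R ->
  exists r, [/\ (0 <= r)%R, (r < tau z)%R & (lev z)%:E < x r + e%:E]].

Definition accum_closed (m : {measure set T -> \bar R}) x t :=
  m ([set z | (tau z <= t)%R] `&` region_closed x).

Lemma region_closed_bigcap x : nondecreasing_path x ->
  region_closed x = \bigcap_k region tau lev (fun t => x t + (k.+1%:R^-1)%:E).
Proof.
move=> ndx; apply/seteqP; split=> z zx.
  by move=> k _; apply: zx; rewrite invr_gt0.
move=> e e0; have [r [r0 rz zr]] := zx (Num.truncn e^-1) I.
exists r; split => //; apply: (lt_le_trans zr); apply: leeD => //.
rewrite lee_fin -[leRHS]invrK lef_pV2 ?posrE ?invr_gt0//.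
by rewrite ltW// truncnS_gt.
Qed.

Lemma shift_path x (e : R) : nondecreasing_path x -> nondecreasing_path (fun t => x t + e%:E).
Proof. by move=> ndx s t s0 st; apply: leeD => //; exact: ndx. Qed.

Lemma measurable_region_closed x : nondecreasing_path x ->
  measurable (region_closed x).
Proof.
move=> ndx; rewrite region_closed_bigcap//; apply: bigcap_measurable => // k _.
by apply: measurable_region => //; exact: shift_path.
Qed.

Lemma measurable_accum_closed x t : nondecreasing_path x ->
  measurable ([set z | (tau z <= t)%R] `&` region_closed x).
Proof.
move=> ndx; apply: measurableI; first exact: measurable_before.
exact: measurable_region_closed.
Qed.

Lemma region_sub_closed x : region tau lev x `<=` region_closed x.
Proof.
move=> z [r [r0 rz zx]] e e0; exists r; split => //.
by rewrite (lt_le_trans zx)// leeDl// lee_fin ltW.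
Qed.

Lemma accum_le_closed x t : nondecreasing_path x ->
  accum tau lev m x t <= accum_closed m x t.
Proof.
move=> ndx; apply: le_measure; rewrite ?inE;
  [exact: measurable_accum|exact: measurable_accum_closed|].
by apply: setIS; exact: region_sub_closed.
Qed.

Lemma accum_closed_le x t (e : R) : nondecreasing_path x -> (0 < e)%R ->
  accum_closed m x t <= accum tau lev m (fun t => x t + e%:E) t.
Proof.
move=> ndx e0; apply: le_measure; rewrite ?inE.
- exact: measurable_accum_closed.
- by apply: measurable_accum; exact: shift_path.
- by apply: setIS => z /(_ _ e0).
Qed.

Lemma accum_closed_nd x s t : nondecreasing_path x -> (s <= t)%R ->
  accum_closed m x s <= accum_closed m x t.
Proof.
move=> ndx st; apply: le_measure; rewrite ?inE; try exact: measurable_accum_closed.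
by apply: setSI => z /= zs; rewrite (le_trans zs).
Qed.

(** Equality of two nested masses is inherited by every shorter horizon, because
    the mass of the difference of the two sets decreases with the horizon. *)
Lemma horizon_mass_eq (P P' : set T) t t' : measurable P -> measurable P' ->
  P `<=` P' -> (t <= t')%R -> m ([set z | (tau z <= t')%R] `&` P) < +oo ->
  m ([set z | (tau z <= t')%R] `&` P') <= m ([set z | (tau z <= t')%R] `&` P) ->
  m ([set z | (tau z <= t)%R] `&` P') = m ([set z | (tau z <= t)%R] `&` P).
Proof.
move=> mP mP' PP' tt fin eq'.
have mA u : measurable ([set z | (tau z <= u)%R] `&` P).
  by apply: measurableI => //; exact: measurable_before.
have mB u : measurable ([set z | (tau z <= u)%R] `&` P').
  by apply: measurableI => //; exact: measurable_before.
have sub u : [set z | (tau z <= u)%R] `&` P `<=` [set z | (tau z <= u)%R] `&` P'.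
  exact: setIS.
have D u : m ([set z | (tau z <= u)%R] `&` P') = m ([set z | (tau z <= u)%R] `&` P) +
    m (([set z | (tau z <= u)%R] `&` P') `\` ([set z | (tau z <= u)%R] `&` P)).
  rewrite -[in LHS](setDUK (sub u)) measureU//.
    exact: measurableD.
  by rewrite setDIK.
rewrite D -[RHS]adde0; congr (_ + _); apply/eqP; rewrite eq_le measure_ge0 andbT.
move: eq'; rewrite D -[leRHS]adde0 leeD2lE; last by rewrite ge0_fin_numE.
apply: le_trans; apply: le_measure; rewrite ?inE; try exact: measurableD.
move=> z [[/= zt zc] nz]; split; first by split => //=; rewrite (le_trans zt).
by move=> [/= _ zx]; apply: nz.
Qed.

(** Before the first passage [sig] of [z] above [K] the path and its truncation
    coincide, so the closed image of the truncation at [sig] is [z sig].  By right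
    continuity [z sig >= K], and after [sig] the image does not decrease. *)
Lemma truncated_le_operator (z : R -> R) (K : R) :
  (forall s t, (0 <= s)%R -> (s <= t)%R -> (z s <= z t)%R) ->
  (forall t, (0 <= t)%R -> z s @[s --> t^'+] --> z t) ->
  (forall t, (0 <= t)%R -> (z t)%:E = (drift t)%:E + accum_closed m (EFin \o z) t) ->
  let y t := (Num.min (z t) K)%:E in
  forall t, (0 <= t)%R -> y t <= (drift t)%:E + accum_closed m y t.
Proof.
move=> ndz rcz zE y t t0.
have ndy : nondecreasing_path y.
  move=> r s r0 rs; rewrite lee_fin le_min ge_min (ndz r s)//=.
  by rewrite ge_min lexx orbT.
have same u : (0 <= u)%R -> (forall r, (0 <= r)%R -> (r < u)%R -> (z r <= K)%R) ->
    (z u)%:E = (drift u)%:E + accum_closed m y u.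
  move=> u0 zK; rewrite zE//; congr (_ + m _); apply/seteqP.
  split=> v [/= vu vz]; split => // e /vz[r [r0 rv zr]]; exists r; split => //;
    move: zr; rewrite /y/= min_l//; apply: zK => //; exact: lt_le_trans rv vu.
have [ztK|Kzt] := leP (z t) K.
  rewrite /y min_l// same// => r r0 rt.
  by rewrite (le_trans _ ztK)// ndz// ltW.
pose S := [set r | [/\ (0 <= r)%R, (r <= t)%R & (K < z r)%R]].
have St : S t by split.
have infS : has_inf S by split; [exists t|exists 0%R => r []].
pose sig := inf S.
have sig0 : (0 <= sig)%R by apply: lb_le_inf; [exists t|move=> r []].
have sigt : (sig <= t)%R by apply: ge_inf => //; case: infS.
have below r : (0 <= r)%R -> (r < sig)%R -> (z r <= K)%R.
  move=> r0 rsig; rewrite leNgt; apply/negP => Kzr.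
  move: (rsig); rewrite ltNge; apply/negP; rewrite negbK.
  by apply: ge_inf; [case: infS|split => //; rewrite (le_trans (ltW rsig))].
have Ksig : (K <= z sig)%R.
  rewrite leNgt; apply/negP => zsig.
  have /(_ _ (lt_nbhsl zsig)) := rcz _ sig0.
  rewrite /= => -[e /= e0 He].
  have [s Ss se] := inf_adherent e0 infS.
  have [s0 st Ks] := Ss.
  have := ge_inf infS.2 Ss; rewrite le_eqVlt => /predU1P[sE|sigs].
    by move: Ks; rewrite -sE ltNge (ltW zsig).
  have := He s; rewrite /= ltr0_norm ?subr_lt0// opprB ltrBlDl => /(_ se sigs).
  by rewrite ltNge (ltW Ks).
apply: (@le_trans _ _ (z sig)%:E).
  by rewrite lee_fin ge_min Ksig orbT.
rewrite same// leeD//; last exact: accum_closed_nd.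
by rewrite lee_fin drift_nd.
Qed.

End operator.

(** * Riemann sums of means *)

Section riemann_sums.
Local Open Scope ereal_scope.
Context {R : realType}.
Implicit Types (f g : R -> \bar R) (t : R) (k : nat).

Let mesh_ge0 t k : (0 <= t)%R -> (0 <= t / 2 ^+ k)%R.
Proof. by move=> t0; rewrite divr_ge0// exprn_ge0. Qed.

Lemma riemann_le f g t k : (0 <= t)%R ->
  (forall s, (0 <= s)%R -> (s <= t)%R -> f s <= g s) -> riemann f t k <= riemann g t k.
Proof.
move=> t0 fg; apply: lee_sum => i _; rewrite lee_wpmul2l ?lee_fin ?mesh_ge0//.
apply: fg; first exact: grid_ge0.
by rewrite -[leRHS](grid_last t k) grid_le// ltnW.
Qed.

Lemma riemannD f g t k : (0 <= t)%R ->
  (forall s, (0 <= s)%R -> 0 <= f s) -> (forall s, (0 <= s)%R -> 0 <= g s) ->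
  riemann (fun s => f s + g s) t k = riemann f t k + riemann g t k.
Proof.
move=> t0 f0 g0; rewrite /riemann -big_split/=; apply: eq_bigr => i _.
by rewrite ge0_muleDr//; [apply: f0|apply: g0]; exact: grid_ge0.
Qed.

Lemma riemann_cst (e : R) t k : riemann (fun=> e%:E) t k = (t * e)%:E.
Proof.
rewrite /riemann; under eq_bigr do rewrite -EFinM.
rewrite sumEFin; congr EFin; rewrite sumr_const card_ord -[LHS]mulr_natr natrX.
by field; rewrite expf_neq0.
Qed.

(** A left Riemann sum of an increasing exponential lies below its integral. *)
Lemma riemann_expR (B b : R) t k : (0 <= t)%R -> (0 <= B)%R -> (0 < b)%R ->
  riemann (fun s => (B * expR (b * s))%:E) t k <= (B / b * expR (b * t))%:E.
Proof.
move=> t0 B0 b0; rewrite /riemann; under eq_bigr do rewrite -EFinM.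
rewrite sumEFin lee_fin.
apply: (@le_trans _ _ (\sum_(i < 2 ^ k)
    (B / b * (expR (b * grid t k i.+1) - expR (b * grid t k i)))))%R.
  apply: ler_sum => i _; rewrite mulrCA -mulrA ler_wpM2l//.
  rewrite ler_pdivlMl// /grid -[i.+1%:R]natr1 mulrDl mul1r mulrDr expRD.
  set h := (t / 2 ^+ k)%R; set E := expR _.
  have E0 : (0 < E)%R by exact: expR_gt0.
  by have := expR_ge1Dx (b * h); set e := expR _ => ?; nra.
rewrite -mulr_sumr -(big_mkord xpredT (fun i => expR (b * grid t k i.+1) -
  expR (b * grid t k i))%R) telescope_sumr// grid_last.
rewrite ler_wpM2l ?divr_ge0 ?(ltW b0)//.
by rewrite lerBlDr lerDl expR_ge0.
Qed.

End riemann_sums.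

Section ae_eq_of_le.
Local Open Scope ereal_scope.
Context d (T : measurableType d) (R : realType).

Lemma ae_eq_of_integral_le (mu : {measure set T -> \bar R}) (f g : T -> \bar R) :
  measurable_fun setT f -> measurable_fun setT g -> (forall x, 0 <= f x) ->
  (forall x, f x <= g x) -> \int[mu]_x f x < +oo ->
  \int[mu]_x g x <= \int[mu]_x f x -> {ae mu, forall x, g x = f x}.
Proof.
move=> mf mg f0 fg foo gf.
pose h x := maxe (g x - f x) 0.
have mh : measurable_fun setT h.
  by apply: measurable_maxe => //; exact: emeasurable_funB.
have h0 x : 0 <= h x by rewrite le_max lexx orbT.
have fhg x : f x + h x = g x.
  rewrite /h; have := fg x; have := f0 x.
  case: (f x) (g x) => [r| |] [s| |]//= r0 rs.
  - rewrite -EFinB max_l ?lee_fin ?subr_ge0//.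
    by rewrite -EFinD addrC subrK.
  - by rewrite max_r// ?leNye.
have ih : \int[mu]_x h x = 0.
  apply/eqP; rewrite eq_le integral_ge0// andbT.
  rewrite -(@leeD2lE _ (\int[mu]_x f x)).
    rewrite -ge0_integralD// adde0 (le_trans _ gf)// le_eqVlt; apply/orP; left.
    by apply/eqP/eq_integral => x _; rewrite fhg.
  by rewrite ge0_fin_numE// integral_ge0.
have : ae_eq mu setT h (cst 0).
  apply/ae_eq_integral_abs => //; rewrite -[RHS]ih.
  by apply: eq_integral => x _; rewrite gee0_abs.
by apply: filterS => x /(_ I) hx; rewrite -fhg hx adde0.
Qed.

End ae_eq_of_le.

(** * The least fixed point driven by a random measure *)

Section stochastic_fixpoint.
Local Open Scope ereal_scope.
Context d (Omega : measurableType d) (R : realType) (Q : probability Omega R).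
Context dT (T : measurableType dT).
Variables (F : R -> set (set Omega)) (fF : filtration F).
Variables (tau lev : T -> R).
Hypotheses (mtau : measurable_fun setT tau) (mlev : measurable_fun setT lev).
Variables (n : Omega -> {measure set T -> \bar R}) (c : R).
Hypotheses (c0 : (0 <= c)%R) (nF : adapted_random_measure F tau n).
Hypothesis nc : cell_intensity Q F tau lev n c.
Variable drift : R -> R.
Hypothesis drift_ge0 : forall t, (0 <= t)%R -> (0 <= drift t)%R.
Hypothesis drift_nd : forall s t, (0 <= s)%R -> (s <= t)%R -> (drift s <= drift t)%R.
Variables A b : R.
Hypotheses (A0 : (0 <= A)%R) (b0 : (0 < b)%R) (cb : (2 * c <= b)%R).
Hypothesis driftA : forall t, (0 <= t)%R -> (drift t <= A * expR (b * t))%R.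

Notation process := (increasing_process F).
Notation Op := (operator tau lev drift).

Let sF (t : R) : (0 <= t)%R -> sigma_algebra setT (F t).
Proof. by case: fF => + _ _; exact. Qed.

Let process_path x w : process x -> nondecreasing_path (x ^~ w).
Proof. by case=> _ + _ => /(_ w). Qed.

Let process_ge0 x t w : process x -> (0 <= t)%R -> 0 <= x t w.
Proof. by case=> + _ _ => /[apply]. Qed.

Let process_meas x t : process x -> (0 <= t)%R -> measurable_fun setT (x t).
Proof.
by move=> [_ _ Hx] t0; apply: (measurable_wrt_fun fF t0); exact: Hx.
Qed.

Let accum_meas x t : process x -> (0 <= t)%R ->
  measurable_fun setT (fun w => accum tau lev (n w) (x ^~ w) t).
Proof.
by move=> Hx t0; apply: (measurable_wrt_fun fF t0); exact: (accum_adapted fF mtau mlev nF nc).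
Qed.

Let int_cst (r : R) : \int[Q]_w r%:E = r%:E.
Proof.
rewrite integral_cst// -[RHS]mule1; congr (_ * _); exact: probability_setT.
Qed.

Let Op_ge0 w x t : (0 <= t)%R -> 0 <= Op (n w) x t.
Proof. exact: (@operator_ge0 _ _ _ tau lev drift (n w) drift_ge0 x). Qed.

Let Op_nd w x : nondecreasing_path x -> nondecreasing_path (Op (n w) x).
Proof. exact: (operator_nd mtau mlev). Qed.

Lemma operator_process x : process x -> process (fun t w => Op (n w) (x ^~ w) t).
Proof.
move=> Hx; split.
- by move=> t w; exact: Op_ge0.
- by move=> w; apply: Op_nd; exact: process_path.
- move=> t t0; apply/(measurable_wrtP (sF t0)); apply: emeasurable_funD => //.
  by apply/(measurable_wrtP (sF t0)); exact: (accum_adapted fF mtau mlev nF nc).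
Qed.

Lemma picard_process k : process (fun t w => picard tau lev drift (n w) k t).
Proof.
elim: k => [|k IH]; last exact: operator_process IH.
split => // t t0; apply/(measurable_wrtP (sF t0)); exact: measurable_cst.
Qed.

Definition minimal_solution (t : R) (w : Omega) := minimal tau lev drift (n w) t.

Notation X := minimal_solution.

Lemma minimal_process : process X.
Proof.
split.
- by move=> t w; exact: (@minimal_ge0 _ _ _ _ _ mtau mlev _ (n w) drift_ge0 drift_nd t).
- by move=> w; exact: (@minimal_path _ _ _ _ _ mtau mlev _ (n w) drift_ge0 drift_nd).
- move=> t t0; apply/(measurable_wrtP (sF t0)).
  apply: (@emeasurable_fun_cvg _ (g_sigma_algebraType (F t)) _ _
    (fun k w => picard tau lev drift (n w) k t)) => [k|w _]; last exact: (@minimal_cvg _ _ _ _ _ mtau mlev _ (n w) drift_ge0 drift_nd t t0).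
  by apply/(measurable_wrtP (sF t0)); case: (picard_process k) => _ _; exact.
Qed.

Lemma operator_mean x t : process x -> (0 <= t)%R ->
  (drift t)%:E + c%:E * riemann (fun s => \int[Q]_w x s w) t k @[k --> \oo] -->
  \int[Q]_w Op (n w) (x ^~ w) t.
Proof.
move=> Hx t0; rewrite /operator ge0_integralD//; last 2 first.
- by move=> w _; rewrite lee_fin drift_ge0.
- exact: accum_meas.
rewrite int_cst.
apply: cvgeD; [exact: fin_num_adde_defr|exact: cvg_cst|].
exact: (accum_mean fF mtau mlev nF nc Hx t0).
Qed.

Let lee_c u v : u <= v -> c%:E * u <= c%:E * v.
Proof. by move=> uv; rewrite lee_wpmul2l. Qed.

(** If the mean of an iterate is at most [2 * A * expR (b * s)], the next one has mean
    at most [A * expR (b * t) + 2 * A * (c / b) * expR (b * t)], which is within the same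
    bound because [2 * c <= b]. *)
Lemma minimal_mean t : (0 <= t)%R -> \int[Q]_w X t w <= (2 * A * expR (b * t))%:E.
Proof.
move=> t0.
have step k s : (0 <= s)%R ->
    \int[Q]_w picard tau lev drift (n w) k s <= (2 * A * expR (b * s))%:E.
  elim: k s => [|k IH] s s0 /=.
    by rewrite integral0 lee_fin !mulr_ge0// expR_ge0.
  have := operator_mean (picard_process k) s0 => H.
  rewrite -(cvg_lim _ H)//; apply: lime_le; first by apply/cvg_ex; eexists; exact: H.
  apply: nearW => j.
  apply: (@le_trans _ _ ((drift s)%:E + c%:E * (2 * A / b * expR (b * s))%:E)).
    rewrite leeD2l// lee_c//.
    apply: (le_trans _ (@riemann_expR _ _ _ _ j s0 _ b0)); last by rewrite mulr_ge0.
    by apply: riemann_le => // r r0 _; exact: IH.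
  rewrite -EFinM -EFinD lee_fin.
  have := driftA s0; have E0 := expR_gt0 (b * s).
  set E := expR _ in E0 * => dA.
  have : (c * (2 * A / b * E) <= A * E)%R.
    rewrite (_ : (c * _ = (2 * c / b) * (A * E))%R); last by field; rewrite gt_eqF.
    by rewrite ler_piMl ?mulr_ge0 ?(ltW E0)// ler_pdivrMr// mul1r.
  by move=> ?; nra.
have Hc : \int[Q]_w picard tau lev drift (n w) k t @[k --> \oo] --> \int[Q]_w X t w.
  apply: cvg_monotone_convergence => //.
  - by move=> k; exact: (process_meas (picard_process k) t0).
  - by move=> k w _; exact: (@picard_ge0 _ _ _ tau lev _ (n w) drift_ge0 k t t0).
  - by move=> w _ i j ij; exact: (@picard_nd _ _ _ _ _ mtau mlev _ (n w) drift_ge0 drift_nd t t0).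
rewrite -(cvg_lim _ Hc)//; apply: lime_le; first by apply/cvg_ex; eexists; exact: Hc.
by apply: nearW => k; exact: step.
Qed.

Lemma minimal_fin t : (0 <= t)%R -> \int[Q]_w X t w < +oo.
Proof. by move=> t0; apply: le_lt_trans (minimal_mean t0) _; rewrite ltry. Qed.

Lemma minimal_fixpoint_process t w : (0 <= t)%R -> X t w = Op (n w) (X ^~ w) t.
Proof. by move=> t0; exact: (@minimal_fixpoint _ _ _ _ _ mtau mlev _ (n w) drift_ge0 drift_nd t t0). Qed.

Lemma shift_process x (e : R) : process x -> (0 <= e)%R -> process (fun t w => x t w + e%:E).
Proof.
move=> Hx e0; split.
- by move=> t w t0; rewrite adde_ge0 ?lee_fin// process_ge0.
- by move=> w; apply: shift_path; exact: process_path.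
- move=> t t0; apply/(measurable_wrtP (sF t0)); apply: emeasurable_funD => //.
  by apply/(measurable_wrtP (sF t0)); case: Hx => _ _; exact.
Qed.

Lemma max_process x y : process x -> process y -> process (fun t w => maxe (x t w) (y t w)).
Proof.
move=> Hx Hy; split.
- by move=> t w t0; rewrite le_max process_ge0.
- move=> w s t s0 st; rewrite ge_max !le_max.
  by rewrite (process_path w Hx s0 st) (process_path w Hy s0 st) orbT.
- move=> t t0; apply/(measurable_wrtP (sF t0)); apply: measurable_maxe;
    apply/(measurable_wrtP (sF t0)).
  + by case: Hx => _ _; exact.
  + by case: Hy => _ _; exact.
Qed.

(** A mean distance [B * expR (b * s)] to the least fixed point contributes at most
    [c * (B / b) * expR (b * t)], half of it since [2 * c <= b]; a shift by [e]
    contributes at most [c * e * t]. *)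
Lemma operator_gap u (B e t : R) : process u -> (0 <= B)%R -> (0 <= e)%R -> (0 <= t)%R ->
  (forall s, (0 <= s)%R -> (s <= t)%R ->
    \int[Q]_w u s w <= \int[Q]_w X s w + (B * expR (b * s))%:E) ->
  \int[Q]_w Op (n w) (fun s => u s w + e%:E) t <=
    \int[Q]_w X t w + (B / 2 * expR (b * t) + c * (e * t))%:E.
Proof.
move=> Hu B0 e0 t0 uX.
have HX := operator_mean minimal_process t0.
have Hue := operator_mean (shift_process Hu e0) t0.
rewrite (_ : \int[Q]_w X t w = \int[Q]_w Op (n w) (X ^~ w) t); last first.
  by apply: eq_integral => w _; exact: minimal_fixpoint_process.
set D := (B / 2 * expR (b * t) + c * (e * t))%:E.
have HXe : (drift t)%:E + c%:E * riemann (fun s => \int[Q]_w X s w) t k + D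
    @[k --> \oo] --> \int[Q]_w Op (n w) (X ^~ w) t + D.
  by apply: cvgeD; [exact: fin_num_adde_defl|exact: HX|exact: cvg_cst].
rewrite -(cvg_lim _ Hue)// -(cvg_lim _ HXe)//.
apply: lee_lim; [by apply/cvg_ex; eexists; exact: Hue|by apply/cvg_ex; eexists; exact: HXe|].
apply: nearW => k; rewrite -addeA leeD2l//.
apply: (@le_trans _ _ (c%:E * (riemann (fun s => \int[Q]_w X s w) t k +
    ((B / b * expR (b * t))%:E + (t * e)%:E)))).
  apply: lee_c.
  apply: (@le_trans _ _ (riemann (fun s => \int[Q]_w X s w +
     ((B * expR (b * s))%:E + e%:E)) t k)).
    apply: riemann_le => // s s0 st.
    rewrite ge0_integralD//; last 2 first.
    - by move=> w _; exact: process_ge0.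
    - exact: process_meas.
    rewrite int_cst addeA leeD2r//.
    exact: uX.
  have iX s : (0 <= s)%R -> 0 <= \int[Q]_w X s w.
    by move=> s0; apply: integral_ge0 => w _; apply: (process_ge0 _ minimal_process).
  rewrite riemannD//; last first.
    by move=> s s0; rewrite adde_ge0// lee_fin// mulr_ge0// expR_ge0.
  rewrite leeD2l// riemannD//; last first.
    by move=> s s0; rewrite lee_fin mulr_ge0// expR_ge0.
  by rewrite leeD// ?riemann_cst// riemann_expR.
rewrite ge0_muleDr; last 2 first.
- apply: sume_ge0 => i _; rewrite mule_ge0 ?lee_fin ?divr_ge0 ?exprn_ge0//.
  apply: integral_ge0 => w _; apply: (process_ge0 _ minimal_process).
  exact: grid_ge0.
- by rewrite -EFinD lee_fin addr_ge0// mulr_ge0// ?divr_ge0 ?expR_ge0 ?(ltW b0).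
rewrite leeD2l// -EFinD -EFinM lee_fin mulrDr [(t * e)%R]mulrC lerD2r.
set E := expR _; rewrite (_ : (c * _ = c / b * (B * E))%R); last first.
  by field; rewrite gt_eqF.
rewrite (_ : (B / 2 * E = 2^-1 * (B * E))%R); last by ring.
rewrite ler_wpM2r ?mulr_ge0 ?expR_ge0// ler_pdivrMr//.
by rewrite -ler_pdivrMl ?invr_gt0// invrK.
Qed.

(** By [operator_gap] the exponentially weighted bound on the mean distance between
    [u] and the least fixed point can be halved indefinitely, starting from [K].  The
    shift by [e] leaves room for comparing closed and open accumulations. *)
Lemma ae_eq_minimal u (K : R) : process u -> (0 <= K)%R ->
  (forall t w, (0 <= t)%R -> X t w <= u t w) ->
  (forall t, (0 <= t)%R -> \int[Q]_w u t w <= \int[Q]_w X t w + K%:E) ->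
  (forall e t, (0 < e)%R -> (0 <= t)%R ->
    {ae Q, forall w, u t w <= Op (n w) (fun s => u s w + e%:E) t}) ->
  forall t, (0 <= t)%R -> {ae Q, forall w, u t w = X t w}.
Proof.
move=> Hu K0 Xu uK uOp.
have half (B : R) : (0 <= B)%R ->
    (forall s, (0 <= s)%R -> \int[Q]_w u s w <= \int[Q]_w X s w + (B * expR (b * s))%:E) ->
    forall s, (0 <= s)%R -> \int[Q]_w u s w <= \int[Q]_w X s w + (B / 2 * expR (b * s))%:E.
  move=> B0 uB s s0; apply/lee_addgt0Pr => e e0.
  have ct : (0 < c * s + 1)%R by rewrite ltr_wpDl// mulr_ge0.
  pose e' := (e / (c * s + 1))%R.
  have e'0 : (0 < e')%R by rewrite divr_gt0.
  apply: (@le_trans _ _ (\int[Q]_w Op (n w) (fun r => u r w + e'%:E) s)).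
    apply: ae_ge0_le_integral => //.
    - by move=> w _; exact: process_ge0.
    - exact: process_meas.
    - by move=> w _; exact: Op_ge0.
    - exact: (process_meas (operator_process (shift_process Hu (ltW e'0)))).
    - by apply: filterS (uOp _ _ e'0 s0) => w + _.
  apply: (le_trans (operator_gap Hu B0 (ltW e'0) s0 _)) => [r r0 _|]; first exact: uB.
  rewrite -[leRHS]addeA -EFinD leeD2l// lee_fin lerD2l /e'.
  rewrite (_ : (c * _ = c * s / (c * s + 1) * e)%R); last by field; rewrite gt_eqF.
  by rewrite ler_piMl ?ltW// ltr_pdivrMr// mul1r ltrDl.
have bound j s : (0 <= s)%R ->
    \int[Q]_w u s w <= \int[Q]_w X s w + (K / 2 ^+ j * expR (b * s))%:E.
  elim: j s => [|j IH] s s0.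
    apply: (le_trans (uK s s0)); rewrite leeD2l// lee_fin expr0 divr1 ler_peMr//.
    by rewrite -expR0 ler_expR mulr_ge0// ltW.
  rewrite (_ : K / 2 ^+ j.+1 = K / 2 ^+ j / 2)%R; last by rewrite exprS invfM mulrCA mulrC.
  by apply: half => //; rewrite divr_ge0// exprn_ge0.
move=> t t0; apply: ae_eq_of_integral_le.
- exact: (process_meas minimal_process).
- exact: (process_meas Hu).
- by move=> w; apply: (process_ge0 _ minimal_process).
- by move=> w; exact: Xu.
- exact: minimal_fin.
- apply/lee_addgt0Pr => e e0.
  have E0 := expR_gt0 (b * t).
  pose j := Num.truncn (K * expR (b * t) / e).
  apply: (le_trans (bound j t t0)); rewrite leeD2l// lee_fin.
  rewrite mulrAC ler_pdivrMr ?exprn_gt0// [leRHS]mulrC -ler_pdivrMr//.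
  rewrite ltW// (lt_le_trans (truncnS_gt _))// -natrX ler_nat.
  exact: ltn_expl.
Qed.

(** The images of the paths shifted by [1 / j] decrease to a variable that is above
    the closed image and whose mean is at most that of the least fixed point, by
    [operator_gap] with [B = 0]; being also above the least fixed point, it equals it
    almost surely.  Integer times suffice, by [horizon_mass_eq]. *)
Lemma ae_accum_closed : {ae Q, forall w, forall t, (0 <= t)%R ->
  accum_closed tau lev (n w) (X ^~ w) t = accum tau lev (n w) (X ^~ w) t /\
  X t w < +oo}.
Proof.
have HX := minimal_process.
have inv0 (j : nat) : (0 < j.+1%:R^-1 :> R)%R by rewrite invr_gt0.
have fixed t : (0 <= t)%R -> {ae Q, forall w,
    (drift t)%:E + accum_closed tau lev (n w) (X ^~ w) t <= X t w /\ X t w < +oo}.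
  move=> t0.
  pose f j w := Op (n w) (fun s => X s w + (j.+1%:R^-1)%:E) t.
  have mf j : measurable_fun setT (f j).
    exact: (process_meas (operator_process (shift_process HX (ltW (inv0 j)))) t0).
  pose g w := einfs (fun j => f j w) 0%N.
  have mg : measurable_fun setT g by exact: measurable_fun_einfs.
  have Xg w : X t w <= g w.
    apply: le_ereal_inf_tmp => _ [j _ <-].
    rewrite (minimal_fixpoint_process w t0).
    apply: (operator_mono mtau mlev) => //; first exact: process_path.
    - by apply: shift_path; exact: process_path.
    - by move=> s s0; rewrite leeDl// lee_fin ltW.
  have gf j w : g w <= f j w by apply: ereal_inf_lbound; exists j.
  have gX : \int[Q]_w g w <= \int[Q]_w X t w.
    apply/lee_addgt0Pr => e e0.
    pose j := Num.truncn (c * t / e).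
    apply: (@le_trans _ _ (\int[Q]_w f j w)).
      apply: ge0_le_integral => //.
      - by move=> w _; apply: le_trans (Xg w); exact: process_ge0.
    apply: (le_trans (@operator_gap _ 0 _ _ HX (lexx 0) (ltW (inv0 j)) t0 _)).
      by move=> s s0 _; rewrite mul0r adde0.
    rewrite leeD2l// lee_fin !mul0r add0r mulrCA.
    rewrite ler_pdivrMl// -ler_pdivrMr//.
    by rewrite ltW// truncnS_gt.
  have := ae_eq_of_integral_le (process_meas HX t0) mg _ Xg (minimal_fin t0) gX.
  move=> /(_ (fun w => process_ge0 _ HX t0)) ae1.
  have ae2 : {ae Q, forall w, X t w < +oo}.
    have iX : Q.-integrable setT (X t).
      apply/integrableP; split; first exact: process_meas.
      rewrite (eq_integral (X t)) ?minimal_fin// => w _.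
      by rewrite gee0_abs// process_ge0.
    have := integrable_ae measurableT iX; apply: filterS => w /(_ I).
    by rewrite fin_numElt => /andP[].
  apply: filterS2 ae1 ae2 => w gXw Xoo; split => //.
  rewrite -gXw; apply: le_ereal_inf_tmp => _ [j _ <-].
  rewrite leeD2l//; apply: (accum_closed_le mtau mlev) => //.
  exact: process_path.
have : {ae Q, forall w, forall N : nat,
    (drift N%:R)%:E + accum_closed tau lev (n w) (X ^~ w) N%:R <= X N%:R w /\
    X N%:R w < +oo}.
  by apply/ae_foralln => N; exact: fixed.
apply: filterS => w Hw t t0.
have tN : (t <= (Num.truncn t).+1%:R)%R by rewrite ltW// truncnS_gt.
have [] := Hw (Num.truncn t).+1; set N := _.+1 => closedN XN.
have N0 : (0 <= N%:R :> R)%R by [].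
have XE := minimal_fixpoint_process w N0.
split; last by apply: le_lt_trans XN; exact: (process_path w HX).
apply: (@horizon_mass_eq _ _ _ tau mtau (n w) _ _ _ N%:R) => //.
- by apply: measurable_region => //; exact: process_path.
- by apply: measurable_region_closed => //; exact: process_path.
- exact: region_sub_closed.
- move: XN; rewrite XE /operator; apply: le_lt_trans.
  by rewrite leeDr// lee_fin drift_ge0.
- by move: closedN; rewrite XE /operator leeD2lE.
Qed.

(** The maximum of the truncated path and the least fixed point satisfies the
    assumptions of [ae_eq_minimal], so that the truncated path is below the least fixed
    point for every integer truncation level and every integer time. *)
Lemma ae_unique (z : R -> Omega -> R) : usual_conditions Q F ->
  (forall t, (0 <= t)%R -> measurable_wrt (F t) (z t)) ->
  {ae Q, forall w, [/\
    forall s t, (0 <= s)%R -> (s <= t)%R -> (z s w <= z t w)%R,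
    forall t, (0 <= t)%R -> z s w @[s --> t^'+] --> z t w &
    forall t, (0 <= t)%R ->
      (z t w)%:E = (drift t)%:E + accum_closed tau lev (n w) (EFin \o z ^~ w) t]} ->
  {ae Q, forall w, forall t, (0 <= t)%R -> (z t w)%:E = X t w}.
Proof.
move=> [_ _ FN] Fz aez.
(* The exceptional set lies in [F 0] by completeness, so restricting the paths to
   its complement preserves adaptedness. *)
pose good : set Omega := [set w | [/\
    forall s t, (0 <= s)%R -> (s <= t)%R -> (z s w <= z t w)%R,
    forall t, (0 <= t)%R -> z s w @[s --> t^'+] --> z t w &
    forall t, (0 <= t)%R ->
      (z t w)%:E = (drift t)%:E + accum_closed tau lev (n w) (EFin \o z ^~ w) t]].
have FgoodC : F 0 (~` good) by apply: FN; exact: aez.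
have Fgood t : (0 <= t)%R -> F t good.
  move=> t0; have [s0 sC _] := sF t0.
  rewrite -[good]setCK -setTD; apply: sC.
  have [_ _ /(_ _ _ (lexx 0) t0)] := fF; apply; exact: FgoodC.
pose y (K : nat) t w : \bar R := (\1_good w * Num.min (z t w) K%:R)%:E.
have HX := minimal_process.
have path w : good w -> nondecreasing_path (EFin \o z ^~ w).
  by move=> [ndz _ _] s t s0 st; rewrite lee_fin; exact: ndz.
have z0 w t : good w -> (0 <= t)%R -> (0 <= z t w)%R.
  by move=> [_ _ zE] t0; rewrite -lee_fin zE// adde_ge0// lee_fin drift_ge0.
have Hy K : process (y K).
  split.
  - move=> t w t0; rewrite lee_fin /y indicE.
    have [/set_mem gw|] := boolP (w \in good); last by rewrite mul0r.
    by rewrite mul1r le_min z0/=.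
  - move=> w s t s0 st; rewrite lee_fin indicE.
    have [/set_mem [ndz _ _]|] := boolP (w \in good); last by rewrite !mul0r.
    rewrite !mul1r le_min !ge_min (ndz _ _ s0 st)/=.
    by rewrite lexx orbT.
  - move=> t t0; apply/(measurable_wrtP (sF t0)); apply/measurable_EFinP.
    apply: measurable_funM.
      by apply: measurable_indic; rewrite (measurable_sub (sF t0)); exact: Fgood.
    by apply: measurable_minr => //; apply/(measurable_wrtP (sF t0)); exact: Fz.
pose u K t w := maxe (y K t w) (X t w).
have Hu K : process (u K) by exact: max_process.
have uX K t : (0 <= t)%R -> {ae Q, forall w, u K t w = X t w}.
  apply: (@ae_eq_minimal _ K%:R) => //.
  - by move=> s w s0; rewrite le_max lexx orbT.
  - move=> s s0.
    apply: (@le_trans _ _ (\int[Q]_w (X s w + K%:R%:E))); last first.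
      rewrite ge0_integralD//; last 2 first.
      + by move=> w _; exact: process_ge0.
      + exact: process_meas.
      by rewrite int_cst.
    apply: ge0_le_integral => //.
    + by move=> w _; exact: process_ge0.
    + exact: process_meas.
    + by apply: emeasurable_funD => //; exact: process_meas.
    + move=> w _; rewrite ge_max leeDl ?lee_fin// andbT.
      apply: (@le_trans _ _ K%:R%:E); last by rewrite leeDr// process_ge0.
      rewrite lee_fin indicE; case: (_ \in _); rewrite ?mul0r ?mul1r//.
      by rewrite ge_min lexx orbT.
  - move=> e s e0 s0; apply: filterS aez => w gw.
    have gE r : y K r w = (Num.min (z r w) K%:R)%:E.
      by rewrite /y indicE mem_set// mul1r.
    have ndu := process_path w (Hu K).
    have ndue := shift_path e ndu.
    rewrite ge_max; apply/andP; split.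
      have [ndz rcz zE] := gw.
      have := truncated_le_operator mtau mlev (drift_nd) K%:R ndz rcz zE s0.
      rewrite -gE => /le_trans; apply.
      rewrite (_ : (fun t => _) = y K ^~ w); last by apply/funext => r; rewrite gE.
      rewrite leeD2l//.
      apply: (le_trans (accum_closed_le mtau mlev _ _ _ e0)); first exact: process_path.
      apply: accum_mono => //.
      + by apply: shift_path; exact: process_path.
      + by move=> r r0; rewrite leeD2r// le_max lexx.
    rewrite (minimal_fixpoint_process w s0).
    apply: (operator_mono mtau mlev) => //; first exact: process_path.
    by move=> r r0; rewrite (@le_trans _ _ (u K r w))// ?le_max ?lexx ?orbT// leeDl// lee_fin ltW.
have aeN : {ae Q, forall w, forall N K : nat, u K N%:R w = X N%:R w}.
  by apply/ae_foralln => N; apply/ae_foralln => K; exact: uX.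
apply: filterS2 aez aeN => w gw HN t t0.
have [ndz rcz zE] := gw.
have Xz : le_path (X ^~ w) (EFin \o z ^~ w).
  apply: (minimal_least mtau mlev drift_ge0 drift_nd); first exact: path.
  - by move=> s s0; rewrite lee_fin z0.
  - move=> s s0; rewrite /= zE// leeD2l//; apply: (accum_le_closed mtau mlev).
    exact: path.
have zN (N : nat) : (z N%:R w)%:E = X N%:R w.
  apply/eqP; rewrite eq_le (Xz N%:R)// andbT.
  have := HN N (Num.truncn (z N%:R w)).+1; rewrite /u /y indicE mem_set// mul1r.
  rewrite min_l; last by rewrite ltW// truncnS_gt.
  by move=> <-; rewrite le_max lexx.
have tN : (t <= (Num.truncn t).+1%:R)%R by rewrite ltW// truncnS_gt.
have := zN (Num.truncn t).+1; set N := _.+1 => zXN.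
have N0 : (0 <= N%:R :> R)%R by [].
rewrite zE// minimal_fixpoint_process//; congr (_ + _).
have XNE := minimal_fixpoint_process w N0.
apply: (@horizon_mass_eq _ _ _ tau mtau (n w) _ _ _ N%:R) => //.
- by apply: measurable_region => //; exact: process_path.
- by apply: measurable_region_closed => //; exact: path.
- apply: (subset_trans (region_mono Xz)); exact: region_sub_closed.
- rewrite (@le_lt_trans _ _ (X N%:R w))//; last by rewrite -zXN ltry.
  by rewrite XNE /operator leeDr// lee_fin drift_ge0.
- have : (drift N%:R)%:E + accum_closed tau lev (n w) (EFin \o z ^~ w) N%:R <=
    (drift N%:R)%:E + accum tau lev (n w) (X ^~ w) N%:R.
    by rewrite -zE// zXN XNE.
  by rewrite leeD2lE.
Qed.

End stochastic_fixpoint.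

(** * Pathwise calculus *)

Section right_continuous.
Context {R : realType}.

(** The values of [x] at the next multiple of [1 / (n + 1)], taken strictly to the
    right, converge to [x] by right continuity. *)
Lemma right_continuous_measurable (x : R -> R) (T : R) :
  (forall t, 0 <= t -> x s @[s --> t^'+] --> x t) -> measurable_fun `[0, T] x.
Proof.
move=> rcx.
pose node (n : nat) (s : R) := (Num.truncn (n.+1%:R * s)).+1%:R / n.+1%:R : R.
apply: (@measurable_fun_cvg _ _ R _ (fun n s => x (node n s))) => [n|s].
  move=> _ B mB.
  rewrite (_ : _ `&` _ = `[0, T] `&` \bigcup_k
    (if pselect (B (x (k.+1%:R / n.+1%:R))) then
      [set s | k%:R <= n.+1%:R * s < k.+1%:R] else set0)); last first.
    apply/seteqP; split => s [] /=; rewrite in_itv/= => /andP[s0 sT] sB.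
      split; first by rewrite s0.
      exists (Num.truncn (n.+1%:R * s)) => //; case: pselect => // ? /=.
      by apply: truncn_itv; rewrite mulr_ge0.
    split; first by rewrite s0.
    case: sB => k _; case: pselect => // Bk /= /truncn_def kE.
    by rewrite /node kE.
  apply: measurableI => //; apply: bigcupT_measurable => k.
  case: pselect => /= Bk; last exact: measurable0.
  rewrite (_ : [set s | _] = `[k%:R / n.+1%:R, k.+1%:R / n.+1%:R[%classic);
    first exact: measurable_itv.
  apply/seteqP; split => s /=; rewrite in_itv/= ler_pdivrMr// ltr_pdivlMr//;
    by rewrite [n.+1%:R * s]mulrC.
rewrite /= in_itv/= => /andP[s0 _].
have /cvg_at_rightP rc := rcx s s0.
apply: (rc (node ^~ s)); split => [n|].
  by rewrite /node ltr_pdivlMr// mulrC truncnS_gt.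
apply: (@squeeze_cvgr _ _ _ _ (fun=> s) (fun n => s + n.+1%:R^-1)).
- apply: nearW => n; apply/andP; split.
    by rewrite ltW// /node ltr_pdivlMr// mulrC truncnS_gt.
  rewrite /node ler_pdivrMr// mulrDl mulVf// -natr1 lerD2r mulrC.
  by rewrite truncn_le mulr_ge0.
- exact: cvg_cst.
- rewrite -[X in _ --> X]addr0; apply: cvgD; first exact: cvg_cst.
  exact: cvg_harmonic.
Qed.

End right_continuous.

Section quadratic_increments.
Context {R : realType}.

(** Over a grid of mesh [h] the increments of [D] add up to at most
    [C * h * (W T - W 0)], which vanishes with [h]. *)
Lemma quadratic_increments (D W : R -> R) (C T : R) : 0 <= T -> 0 <= C ->
  (forall s t, 0 <= s -> s <= t -> t <= T ->
    `|D t - D s| <= C * (t - s) * (W t - W s)) -> D T = D 0.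
Proof.
move=> T0 C0 DW.
pose K := C * T * (W T - W 0).
have bound n : `|D T - D 0| <= K / n.+1%:R.
  pose p i := i%:R * (T / n.+1%:R) : R.
  have p0 : p 0%N = 0 by rewrite /p mul0r.
  have pT : p n.+1 = T by rewrite /p mulrC divfK.
  have pge i : 0 <= p i by rewrite mulr_ge0// divr_ge0.
  have ple i j : (i <= j)%N -> p i <= p j by move=> ij; rewrite ler_wpM2r ?ler_nat ?divr_ge0.
  rewrite -{1}pT -p0 -(telescope_sumr (fun i => D (p i)))// big_mkord.
  apply: (le_trans (ler_norm_sum _ _ _)).
  apply: (@le_trans _ _ (\sum_(i < n.+1) C * (T / n.+1%:R) * (W (p i.+1) - W (p i)))).
    apply: ler_sum => i _.
    have -> : T / n.+1%:R = p i.+1 - p i.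
      by rewrite /p -[i.+1%:R]natr1 mulrDl mul1r addrAC subrr add0r.
    by apply: DW => //; [exact: ple|rewrite -pT; exact: ple].
  rewrite -mulr_sumr -(big_mkord xpredT (fun i => W (p i.+1) - W (p i))).
  rewrite telescope_sumr// pT p0 /K le_eqVlt; apply/orP; left; apply/eqP.
  by ring.
apply/eqP; rewrite -subr_eq0 -normr_eq0 eq_le normr_ge0 andbT.
rewrite leNgt; apply/negP => D0.
pose n := Num.truncn (K / `|D T - D 0|).
have := bound n; rewrite leNgt => /negP; apply.
by rewrite ltr_pdivrMr// mulrC -ltr_pdivrMr// truncnS_gt.
Qed.

Lemma integral_difference (f : R -> R) (T s t : R) :
  lebesgue_measure.-integrable `[0, T] (EFin \o f) ->
  0 <= s -> s <= t -> t <= T ->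
  \int[lebesgue_measure]_(r in `[0, t]) f r -
    \int[lebesgue_measure]_(r in `[0, s]) f r =
  \int[lebesgue_measure]_(r in `]s, t]) f r.
Proof.
move=> fT s0 st tT; apply: (@Rintegral_itvB _ f (BLeft 0) (BRight t) s) => //.
by apply: integrableS fT => //; apply: subset_itvl; rewrite bnd_simp.
Qed.

Lemma integral_increment (f : R -> R) (T s t l u : R) :
  lebesgue_measure.-integrable `[0, T] (EFin \o f) ->
  0 <= s -> s <= t -> t <= T -> (forall r, s <= r <= t -> l <= f r <= u) ->
  l * (t - s) <= \int[lebesgue_measure]_(r in `[0, t]) f r -
    \int[lebesgue_measure]_(r in `[0, s]) f r <= u * (t - s).
Proof.
move=> fT s0 st tT lfu.
rewrite (integral_difference fT)//.
have fst : lebesgue_measure.-integrable `]s, t] (EFin \o f).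
  apply: integrableS fT => //; apply: subset_itv; by rewrite bnd_simp.
have leb : lebesgue_measure (`]s, t] : set R) = (t - s)%:E.
  rewrite lebesgue_measure_itv/= lte_fin; case: ltgtP st => // -> _.
  by rewrite subrr.
have st_fin : (lebesgue_measure (`]s, t] : set R) < +oo)%E by rewrite leb ltry.
have icst k : lebesgue_measure.-integrable `]s, t] (EFin \o cst k : R -> \bar R).
  apply/integrableP; split; first exact/measurable_EFinP/measurable_cst.
  under eq_integral do rewrite /=.
  by rewrite integral_cst// lte_mul_pinfty.
have cstE k : k * (t - s) = \int[lebesgue_measure]_(r in `]s, t]) k.
  by rewrite Rintegral_cst//; congr (_ * _); exact: (esym (congr1 fine leb)).
rewrite !cstE; apply/andP; split; apply: le_Rintegral;
  (try exact: icst) => // r /=;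
  by rewrite in_itv/= => /andP[/ltW sr rt]; have /andP[] := lfu r (introT andP (conj sr rt)).
Qed.

(** Multiplying the first quantity by the integrating factor turns it into the
    second up to errors of second order in the mesh. *)
Lemma integrating_factor (kappa T B : R) (f I A J V : R -> R) :
  0 <= kappa -> 0 <= T ->
  (forall t, 0 <= t -> t <= T -> `|f t| <= B) ->
  (forall r s t, 0 <= s -> s <= r -> r <= t -> t <= T -> `|f r - f s| <= V t - V s) ->
  (forall s t l u, 0 <= s -> s <= t -> t <= T ->
    (forall r, s <= r <= t -> l <= f r <= u) ->
    l * (t - s) <= I t - I s <= u * (t - s)) ->
  (forall s t, 0 <= s -> s <= t -> t <= T -> A s <= A t) ->
  (forall s t, 0 <= s -> s <= t -> t <= T ->
    expR (kappa * s) * (A t - A s) <= J t - J s <= expR (kappa * t) * (A t - A s)) ->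
  let D1 t := f t + kappa * I t - A t in
  let D2 t := expR (kappa * t) * f t - J t in
  exists2 C, 0 <= C & forall s t, 0 <= s -> s <= t -> t <= T ->
    `|(D2 t - D2 s) - expR (kappa * s) * (D1 t - D1 s)| <=
    C * (t - s) * ((t + V t + A t) - (s + V s + A s)).
Proof.
move=> k0 T0 fB fV IP ndA JA D1 D2.
have B0 : 0 <= B by rewrite (le_trans _ (fB 0 _ _)).
exists (expR (kappa * T) * kappa * (B * kappa + 2)).
  by rewrite !mulr_ge0 ?expR_ge0 ?addr_ge0 ?mulr_ge0.
move=> s t s0 st tT.
set es := expR (kappa * s); set et := expR (kappa * t); set eT := expR (kappa * T).
pose h := t - s; have h0 : 0 <= h by rewrite subr_ge0.
have es0 : 0 < es := expR_gt0 _.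
have eset : es <= et by rewrite ler_expR ler_wpM2l.
have eteT : et <= eT by rewrite ler_expR ler_wpM2l.
(* both bounds are instances of [1 + x <= expR x] *)
have lower : es * (kappa * h) <= et - es.
  have -> : et = es * expR (kappa * h) by rewrite -expRD -mulrDr addrC subrK.
  by have := expR_ge1Dx (kappa * h); set e := expR _ => ?; nra.
have upper : et - es <= et * (kappa * h).
  have -> : es = et * expR (- (kappa * h)).
    by rewrite -expRD -mulrN -mulrDr opprB addrC subrK.
  have := expR_ge1Dx (- (kappa * h)); have : 0 < et := expR_gt0 _.
  by set e := expR (- _) => ? ?; nra.
pose dA := A t - A s; have dA0 : 0 <= dA by rewrite subr_ge0 ndA.
have /andP[J1 J2] := JA s t s0 st tT.
pose dV := V t - V s.
have dV0 : 0 <= dV by rewrite (le_trans (normr_ge0 _) (fV s s t s0 _ st tT)).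
have ftB : `|f t| <= B by apply: fB => //; exact: le_trans st.
have fr r : s <= r <= t -> f t - 2 * dV <= f r <= f t + 2 * dV.
  move=> /andP[sr rt]; have := fV r s t s0 sr rt tT; have := fV t s t s0 st (lexx _) tT.
  by rewrite -/dV !ler_norml => /andP[? ?] /andP[? ?]; apply/andP; split; lra.
have /andP[I1 I2] := IP s t _ _ s0 st tT fr.
rewrite -/h in I1 I2.
have -> : D2 t - D2 s - es * (D1 t - D1 s) =
    ((et - es) - es * (kappa * h)) * f t
    - es * kappa * ((I t - I s) - f t * h) - ((J t - J s) - es * dA).
  by rewrite /D1 /D2 /dA -/es -/et; ring.
set X1 := (et - es) - es * (kappa * h).
have X10 : 0 <= X1 by rewrite subr_ge0.
have X1le : X1 <= eT * kappa * h * (kappa * h).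
  have kh : 0 <= kappa * h by rewrite mulr_ge0.
  have E1 : (et - es) * (kappa * h) <= et * (kappa * h) * (kappa * h) by rewrite ler_wpM2r.
  have E2 : et * (kappa * h) * (kappa * h) <= eT * (kappa * h) * (kappa * h).
    by rewrite !ler_wpM2r.
  by rewrite /X1; have := upper; nra.
have T1 : `|X1 * f t| <= eT * kappa * h * (kappa * h) * B.
  by rewrite normrM (ger0_norm X10); apply: ler_pM.
have T2 : `|es * kappa * ((I t - I s) - f t * h)| <= eT * kappa * (2 * dV * h).
  rewrite normrM ger0_norm ?mulr_ge0 ?(ltW es0)//.
  apply: ler_pM => //; first by rewrite mulr_ge0// ltW.
    by rewrite ler_wpM2r// (le_trans eset).
  by rewrite ler_norml; apply/andP; split; lra.
have T3 : `|(J t - J s) - es * dA| <= eT * kappa * h * dA.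
  rewrite ger0_norm ?subr_ge0//.
  apply: (@le_trans _ _ ((et - es) * dA)); first by rewrite mulrBl lerD2r.
  rewrite ler_wpM2r// (le_trans upper)// -mulrA ler_wpM2r// mulr_ge0//.
apply: (le_trans (ler_normB _ _)); apply: (le_trans (lerD (ler_normB _ _) T3)).
apply: (le_trans (lerD (lerD T1 T2) (lexx _))).
have eT0 : 0 <= eT := expR_ge0 _.
rewrite (_ : _ + _ + _ = eT * kappa * h * (B * kappa * h + 2 * dV + dA)); last by ring.
rewrite -/h (_ : t + V t + A t - (s + V s + A s) = h + dV + dA); last by rewrite /h /dV /dA; ring.
rewrite [leRHS](_ : _ = eT * kappa * h * ((B * kappa + 2) * (h + dV + dA))); last by ring.
apply: ler_wpM2l; first by rewrite !mulr_ge0.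
have Bk : 0 <= B * kappa by rewrite mulr_ge0.
by nra.
Qed.

End quadratic_increments.

(** * Two integrated forms of the jump equation *)

Section jump_equation.
Context {R : realType}.
Variable mu : {measure set (R * R)%type -> \bar R}.
Variables kappa lbar eta a lambda0 : R.
Hypotheses (kappa0 : 0 < kappa) (lbar0 : 0 < lbar) (eta0 : 0 <= eta) (a0 : 0 < a).
Hypothesis l00 : 0 < lambda0.

Definition jumps (t : R) := [set z : R * R | [/\ 0 < z.1, z.1 <= t & z.2 != 0]].

Definition jump_sum t := (\int[mu]_(z in jumps t) (eta * gfun a z.2)%:E)%E.

Definition compounded_jump_sum t :=
  (\int[mu]_(z in jumps t) (expR (kappa * z.1) * (eta * gfun a z.2))%:E)%E.

(** The solution of the equation for [x t = expR (kappa * t) * lambda t] when there are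
    no jumps. *)
Definition mild_drift t := lambda0 + lbar * (expR (kappa * t) - 1).

Lemma measurable_jumps t : measurable (jumps t).
Proof.
rewrite (_ : jumps t = fst @^-1` `]0, t]%classic `&` snd @^-1` (~` [set 0])).
  apply: measurableI; rewrite -[X in measurable X]setTI.
    exact: measurable_fst.
  by apply: measurable_snd => //; exact: measurableC.
apply/seteqP; split => z /=; rewrite in_itv/=.
  by move=> [z0 zt /eqP z1]; split => //; apply/andP.
by move=> [/andP[z0 zt] /eqP z1].
Qed.

Let mg : measurable_fun setT (fun z : R * R => (eta * gfun a z.2)%:E).
Proof.
apply/measurable_EFinP; apply: measurable_funM => //.
by apply: (measurableT_comp (measurable_gfun a)).
Qed.

Let meg : measurable_fun setT (fun z : R * R => (expR (kappa * z.1) * (eta * gfun a z.2))%:E).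
Proof.
apply/measurable_EFinP; apply: measurable_funM.
  by apply: measurableT_comp => //; exact: measurable_funM.
apply: measurable_funM => //.
by apply: (measurableT_comp (measurable_gfun a)).
Qed.

Let w0 (z : R * R) : 0 <= eta * gfun a z.2.
Proof. by rewrite mulr_ge0// gfun_ge0. Qed.

Let ew0 (z : R * R) : 0 <= expR (kappa * z.1) * (eta * gfun a z.2).
Proof. by rewrite mulr_ge0 ?expR_ge0. Qed.

Let jumps_between s t := jumps t `\` jumps s.

Let measurable_between s t : measurable (jumps_between s t).
Proof. by apply: measurableD; exact: measurable_jumps. Qed.

Let split_integral (h : R * R -> R) s t : measurable_fun setT (EFin \o h) ->
  (forall z, 0 <= h z) -> s <= t ->
  (\int[mu]_(z in jumps t) (h z)%:E = \int[mu]_(z in jumps s) (h z)%:E +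
   \int[mu]_(z in jumps_between s t) (h z)%:E)%E.
Proof.
move=> mh h0 st; rewrite -ge0_integral_setU//.
- congr (integral _ _ _); rewrite setDUK// => z [z0 zs z1].
  by split => //; exact: le_trans zs st.
- exact: measurable_jumps.
- exact: measurable_funTS.
- by move=> z _; rewrite lee_fin.
- by apply/disj_setPS => z [zs [_]].
Qed.

Let between_bounds s t : 0 <= s ->
  ((expR (kappa * s))%:E * \int[mu]_(z in jumps_between s t) (eta * gfun a z.2)%:E <=
   \int[mu]_(z in jumps_between s t) (expR (kappa * z.1) * (eta * gfun a z.2))%:E <=
   (expR (kappa * t))%:E * \int[mu]_(z in jumps_between s t) (eta * gfun a z.2)%:E)%E.
Proof.
move=> s0; have mS := measurable_between s t.
rewrite -!ge0_integralZl_EFin ?expR_ge0//; last 4 first.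
- by move=> z _; rewrite lee_fin.
- exact: measurable_funTS.
- by move=> z _; rewrite lee_fin.
- exact: measurable_funTS.
apply/andP; split; apply: ge0_le_integral => //.
- by move=> z _; rewrite -EFinM lee_fin mulr_ge0 ?expR_ge0.
- by apply: emeasurable_funM => //; exact: measurable_funTS.
- exact: measurable_funTS.
- move=> z [[z0 zt z1] zs]; rewrite -EFinM lee_fin ler_wpM2r// ler_expR ler_pM2l//.
  by rewrite leNgt; apply/negP => zs'; apply: zs; split => //; exact: ltW.
- by move=> z _; rewrite lee_fin.
- exact: measurable_funTS.
- by apply: emeasurable_funM => //; exact: measurable_funTS.
- by move=> z [[z0 zt z1] _]; rewrite -EFinM lee_fin ler_wpM2r// ler_expR ler_pM2l.
Qed.

Lemma jumps0 : jumps 0 = set0.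
Proof. by apply/seteqP; split => // z [z0 /(lt_le_trans z0)]; rewrite ltxx. Qed.

Lemma jump_sum_ge0 t : (0 <= jump_sum t)%E.
Proof. by apply: integral_ge0 => z _; rewrite lee_fin. Qed.

Lemma compounded_jump_sum_ge0 t : (0 <= compounded_jump_sum t)%E.
Proof. by apply: integral_ge0 => z _; rewrite lee_fin. Qed.

Lemma jump_sum_nd s t : s <= t -> (jump_sum s <= jump_sum t)%E.
Proof.
move=> st; rewrite /jump_sum (split_integral mg w0 st) leeDl//.
by apply: integral_ge0 => z _; rewrite lee_fin.
Qed.

Lemma compounded_jump_sum_nd s t : s <= t ->
  (compounded_jump_sum s <= compounded_jump_sum t)%E.
Proof.
move=> st; rewrite /compounded_jump_sum (split_integral meg ew0 st) leeDl//.
by apply: integral_ge0 => z _; rewrite lee_fin.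
Qed.

Let jump_bounds0 t : 0 <= t -> (jump_sum t <= compounded_jump_sum t <=
  (expR (kappa * t))%:E * jump_sum t)%E.
Proof.
move=> t0; have := between_bounds t (lexx 0).
have -> : jumps_between 0 t = jumps t by rewrite /jumps_between jumps0 setD0.
by rewrite mulr0 expR0 mul1e.
Qed.

Lemma jump_sum_finite t : 0 <= t ->
  (jump_sum t < +oo)%E <-> (compounded_jump_sum t < +oo)%E.
Proof.
move=> /jump_bounds0/andP[h1 h2]; split => [H|]; last exact: le_lt_trans.
by apply: (le_lt_trans h2); rewrite lte_mul_pinfty ?lee_fin ?expR_ge0.
Qed.

Let A t := fine (jump_sum t).
Let J t := fine (compounded_jump_sum t).

Section finite_horizon.
Variables (T : R) (T0 : 0 <= T) (AT : (jump_sum T < +oo)%E).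

Let Afin t : t <= T -> jump_sum t \is a fin_num.
Proof.
move=> tT; rewrite ge0_fin_numE ?jump_sum_ge0//.
exact: le_lt_trans (jump_sum_nd tT) AT.
Qed.

Let Jfin t : t <= T -> compounded_jump_sum t \is a fin_num.
Proof.
move=> tT; rewrite ge0_fin_numE ?compounded_jump_sum_ge0//.
by apply: le_lt_trans (compounded_jump_sum_nd tT) _; apply/jump_sum_finite.
Qed.

Let A_nd s t : 0 <= s -> s <= t -> t <= T -> A s <= A t.
Proof.
by move=> _ st tT; rewrite fine_le ?Afin ?(le_trans st)// jump_sum_nd.
Qed.

Let JA s t : 0 <= s -> s <= t -> t <= T ->
  expR (kappa * s) * (A t - A s) <= J t - J s <= expR (kappa * t) * (A t - A s).
Proof.
move=> s0 st tT; have sT := le_trans st tT.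
pose dA := (\int[mu]_(z in jumps_between s t) (eta * gfun a z.2)%:E)%E.
pose dJ := (\int[mu]_(z in jumps_between s t)
  (expR (kappa * z.1) * (eta * gfun a z.2))%:E)%E.
have DA : jump_sum t = (jump_sum s + dA)%E := split_integral mg w0 st.
have DJ : compounded_jump_sum t = (compounded_jump_sum s + dJ)%E :=
  split_integral meg ew0 st.
have := between_bounds t s0; rewrite -/dA -/dJ.
have At := Afin tT; have As := Afin sT; have Jt := Jfin tT; have Js := Jfin sT.
have dAE : dA = (A t - A s)%:E.
  by rewrite /A EFinB !fineK// DA addeAC subee// add0e.
have dJE : dJ = (J t - J s)%:E.
  by rewrite /J EFinB !fineK// DJ addeAC subee// add0e.
by rewrite dAE dJE -!EFinM !lee_fin.
Qed.

Variable l : R -> R.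
Let f t := l t - lbar.
Let I t := \int[lebesgue_measure]_(r in `[0, t]) f r.
Hypothesis f_int : lebesgue_measure.-integrable `[0, T] (EFin \o f).

Let I0 : I 0 = 0.
Proof. by rewrite /I set_itv1 Rintegral_set1. Qed.

Let A00 : A 0 = 0.
Proof. by rewrite /A /jump_sum jumps0 integral_set0. Qed.

Let J00 : J 0 = 0.
Proof. by rewrite /J /compounded_jump_sum jumps0 integral_set0. Qed.

Let IP s t m M : 0 <= s -> s <= t -> t <= T ->
  (forall r, s <= r <= t -> m <= f r <= M) ->
  m * (t - s) <= I t - I s <= M * (t - s).
Proof. exact: (integral_increment f_int). Qed.

Let drift_integral t : t <= T ->
  (\int[lebesgue_measure]_(s in `[0%R, t]) (kappa * (lbar - l s))%:E
   = (- (kappa * I t))%:E)%E.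
Proof.
move=> tT.
have ft : lebesgue_measure.-integrable `[0, t] (EFin \o f).
  by apply: integrableS f_int => //; apply: subset_itvl; rewrite bnd_simp.
rewrite -mulNr EFinM /I /Rintegral fineK; last exact: integrable_fin_num.
rewrite -integralZl//; apply: eq_integral => s _.
by rewrite -EFinM /f; congr EFin; ring.
Qed.

Lemma jump_sumE t : (eta%:E * \int[mu]_(z in jumps t) (gfun a z.2)%:E = jump_sum t)%E.
Proof.
rewrite -ge0_integralZl_EFin//.
- exact: measurable_jumps.
- by move=> z _; rewrite lee_fin gfun_ge0.
- apply: measurable_funTS; apply/measurable_EFinP.
  exact: (measurableT_comp (measurable_gfun a)).
Qed.

(** The integrated equation says that the first quantity of [integrating_factor] is
    constant; the conclusion says that the second one is.  The variation of [lambda] is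
    controlled by the integral of its absolute drift plus the jumps. *)
Lemma integrated_to_mild :
  (forall t, 0 <= t -> t <= T -> ((l t)%:E = lambda0%:E +
     \int[lebesgue_measure]_(s in `[0%R, t]) (kappa * (lbar - l s))%:E +
     eta%:E * \int[mu]_(z in jumps t) (gfun a z.2)%:E)%E) ->
  ((expR (kappa * T) * l T)%:E = (mild_drift T)%:E + compounded_jump_sum T)%E.
Proof.
move=> eqn.
have lE t : 0 <= t -> t <= T -> l t = lambda0 - kappa * I t + A t.
  move=> t0 tT; have := eqn t t0 tT; rewrite drift_integral// jump_sumE.
  by rewrite -(fineK (Afin tT)) -!EFinD => -[].
pose N t := \int[lebesgue_measure]_(r in `[0, t]) `|f r|.
have fN : lebesgue_measure.-integrable `[0, T] (EFin \o (fun r => `|f r|)).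
  exact: integrable_norm.
have N_diff s t : 0 <= s -> s <= t -> t <= T ->
    N t - N s = \int[lebesgue_measure]_(r in `]s, t]) `|f r|.
  exact: (integral_difference fN).
have IN s t : 0 <= s -> s <= t -> t <= T -> `|I t - I s| <= N t - N s.
  move=> s0 st tT; rewrite (integral_difference f_int)// N_diff//.
  apply: le_normr_Rintegral => //; apply: integrableS f_int => //.
  by apply: subset_itv; rewrite bnd_simp.
have N_nd s t : 0 <= s -> s <= t -> t <= T -> N s <= N t.
  by move=> s0 st tT; rewrite -subr_ge0 (le_trans _ (IN s t s0 st tT)).
have N0 : N 0 = 0 by rewrite /N set_itv1 Rintegral_set1.
pose V t := kappa * N t + A t.
have fV r s t : 0 <= s -> s <= r -> r <= t -> t <= T -> `|f r - f s| <= V t - V s.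
  move=> s0 sr rt tT; have r0 := le_trans s0 sr; have rT := le_trans rt tT.
  have -> : f r - f s = (A r - A s) - kappa * (I r - I s).
    by rewrite /f !lE ?(le_trans sr)//; ring.
  apply: (le_trans (ler_normB _ _)); rewrite normrM (gtr0_norm kappa0).
  have Asr := A_nd s0 sr rT; have Art := A_nd r0 rt tT.
  rewrite [`|A r - A s|]ger0_norm ?subr_ge0//.
  have NI : kappa * `|I r - I s| <= kappa * (N t - N s).
    rewrite ler_pM2l// (le_trans (IN s r s0 sr rT))// lerD2r.
    exact: N_nd.
  move: NI Art; rewrite /V mulrBr => NI Art; lra.
have fB t : 0 <= t -> t <= T -> `|f t| <= `|f 0| + (V T - V 0).
  move=> t0 tT; rewrite -[f t](subrK (f 0)) addrC.
  apply: (le_trans (ler_normD _ _)); rewrite lerD2l.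
  exact: fV.
have [C C0 CP] := integrating_factor (ltW kappa0) T0 fB fV IP A_nd JA.
have D1c t : 0 <= t -> t <= T -> f t + kappa * I t - A t = lambda0 - lbar.
  by move=> t0 tT; rewrite /f lE//; ring.
have : expR (kappa * T) * f T - J T = expR (kappa * 0) * f 0 - J 0.
  apply: (@quadratic_increments _ (fun t => expR (kappa * t) * f t - J t)
    (fun t => t + V t + A t) C) => // s t s0 st tT.
  apply: le_trans (CP s t s0 st tT); rewrite !D1c ?(le_trans st)//; last first.
    exact: le_trans st.
  by rewrite subrr mulr0 subr0.
rewrite mulr0 expR0 mul1r J00 subr0 [f 0]/f lE// I0 mulr0 A00 subr0 addr0 => E.
rewrite -(fineK (Jfin (lexx T))) -EFinD; congr EFin; rewrite -/(J T) /mild_drift.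
by move: E; rewrite /f mulrBr => /eqP; rewrite subr_eq => /eqP E; lra.
Qed.

(** The same argument with the two quantities exchanged.  The variation of [lambda] is
    controlled by that of the nondecreasing function [x]. *)
Lemma mild_to_integrated :
  (forall s t, 0 <= s -> s <= t -> t <= T ->
    expR (kappa * s) * l s <= expR (kappa * t) * l t) ->
  (forall t, 0 <= t -> t <= T ->
    ((expR (kappa * t) * l t)%:E = (mild_drift t)%:E + compounded_jump_sum t)%E) ->
  ((l T)%:E = lambda0%:E +
     \int[lebesgue_measure]_(s in `[0%R, T]) (kappa * (lbar - l s))%:E +
     eta%:E * \int[mu]_(z in jumps T) (gfun a z.2)%:E)%E.
Proof.
move=> x_nd eqn; pose x t := expR (kappa * t) * l t.
have xE t : 0 <= t -> t <= T -> x t = mild_drift t + J t.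
  by move=> t0 tT; have := eqn t t0 tT; rewrite -(fineK (Jfin tT)) -EFinD => -[].
have x0E : x 0 = lambda0 by rewrite xE// J00 /mild_drift mulr0 expR0; ring.
have x_ge0 t : 0 <= t -> t <= T -> 0 <= x t.
  by move=> t0 tT; rewrite (le_trans (ltW l00))// -x0E x_nd.
have lx t : l t = expR (- (kappa * t)) * x t.
  by rewrite /x mulrA -expRD addNr expR0 mul1r.
have e_le1 t : 0 <= t -> expR (- (kappa * t)) <= 1.
  by move=> t0; rewrite -expR0 ler_expR oppr_le0 mulr_ge0// ltW.
pose V t := x t + kappa * x T * t.
have fV r s t : 0 <= s -> s <= r -> r <= t -> t <= T -> `|f r - f s| <= V t - V s.
  move=> s0 sr rt tT; have r0 := le_trans s0 sr; have rT := le_trans rt tT.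
  have sT := le_trans sr rT.
  set er := expR (- (kappa * r)); set es := expR (- (kappa * s)).
  have -> : f r - f s = er * (x r - x s) - (es - er) * x s.
    by rewrite /f !lx -/er -/es; ring.
  have er1 : er <= 1 by exact: e_le1.
  have es1 : es <= 1 by exact: e_le1.
  have er0 : 0 < er := expR_gt0 _.
  have es0 : 0 < es := expR_gt0 _.
  have eres : er <= es by rewrite ler_expR lerN2 ler_pM2l.
  have diff : es - er <= kappa * (r - s).
    have -> : er = es * expR (- (kappa * (r - s))).
      by rewrite -expRD; congr expR; ring.
    have := expR_ge1Dx (- (kappa * (r - s))).
    have : expR (- (kappa * (r - s))) <= 1 by apply: e_le1; rewrite subr_ge0.
    by set e := expR (- (kappa * (r - s))) => ? ?; nra.
  have xs0 := x_ge0 s s0 sT; have xsr := x_nd s r s0 sr rT; have xrt := x_nd r t r0 rt tT.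
  have xsT := x_nd s T s0 sT (lexx T).
  rewrite -/(x _) -/(x _) in xsr; rewrite -/(x _) -/(x _) in xrt.
  rewrite -/(x _) -/(x _) in xsT.
  apply: (le_trans (ler_normB _ _)); rewrite (normrM er) (normrM _ (x s)).
  rewrite (gtr0_norm er0) (ger0_norm xs0) [`|x r - x s|]ger0_norm ?subr_ge0//.
  rewrite [`|es - er|]ger0_norm ?subr_ge0//.
  have h1 : er * (x r - x s) <= x t - x s by rewrite (le_trans (ler_piMl _ _))// ?subr_ge0// lerD2r.
  have h2 : (es - er) * x s <= kappa * x T * (t - s).
    apply: (@le_trans _ _ (kappa * (r - s) * x T)).
      by apply: ler_pM => //; rewrite subr_ge0.
    rewrite [leRHS]mulrAC; apply: ler_wpM2r; first exact: le_trans xsT.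
    by rewrite ler_pM2l// lerD2r.
  by rewrite /V; lra.
have fB t : 0 <= t -> t <= T -> `|f t| <= `|f 0| + (V T - V 0).
  move=> t0 tT; rewrite -[f t](subrK (f 0)) addrC.
  apply: (le_trans (ler_normD _ _)); rewrite lerD2l.
  exact: fV.
have [C C0 CP] := integrating_factor (ltW kappa0) T0 fB fV IP A_nd JA.
have D2c t : 0 <= t -> t <= T -> expR (kappa * t) * f t - J t = lambda0 - lbar.
  by move=> t0 tT; rewrite /f mulrBr -/(x t) xE// /mild_drift; ring.
have : f T + kappa * I T - A T = f 0 + kappa * I 0 - A 0.
  apply: (@quadratic_increments _ (fun t => f t + kappa * I t - A t)
    (fun t => t + V t + A t) C) => // s t s0 st tT.
  apply: le_trans (CP s t s0 st tT); rewrite !D2c ?(le_trans st)//; last first.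
    exact: le_trans st.
  rewrite subrr sub0r normrN normrM (gtr0_norm (expR_gt0 _)) ler_peMl//.
  by rewrite -expR0 ler_expR mulr_ge0// ltW.
rewrite I0 mulr0 addr0 A00 subr0 [f 0]/f => E.
have l0E : l 0 = lambda0 by move: x0E; rewrite /x mulr0 expR0 mul1r.
rewrite drift_integral// jump_sumE -(fineK (Afin (lexx T))) -!EFinD; congr EFin.
by rewrite -/(A T); move: E; rewrite l0E /f; lra.
Qed.

End finite_horizon.

End jump_equation.

(** * Thinning as the mass below a left limit *)

Section right_continuity.
Context {R : realType} dT (T : measurableType dT).
Variables (tau : T -> R) (mtau : measurable_fun setT tau).
Variables (m : {measure set T -> \bar R}) (P : set T).
Hypotheses (mP : measurable P).
Hypothesis fin : forall t, (m ([set z | (tau z <= t)%R] `&` P) < +oo)%E.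

Lemma mass_right_continuous t :
  fine (m ([set z | tau z <= s] `&` P)) @[s --> t^'+] -->
  fine (m ([set z | tau z <= t] `&` P)).
Proof.
have mS s : measurable ([set z | tau z <= s] `&` P).
  by apply: measurableI => //; exact: measurable_before.
have mfin s : m ([set z | tau z <= s] `&` P) \is a fin_num by rewrite ge0_fin_numE.
have nd s u : s <= u ->
    fine (m ([set z | tau z <= s] `&` P)) <= fine (m ([set z | tau z <= u] `&` P)).
  move=> su; apply: fine_le => //; apply: le_measure; rewrite ?inE//.
  by apply: setSI => z /= zs; exact: le_trans zs su.
pose E n := [set z | tau z <= t + n.+1%:R^-1] `&` P.
have capE : \bigcap_n E n = [set z | tau z <= t] `&` P.
  apply/seteqP; split=> z; last first.
    by move=> [/= zt Pz] n _; split => //=; rewrite (le_trans zt)// lerDl invr_ge0.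
  move=> zE; split; last by have [] := zE 0%N I.
  rewrite /= leNgt; apply/negP => tz.
  have d0 : 0 < tau z - t by rewrite subr_gt0.
  have [/= zn _] := zE (Num.truncn (tau z - t)^-1) I.
  move: zn; rewrite -lerBlDl leNgt => /negP; apply.
  by rewrite invf_plt ?posrE// truncnS_gt.
have cvgE : m (E n) @[n --> \oo] --> m ([set z | tau z <= t] `&` P).
  rewrite -capE; apply: nonincreasing_cvg_mu => //.
  - exact: fin.
  - by move=> n; exact: mS.
  - by rewrite capE.
  - move=> i j ij; apply/subsetPset; apply: setSI => z /= zj.
    by rewrite (le_trans zj)// lerD2l lef_pV2 ?posrE// ler_nat ltnS.
apply/cvgrPdist_lt => e e0.
have /fine_cvgP[_ /cvgrPdist_lt/(_ e e0)[n _ /(_ n (leqnn n))/=]] : m (E n) @[n --> \oo]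
    --> (fine (m ([set z | tau z <= t] `&` P)))%:E by rewrite fineK.
rewrite distrC ger0_norm ?subr_ge0; last by rewrite nd// lerDl invr_ge0.
move=> En; near=> s.
have ts : t <= s by near: s; exact: nbhs_right_ge.
have sn : s <= t + n.+1%:R^-1.
  by near: s; apply: nbhs_right_le; rewrite ltrDl invr_gt0.
rewrite distrC ger0_norm ?subr_ge0 ?nd//.
by rewrite (le_lt_trans _ En)// lerD2r nd.
Unshelve. all: by end_near. Qed.

End right_continuity.

Section thinning.
Context {R : realType}.
Variables (kappa : R) (l : R -> R).
Let x t := expR (kappa * t) * l t.
Hypothesis x_nd : forall s t, 0 <= s -> s <= t -> x s <= x t.

Let range_before s := [set x r | r in [set r | 0 <= r < s]].

Let has_sup_before s : 0 < s -> has_sup (range_before s).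
Proof.
move=> s0; split; first by exists (x 0); exists 0 => //=; rewrite lexx.
by exists (x s) => _ [r /andP[r0 rs] <-]; rewrite x_nd// ltW.
Qed.

(** The left limit of a nondecreasing function is the supremum of its earlier
    values. *)
Lemma left_cvg_sup s : 0 < s ->
  l r @[r --> s^'-] --> expR (- (kappa * s)) * sup (range_before s).
Proof.
move=> s0; rewrite (_ : l = fun t => expR (- (kappa * t)) * x t); last first.
  by apply/funext => t; rewrite /x mulrA -expRD addNr expR0 mul1r.
apply: cvgM.
  apply: cvg_at_left_filter; apply: continuous_comp; last exact: continuous_expR.
  by apply: cvgN; apply: cvgM; [exact: cvg_cst|exact: cvg_id].
apply/cvgrPdist_lt => e e0.
have [_ [r0 /andP[r00 r0s] <-] xr0] := sup_adherent e0 (has_sup_before s0).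
near=> r.
have r0r : r0 < r by near: r; exact: nbhs_left_gt.
have rs : r < s by near: r; exact: nbhs_left_lt.
have r_ge0 : 0 <= r by rewrite (le_trans r00)// ltW.
rewrite ger0_norm; last first.
  rewrite subr_ge0; apply: ub_le_sup; first by case: (has_sup_before s0).
  by exists r => //=; rewrite r_ge0.
by rewrite ltrBlDr -ltrBlDl (lt_le_trans xr0)// x_nd// ltW.
Unshelve. all: by end_near. Qed.

Lemma left_limit_sup s : 0 < s ->
  left_limit l s = expR (- (kappa * s)) * sup (range_before s).
Proof.
move=> s0; rewrite /left_limit leNgt s0/=; apply/cvg_lim => //.
exact: left_cvg_sup.
Qed.

Let tau (z : R * R * R) := z.1.1.

Lemma region_closed_left_limit z : 0 < tau z ->
  region_closed tau (level kappa) (EFin \o x) z <-> z.2 <= left_limit l (tau z).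
Proof.
move=> z0; have hs := has_sup_before z0.
rewrite left_limit_sup// -ler_pdivrMl ?expR_gt0// -expRN opprK -/(level kappa z).
split=> [zx|zsup e e0].
  apply/ler_addgt0Pr => e e0; have [r [r0 rz]] := zx e e0.
  rewrite -EFinD lte_fin => /ltW/le_trans; apply; rewrite lerD2r.
  by apply: ub_le_sup; [case: hs|exists r => //=; rewrite r0].
have [_ [r /andP[r0 rz] <-] xr] := sup_adherent e0 hs.
exists r; split => //; rewrite -EFinD lte_fin.
by rewrite (le_lt_trans zsup)// -ltrBlDr.
Qed.

Definition kept : set (R * R * R) := [set z | 0 <= z.2 /\ z.2 <= left_limit l z.1.1].

Let x_path : nondecreasing_path (EFin \o x).
Proof. by move=> s t s0 st; rewrite lee_fin x_nd. Qed.

Let mtau : measurable_fun setT tau.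
Proof. exact: measurableT_comp. Qed.

Lemma measurable_below_left_limit :
  measurable [set z : R * R * R | z.2 <= left_limit l z.1.1].
Proof.
rewrite (_ : [set z | _] =
    ([set z | tau z <= 0] `&` (snd @^-1` `]-oo, l 0]%classic)) `|`
    ((tau @^-1` `]0, +oo[%classic) `&` region_closed tau (level kappa) (EFin \o x))).
  apply: measurableU; apply: measurableI.
  - exact: measurable_before.
  - by rewrite -[X in measurable X]setTI; exact: measurable_snd.
  - by rewrite -[X in measurable X]setTI; exact: mtau.
  - by apply: measurable_region_closed => //; exact: measurable_level.
apply/seteqP; split => z /=; rewrite !in_itv/= ?andbT.
  have [z0|z0] := leP (tau z) 0 => zl.
    by left; split => //; move: zl; rewrite /left_limit z0.
  by right; split => //; apply/region_closed_left_limit.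
move=> [[z0 zl]|[z0 /(region_closed_left_limit z0)//]].
by rewrite /left_limit z0.
Qed.

Lemma measurable_kept : measurable kept.
Proof.
apply: measurableI; last exact: measurable_below_left_limit.
rewrite (_ : (fun _ => _) = snd @^-1` `[0, +oo[%classic).
  by rewrite -[X in measurable X]setTI; exact: measurable_snd.
by apply/seteqP; split => z /=; rewrite in_itv/= andbT.
Qed.

Variable N : {measure set (R * R * R)%type -> \bar R}.

Lemma thinningE (A : set (R * R)) : measurable A ->
  thinning l N A = N (fst @^-1` A `&` kept).
Proof.
move=> mA; rewrite /thinning.
have mD : measurable [set z : R * R * R | A z.1 /\ 0 <= z.2].
  apply: measurableI.
    by rewrite -[X in measurable X]setTI; apply: measurable_fst.
  rewrite (_ : (fun _ => _) = snd @^-1` `[0, +oo[%classic).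
    by rewrite -[X in measurable X]setTI; exact: measurable_snd.
  by apply/seteqP; split => z /=; rewrite in_itv/= andbT.
rewrite integral_indic//; last exact: measurable_below_left_limit.
by congr (N _); apply/seteqP; split => [z [zl [Az z0]]|z [Az [z0 zl]]].
Qed.

Variables (a eta : R) (a0 : 0 < a) (eta0 : 0 <= eta).
Hypothesis N_mark : N (~` mark_space) = 0%E.
Variable mu : {measure set (R * R)%type -> \bar R}.
Hypothesis muE : forall A, measurable A -> mu A = thinning l N A.

Let n := density_measure N (weight_ge0 a0 kappa eta0) (measurable_weight a kappa eta).

(** The points of the closed region that the thinning discards have a null mark or a
    negative level; they lie outside [mark_space], where [N] has no mass. *)
Lemma compounded_jump_sum_accum t :
  compounded_jump_sum mu kappa eta a t =
  accum_closed tau (level kappa) n (EFin \o x) t.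
Proof.
pose h (y : R * R) := (expR (kappa * y.1) * (eta * gfun a y.2))%:E.
have mh : measurable_fun setT h.
  apply/measurable_EFinP; apply: measurable_funM.
    by apply: measurableT_comp => //; exact: measurable_funM.
  apply: measurable_funM => //.
  by apply: (measurableT_comp (measurable_gfun a)).
have h0 y : (0 <= h y)%E.
  by rewrite lee_fin mulr_ge0 ?expR_ge0// mulr_ge0// gfun_ge0.
have mk := measurable_kept.
have mfst : measurable_fun setT (@fst (R * R) R) by exact: measurable_fst.
pose D := fst @^-1` jumps t : set (R * R * R).
have mD : measurable D.
  by rewrite -[X in measurable X]setTI; apply: mfst => //; exact: measurable_jumps.
have mark_measurable : measurable (@mark_space R).
  rewrite (_ : mark_space = (tau @^-1` `[0, +oo[%classic) `&`
    (((fun z => z.1.2) @^-1` (~` [set 0])) `&` (snd @^-1` `[0, +oo[%classic))).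
    apply: measurableI; first by rewrite -[X in measurable X]setTI; exact: mtau.
    apply: measurableI; rewrite -[X in measurable X]setTI; last exact: measurable_snd.
    have msnd : measurable_fun setT (fun z : R * R * R => z.1.2).
      exact: (measurableT_comp measurable_snd measurable_fst).
    by apply: msnd => //; exact: measurableC.
  apply/seteqP; split => z; rewrite /mark_space/= !in_itv/= !andbT.
    by move=> [z0 /eqP z1 z2].
  by move=> [z0 [/eqP z1 z2]].
have mS : measurable ([set z | tau z <= t] `&`
    region_closed tau (level kappa) (EFin \o x)).
  by apply: measurable_accum_closed => //; exact: measurable_level.
transitivity (n (kept `&` D)).
  rewrite /compounded_jump_sum.
  rewrite (eq_measure_integral (image_measure (mrestr N mk) mfst)); last first.
    by move=> A mA _; rewrite muE// thinningE.
  rewrite (@ge0_integral_image _ _ _ _ _ (mrestr N mk) _ mfst h (jumps t)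
    (measurable_jumps t) (measurable_funTS mh) (fun y _ => h0 y)).
  rewrite -/D integral_mkcond ge0_integral_mrestr; last 2 first.
  - by move=> z; apply: erestrict_ge0 => ? _; exact: h0.
  - by apply/(measurable_restrictT _ mD); apply: measurable_funTS;
      exact: measurable_weight.
  by rewrite -integral_mkcondr.
rewrite /accum_closed.
set S := _ `&` region_closed _ _ _ in mS *.
rewrite -[in RHS](setIT S) -(setUv mark_space) setIUr measureU; last 3 first.
- exact: measurableI.
- by apply: measurableI => //; exact: measurableC.
- by rewrite setIACA setICr setI0.
have Z : n (S `&` ~` mark_space) = 0%E.
  apply/eqP; rewrite eq_le measure_ge0 andbT.
  apply: (@le_trans _ _ (n (~` mark_space))).
    apply: le_measure; rewrite ?inE//; last exact: measurableC.
    by apply: measurableI => //; exact: measurableC.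
  rewrite /n /= /density_measure null_set_integral//; first exact: measurableC.
  exact: (measurable_funTS (measurable_weight a kappa eta)).
rewrite [X in (_ + X)%E](_ : _ = 0%E); last exact: Z.
rewrite adde0; congr (density_measure _ _ _ _); apply/seteqP; split.
  move=> z [[z0 zl] [t0 tt z1]]; split; last by split => //; exact: ltW.
  by split => //; apply/region_closed_left_limit.
move=> z [[zt zc] [t0 z1 z0]].
have tz : 0 < tau z by have [r [r0 rz _]] := zc 1 ltr01; exact: le_lt_trans rz.
by split; [split => //; apply/(region_closed_left_limit tz)|split].
Qed.

End thinning.

(** * The equation along one path *)

Section mild_drift.
Context {R : realType}.
Variables (kappa lbar lambda0 : R).
Hypotheses (kappa0 : 0 < kappa) (lbar0 : 0 < lbar) (l00 : 0 < lambda0).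

Notation drift := (mild_drift kappa lbar lambda0).

Lemma mild_drift_nd s t : 0 <= s -> s <= t -> drift s <= drift t.
Proof. by move=> _ st; rewrite lerD2l ler_pM2l// lerD2r ler_expR ler_pM2l. Qed.

Lemma mild_drift0 : drift 0 = lambda0.
Proof. by rewrite /mild_drift mulr0 expR0 subrr mulr0 addr0. Qed.

Lemma mild_drift_ge0 t : 0 <= t -> 0 <= drift t.
Proof. by move=> t0; rewrite (le_trans _ (mild_drift_nd (lexx 0) t0))// mild_drift0 ltW. Qed.

Lemma mild_drift_le b t : kappa <= b -> 0 <= t ->
  drift t <= (lambda0 + lbar) * expR (b * t).
Proof.
move=> kb t0; have e1 : 1 <= expR (kappa * t).
  by rewrite -expR0 ler_expR mulr_ge0// ltW.
have : expR (kappa * t) <= expR (b * t) by rewrite ler_expR ler_wpM2r.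
rewrite /mild_drift; move: (expR (kappa * t)) (expR (b * t)) e1 => e e' e1 ee'.
have h1 : 0 <= lambda0 * (e' - 1) by rewrite mulr_ge0 ?subr_ge0 ?(le_trans e1)// ltW.
have h2 : 0 <= lbar * (e' - e) by rewrite mulr_ge0 ?subr_ge0// ltW.
rewrite -subr_ge0 (_ : _ - _ = lambda0 * (e' - 1) + (lbar * (e' - e) + lbar)).
  by rewrite !addr_ge0// ltW.
by ring.
Qed.

Lemma cvg_expR_mul k (t : R) : expR (k * s) @[s --> t] --> expR (k * t).
Proof.
apply: continuous_comp; last exact: continuous_expR.
by apply: cvgM; [exact: cvg_cst|exact: cvg_id].
Qed.

Lemma discountK (t : R) x : expR (kappa * t) * (expR (- (kappa * t)) * x) = x.
Proof. by rewrite mulrA -expRD addrN expR0 mul1r. Qed.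

Lemma discounted_cadlag (l : R -> R) (x := fun t => expR (kappa * t) * l t) :
  (forall s t, 0 <= s -> s <= t -> x s <= x t) ->
  (forall t, 0 <= t -> x s @[s --> t^'+] --> x t) -> cadlag l.
Proof.
move=> x_nd x_rc; split => t t0; last first.
  by apply/cvg_ex; eexists; exact: (left_cvg_sup x_nd t0).
have lE s : l s = expR (- kappa * s) * x s.
  by rewrite /x mulrA -expRD mulNr addNr expR0 mul1r.
rewrite lE (_ : l = fun s => expR (- kappa * s) * x s); last exact/funext.
apply: cvgM; last exact: x_rc.
by apply: cvg_at_right_filter; exact: cvg_expR_mul.
Qed.

End mild_drift.

Section path.
Context {R : realType}.
Variables kappa lbar eta a lambda0 : R.
Hypotheses (kappa0 : 0 < kappa) (lbar0 : 0 < lbar) (eta0 : 0 <= eta) (a0 : 0 < a).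
Hypothesis l00 : 0 < lambda0.
Variable N : {measure set (R * R * R)%type -> \bar R}.
Hypothesis N_mark : N (~` mark_space) = 0%E.
Variable l : R -> R.
Variable mu : {measure set (R * R)%type -> \bar R}.
Hypothesis muE : forall A, measurable A -> mu A = thinning l N A.

Let x t := expR (kappa * t) * l t.
Let n : {measure set (R * R * R)%type -> \bar R} :=
  density_measure N (weight_ge0 a0 kappa eta0) (measurable_weight a kappa eta).
Notation tau := (fun z : R * R * R => z.1.1).

Definition mild_path := [/\
  forall s t, 0 <= s -> s <= t -> x s <= x t,
  forall t, 0 <= t -> x s @[s --> t^'+] --> x t &
  forall t, 0 <= t -> ((x t)%:E = (mild_drift kappa lbar lambda0 t)%:E +
    accum_closed tau (level kappa) n (EFin \o x) t)%E].

Definition integrated_path := forall t : R, 0 <= t ->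
  ((l t)%:E = lambda0%:E
    + \int[lebesgue_measure]_(s in `[0%R, t]) (kappa * (lbar - l s))%:E
    + eta%:E * \int[mu]_(z in jumps t) (gfun a z.2)%:E)%E.

Lemma integrated_path_mild : cadlag l -> integrated_path -> mild_path.
Proof.
move=> [l_rc _] eqn.
have mild t : 0 <= t -> ((x t)%:E = (mild_drift kappa lbar lambda0 t)%:E +
    compounded_jump_sum mu kappa eta a t)%E.
  move=> t0.
  have : (l t)%:E \is a fin_num by [].
  rewrite eqn// fin_numD => /andP[]; rewrite fin_numD => /andP[_ If].
  rewrite jump_sumE// => Jf.
  have ml : measurable_fun `[0, t] l by exact: right_continuous_measurable.
  have mk : measurable_fun `[0, t] (fun s => kappa * (lbar - l s)).
    by apply: measurable_funM => //; exact: measurable_funB.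
  apply: integrated_to_mild => //; first by rewrite ltey_eq Jf.
    have kl : lebesgue_measure.-integrable `[0, t]
        (EFin \o (fun s => kappa * (lbar - l s))).
      by apply/integrableP; split; [exact/measurable_EFinP|rewrite integral_fin_num_abs].
    rewrite (_ : EFin \o _ = (fun s =>
      (- kappa^-1)%:E * (EFin \o (fun s => (kappa * (lbar - l s))%R)) s)%E).
      exact: integrableZl.
    apply/funext => s /=; rewrite -EFinM; congr EFin.
    by field; rewrite gt_eqF.
  by move=> s s0 _; exact: eqn.
have x_nd s t : 0 <= s -> s <= t -> x s <= x t.
  move=> s0 st; rewrite -lee_fin !mild ?(le_trans s0)//; apply: leeD.
    by rewrite lee_fin mild_drift_nd.
  exact: compounded_jump_sum_nd.
split => // t t0.
  apply: cvgM; last exact: l_rc.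
  by apply: cvg_at_right_filter; exact: cvg_expR_mul.
by rewrite mild// (compounded_jump_sum_accum x_nd a0 eta0 N_mark muE).
Qed.

Lemma mild_path_integrated : mild_path -> integrated_path.
Proof.
move=> [x_nd x_rc mild] t t0.
have x0 s : 0 <= s -> 0 <= x s.
  move=> s0; rewrite -lee_fin mild// adde_ge0// lee_fin.
  exact: mild_drift_ge0.
have [l_rc _] : cadlag l by exact: (discounted_cadlag x_nd).
have ml : measurable_fun `[0, t] l by exact: right_continuous_measurable.
have lE s : l s = expR (- (kappa * s)) * x s.
  by rewrite /x mulrA -expRD addNr expR0 mul1r.
have JE := compounded_jump_sum_accum x_nd a0 eta0 N_mark muE.
apply: mild_to_integrated => //.
- apply/(@jump_sum_finite _ mu kappa) => //; rewrite JE.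
  apply: le_lt_trans (ltry (x t)).
  by rewrite mild// leeDr// lee_fin mild_drift_ge0.
- have mf : measurable_fun `[0, t] (fun s => l s - lbar) by exact: measurable_funB.
  apply: measurable_bounded_integrable => //.
    by rewrite /= lebesgue_measure_itv/=; case: ifP; rewrite ?ltry.
  exists (x t + lbar); split; first exact: num_real.
  move=> B xB s /=; rewrite in_itv/= => /andP[s0 st].
  have ls0 : 0 <= l s by rewrite lE mulr_ge0 ?expR_ge0 ?x0.
  have lsx : l s <= x t.
    rewrite (le_trans _ (x_nd s t s0 st))// ler_peMl//.
    by rewrite -expR0 ler_expR mulr_ge0// ltW.
  apply: ltW; apply: le_lt_trans xB; have := ltW lbar0; move: ls0 lsx.
  move: (l s) (x t) => u v u0 uv lb0; rewrite ler_norml; apply/andP; split.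
    by rewrite opprD lerD2r (le_trans _ u0)// oppr_le0 (le_trans u0).
  by apply: lerD => //; rewrite (le_trans _ lb0)// oppr_le0.
- by move=> s u s_ge0 su _; exact: x_nd.
- by move=> s s0 _; rewrite JE; exact: mild.
Qed.
End path.

(** * Existence and uniqueness *)

Section nonmeasurable_integrand.
Context d (T : measurableType d) (R : realType) (mu : {measure set T -> \bar R}).
Import HBNNSimple.

(** The integral of a nonnegative function is a supremum over the simple functions
    below it, so it is monotone for arbitrary integrands. *)
Lemma ge0_le_integralT (f g : T -> \bar R) : (forall x, 0 <= f x)%E ->
  (forall x, f x <= g x)%E -> (\int[mu]_x f x <= \int[mu]_x g x)%E.
Proof.
move=> f0 fg; have g0 x : (0 <= g x)%E := le_trans (f0 x) (fg x).
rewrite !ge0_integralTE//; apply: ereal_sup_le => _ [h hf <-].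
by exists h => // x; exact: le_trans (hf x) (fg x).
Qed.

End nonmeasurable_integrand.

Section existence_uniqueness.
Context d (Omega : measurableType d) (R : realType) (Q : probability Omega R).
Variables (F : R -> set (set Omega)) (usual : usual_conditions Q F).
Variable m : {sigma_finite_measure set (R * R * R)%type -> \bar R}.
Variables kappa lbar eta a lambda0 c : R.
Hypotheses (kappa0 : 0 < kappa) (lbar0 : 0 < lbar) (eta0 : 0 <= eta) (a0 : 0 < a).
Hypotheses (l00 : 0 < lambda0) (c0 : 0 <= c).
Hypothesis cellE : forall s u q, 0 <= s -> s <= u -> 0 <= q ->
  (\int[m]_(z in [set z | (s < z.1.1 <= u)%R /\ (level kappa z < q)%R])
     weight a kappa eta z = (c * (u - s) * q)%:E)%E.
Variable N : Omega -> {measure set (R * R * R)%type -> \bar R}.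
Hypothesis prmN : adapted_poisson_random_measure Q F m N.

Notation tau := (fun z : R * R * R => z.1.1).
Notation lev := (level kappa).
Notation drift := (mild_drift kappa lbar lambda0).
Notation sol := (solution Q F kappa lbar eta a lambda0 N).

Let n w : {measure set (R * R * R)%type -> \bar R} :=
  density_measure (N w) (weight_ge0 a0 kappa eta0) (measurable_weight a kappa eta).

Let fF : filtration F. Proof. by case: usual. Qed.

Let sF (t : R) : 0 <= t -> sigma_algebra setT (F t).
Proof. by case: fF => + _ _; exact. Qed.

Let mtau : measurable_fun setT tau.
Proof. exact: measurableT_comp. Qed.

Let mlev : measurable_fun setT lev := measurable_level kappa.

Let nF : adapted_random_measure F tau n.
Proof. by move=> t A t0 mA At; exact: (weighted_prm_adapted fF prmN). Qed.

Let nc : cell_intensity Q F tau lev n c.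
Proof.
move=> s u q E s0 su q0 FE; rewrite -cellE//.
apply: (weighted_prm_intensity fF prmN _ _ s0 su FE).
  exact: (measurable_cell mtau mlev).
by move=> z [].
Qed.

Let N_mark w : N w (~` mark_space) = 0%E.
Proof. by case: prmN => -[]. Qed.

Let drift_ge0 (t : R) : 0 <= t -> 0 <= drift t.
Proof. exact: mild_drift_ge0. Qed.

Let drift_nd (s t : R) : 0 <= s -> s <= t -> drift s <= drift t.
Proof. exact: mild_drift_nd. Qed.

Let b := kappa + 2 * c.
Let A0 : 0 <= lambda0 + lbar. Proof. by rewrite addr_ge0// ltW. Qed.
Let b0 : 0 < b. Proof. by rewrite ltr_pwDl// mulr_ge0. Qed.
Let cb : 2 * c <= b. Proof. by rewrite lerDr ltW. Qed.

Let driftA (t : R) : 0 <= t -> drift t <= (lambda0 + lbar) * expR (b * t).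
Proof. by apply: mild_drift_le => //; rewrite lerDl mulr_ge0. Qed.

Let X := minimal_solution tau lev n drift.

Let X_process : increasing_process F X :=
  minimal_process fF mtau mlev nF nc drift_ge0 drift_nd.

Let X_closed := ae_accum_closed fF mtau mlev c0 nF nc drift_ge0 drift_nd A0 b0 cb driftA.

Let X_unique := ae_unique fF mtau mlev c0 nF nc drift_ge0 drift_nd A0 b0 cb driftA.

Let X_mean := minimal_mean fF mtau mlev c0 nF nc drift_ge0 drift_nd A0 b0 cb driftA.

Let X_fixpoint (t : R) w : 0 <= t -> X t w = operator tau lev drift (n w) (X ^~ w) t.
Proof. exact: (minimal_fixpoint_process mtau mlev n drift_ge0 drift_nd). Qed.

Lemma solution_minimal lambda mu : sol lambda mu ->
  {ae Q, forall w, forall t : R, 0 <= t ->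
    (expR (kappa * t) * lambda t w)%:E = X t w}.
Proof.
move=> [adapt cad muE eqn]; apply: X_unique => //.
  move=> t t0; apply/(measurable_wrtP (sF t0)); apply: measurable_funM => //.
  by apply/(measurable_wrtP (sF t0)); exact: adapt.
apply: filterS2 muE eqn => w muE eqn.
exact: (integrated_path_mild kappa0 lbar0 eta0 a0 (N_mark w) muE (cad w) eqn).
Qed.

(** Both intensities are the least fixed point in the exponential scale.  Their paths
    agree at nonnegative times, hence so do their left limits, which determine the
    thinnings. *)
Lemma solution_unique lambda lambda' mu mu' :
  sol lambda mu -> sol lambda' mu' -> indistinguishable Q lambda lambda' mu mu'.
Proof.
move=> H H'; have [_ _ muE _] := H; have [_ _ muE' _] := H'.
have [_ x_nd _] := X_process.
apply: filterS2 (filterI (solution_minimal H) (solution_minimal H')) (filterI muE muE').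
move=> w [XE XE'] [muwE muwE'].
have lE t : 0 <= t -> lambda t w = lambda' t w.
  move=> t0; have := XE t t0; rewrite -XE'// => -[].
  by apply: mulfI; rewrite gt_eqF// expR_gt0.
split; first exact: lE.
move=> A mA; rewrite (muwE A mA) (muwE' A mA) /thinning.
have nd l : (forall t : R, 0 <= t -> (expR (kappa * t) * l t)%:E = X t w) ->
    forall s t, 0 <= s -> s <= t -> expR (kappa * s) * l s <= expR (kappa * t) * l t.
  by move=> lX s t s0 st; rewrite -lee_fin !lX ?(le_trans s0)//; exact: x_nd.
rewrite (_ : left_limit (lambda ^~ w) = left_limit (lambda' ^~ w))//.
apply/funext => t; have [t0|t0] := leP t 0.
  by rewrite /left_limit t0 lE.
rewrite (left_limit_sup (nd _ XE) t0) (left_limit_sup (nd _ XE') t0).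
congr (_ * sup _); apply/seteqP; split => _ [r /andP[r0 rt] <-];
  by exists r => /=; rewrite ?r0 ?lE.
Qed.

Let good : set Omega := [set w | forall t : R, 0 <= t ->
  accum_closed tau lev (n w) (X^~ w) t = accum tau lev (n w) (X^~ w) t /\
  (X t w < +oo)%E].

Let F_good (t : R) : 0 <= t -> F t good.
Proof.
move=> t0; have [_ sC _] := sF t0; have [_ _ FN] := usual.
rewrite -[good]setCK -setTD; apply: sC.
have [_ _ /(_ _ _ (lexx 0) t0)] := fF; apply; apply: FN.
exact: X_closed.
Qed.

(** Off the almost sure event [good] the least fixed point is replaced by the drift, so
    that every path is real valued and cadlag.  The process stays adapted because null
    sets belong to [F 0]. *)
Definition discounted_minimal (t : R) w : R :=
  expR (- (kappa * t)) * (drift t + \1_good w * (fine (X t w) - drift t)).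

Notation lambda := discounted_minimal.

Let x t w := expR (kappa * t) * lambda t w.

Let xE t w : x t w = if w \in good then fine (X t w) else drift t.
Proof.
rewrite /x discountK indicE; case: ifP; first by rewrite mul1r addrC subrK.
by rewrite mul0r addr0.
Qed.

Let good_fin t w : good w -> 0 <= t -> X t w \is a fin_num.
Proof.
move=> gw t0; rewrite ge0_fin_numE; first by case: (gw t t0).
by case: X_process => + _ _; exact.
Qed.

Let x_good t w : good w -> 0 <= t -> (x t w)%:E = X t w.
Proof. by move=> gw t0; rewrite xE mem_set// fineK// good_fin. Qed.

Let x_nd w s t : 0 <= s -> s <= t -> x s w <= x t w.
Proof.
move=> s0 st; rewrite !xE; case: ifPn => [/set_mem gw|_]; last exact: drift_nd.
rewrite fine_le ?good_fin ?(le_trans s0)//.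
by case: X_process => _ + _; exact.
Qed.

Let drift_le_X t w : 0 <= t -> ((drift t)%:E <= X t w)%E.
Proof. by move=> t0; rewrite X_fixpoint// leeDl. Qed.

Let x_le_X t w : 0 <= t -> ((x t w)%:E <= X t w)%E.
Proof.
move=> t0; have [gw|gw] := pselect (good w); first by rewrite x_good.
by rewrite xE memNset// drift_le_X.
Qed.

Let x_ge0 t w : 0 <= t -> 0 <= x t w.
Proof.
move=> t0; rewrite xE; case: ifP => _; last exact: drift_ge0.
by apply: fine_ge0; case: X_process => + _ _; exact.
Qed.

Let lambdaE t w : lambda t w = expR (- (kappa * t)) * x t w.
Proof. by rewrite /x mulrA -expRD addNr expR0 mul1r. Qed.

Lemma discounted_minimal_ge0 t w : 0 <= t -> 0 <= lambda t w.
Proof. by move=> t0; rewrite lambdaE mulr_ge0 ?expR_ge0 ?x_ge0. Qed.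

Let x_rc w t : 0 <= t -> x s w @[s --> t^'+] --> x t w.
Proof.
move=> t0.
have drift_rc : drift s @[s --> t^'+] --> drift t.
  apply: cvgD; first exact: cvg_cst.
  apply: cvgM; first exact: cvg_cst.
  apply: cvgB; last exact: cvg_cst.
  by apply: cvg_at_right_filter; exact: cvg_expR_mul.
have [gw|gw] := pselect (good w); last first.
  by rewrite (_ : x ^~ w = drift) ?xE ?memNset//; apply/funext => s; rewrite xE memNset.
pose P := region tau lev (X ^~ w).
have mP : measurable P.
  by apply: measurable_region => //; case: X_process => _ + _; exact.
have fin s : 0 <= s -> (n w ([set z | (tau z <= s)%R] `&` P) < +oo)%E.
  move=> s0; have [_] := gw s s0; rewrite X_fixpoint//; apply: le_lt_trans.
  by rewrite leeDr// lee_fin drift_ge0.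
have xD s : 0 <= s -> x s w = drift s + fine (n w ([set z | (tau z <= s)%R] `&` P)).
  move=> s0; apply: EFin_inj; rewrite x_good// X_fixpoint// EFinD fineK//.
  by rewrite ge0_fin_numE// fin.
rewrite xD//.
apply: (@cvg_trans _ (drift s + fine (n w ([set z | (tau z <= s)%R] `&` P)) @[s --> t^'+])).
  apply: near_eq_cvg; near=> s; rewrite xD//.
  by rewrite (le_trans t0)//; near: s; exact: nbhs_right_ge.
apply: cvgD => //; apply: mass_right_continuous => // s.
apply: (@le_lt_trans _ _ (n w ([set z | (tau z <= Num.max s 0)%R] `&` P))).
  apply: le_measure; rewrite ?inE; try by apply: measurableI => //; exact: measurable_before.
  by apply: setSI => z /= zs; rewrite le_max zs.
by rewrite fin// le_max lexx orbT.
Unshelve. all: by end_near. Qed.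

Let lambda_adapted : adapted F lambda.
Proof.
move=> t t0; apply/(measurable_wrtP (sF t0)); apply: measurable_funM => //.
apply: measurable_funD => //; apply: measurable_funM.
  by apply: measurable_indic; rewrite (measurable_sub (sF t0)); exact: F_good.
apply: measurable_funB => //; apply: measurableT_comp => //.
by apply/(measurable_wrtP (sF t0)); case: X_process => _ _; exact.
Qed.

Definition thinned w : {measure set (R * R)%type -> \bar R} :=
  image_measure (mrestr (N w) (measurable_kept (x_nd w))) measurable_fst.

Let thinnedE w A : measurable A -> thinned w A = thinning (lambda ^~ w) (N w) A.
Proof. by move=> mA; rewrite (thinningE (x_nd w)). Qed.

Lemma thinned_solution : sol lambda thinned.
Proof.
split => //.
- move=> w; apply: (discounted_cadlag (x_nd w)) => t; exact: x_rc.
- by apply: aeW => w A mA; exact: thinnedE.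
- apply: filterS X_closed => w gw.
  refine (mild_path_integrated kappa0 lbar0 l00 (N_mark w) (@thinnedE w) _).
  split; [exact: x_nd|by move=> t; exact: x_rc|move=> t t0].
  transitivity (X t w); first exact: x_good.
  have [closedE _] := gw t t0.
  transitivity ((drift t)%:E + accum tau lev (n w) (X ^~ w) t)%E; first exact: X_fixpoint.
  rewrite -closedE; apply: (f_equal (fun y => (drift t)%:E + y)%E).
  apply: (f_equal (fun S => n w ([set z | (tau z <= t)%R] `&` S))).
  apply/seteqP; split=> z zx e e0;
    have [r [r0 rz ze]] := zx e e0; exists r; split => //; move: ze;
    have /= -> // := x_good gw r0.
Qed.

Let lambda_integral w (T : R) : 0 <= T ->
  (\int[lebesgue_measure]_(s in `[0%R, T]) (lambda s w)%:E <= T%:E * (x T w)%:E)%E.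
Proof.
move=> T0.
have [rc _] : cadlag (lambda ^~ w) by apply: (discounted_cadlag (x_nd w)) => t; exact: x_rc.
have ml : measurable_fun `[0, T] (lambda ^~ w) by exact: right_continuous_measurable.
apply: (@le_trans _ _ (\int[lebesgue_measure]_(s in `[0%R, T]) (x T w)%:E)%E).
  apply: ge0_le_integral => //.
  - by move=> s /=; rewrite in_itv/= => /andP[s0 _]; rewrite lee_fin discounted_minimal_ge0.
  - exact/measurable_EFinP.
  - move=> s /=; rewrite in_itv/= => /andP[s0 sT]; rewrite lee_fin.
    apply: (le_trans _ (x_nd w s0 sT)).
    rewrite lambdaE; apply: ler_piMl; first exact: x_ge0.
    by rewrite -expR0 ler_expR oppr_le0 mulr_ge0// ltW.
rewrite integral_cst//= lebesgue_measure_itv/= muleC; case: ifPn => [_|].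
  by rewrite oppr0 adde0.
rewrite lte_fin -leNgt => TN; have -> : T = 0 by apply/eqP; rewrite eq_le TN.
by rewrite !mul0e.
Qed.

Lemma discounted_minimal_integral w (T : R) : 0 <= T ->
  (\int[lebesgue_measure]_(s in `[0%R, T]) (lambda s w)%:E < +oo)%E.
Proof. by move=> /(lambda_integral w)/le_lt_trans; apply; rewrite -EFinM ltry. Qed.

(** The intensity up to time [T] is bounded by the least fixed point at [T], whose mean is
    finite. *)
Lemma discounted_minimal_mean (T : R) : 0 <= T ->
  (\int[Q]_w \int[lebesgue_measure]_(s in `[0%R, T]) (lambda s w)%:E < +oo)%E.
Proof.
move=> T0; have X0 w : (0 <= X T w)%E by case: X_process => + _ _; exact.
apply: (@le_lt_trans _ _ (\int[Q]_w (T%:E * X T w))%E).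
  apply: ge0_le_integralT => w.
    apply: integral_ge0 => s /=; rewrite in_itv/= => /andP[s0 _].
    by rewrite lee_fin discounted_minimal_ge0.
  apply: (le_trans (lambda_integral w T0)).
  by rewrite lee_wpmul2l ?lee_fin// x_le_X.
rewrite ge0_integralZl_EFin//; last first.
  by apply: (measurable_wrt_fun fF T0); case: X_process => _ _; exact.
rewrite lte_mul_pinfty ?lee_fin//.
by apply: le_lt_trans (X_mean T0) _; rewrite ltry.
Qed.

End existence_uniqueness.

Theorem proposition3p1 (R : realType)
  (d : measure_display) (Omega : measurableType d) (Q : probability Omega R)
  (F : R -> set (set Omega)) (p M G alpha : R)
  (W : R -> Omega -> R) (N : Omega -> {measure set (R * R * R) -> \bar R})
  (kappa lbar eta a lambda0 : R) :
  usual_conditions Q F ->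
  0 < p -> p < 1 -> 0 < M -> 0 < G -> 0 < alpha -> alpha < 2 ->
  brownian_motion Q F W ->
  adapted_poisson_random_measure Q F (intensity p M G alpha) N ->
  independent Q (sigma_of `[0, +oo[ W)
                (sigma_of [set A : set (R * R * R) | measurable A] (fun A w => N w A)) ->
  0 < kappa -> 0 < lbar -> 0 <= eta -> 0 < a -> 0 < lambda0 ->
  (exists (lambda : R -> Omega -> R)
          (mu : Omega -> {measure set (R * R) -> \bar R}),
    [/\ solution Q F kappa lbar eta a lambda0 N lambda mu,
        forall (t : R) w, 0 <= t -> 0 <= lambda t w &
        forall T : R, 0 <= T ->
          {ae Q, forall w,
            (\int[lebesgue_measure]_(s in `[0%R, T]) (lambda s w)%:E < +oo)%E}
          /\ (\int[Q]_w \int[lebesgue_measure]_(s in `[0%R, T]) (lambda s w)%:E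
              < +oo)%E])
  /\ (forall (lambda lambda' : R -> Omega -> R)
             (mu mu' : Omega -> {measure set (R * R) -> \bar R}),
        solution Q F kappa lbar eta a lambda0 N lambda mu ->
        solution Q F kappa lbar eta a lambda0 N lambda' mu' ->
        indistinguishable Q lambda lambda' mu mu').
Proof.
move=> usual p0 p1 M0 G0 al0 al2 _ prmN _ kappa0 lbar0 eta0 a0 l00.
have [m [c [mE c0 cellE]]] :=
  intensity_sigma_finite p0 p1 M0 G0 al0 al2 a0 kappa eta0.
rewrite -mE in prmN; split; last first.
  by move=> *; apply: (solution_unique usual kappa0 lbar0 eta0 a0 l00 c0 cellE prmN); eassumption.
have sol := thinned_solution usual kappa0 lbar0 eta0 a0 l00 c0 cellE prmN.
eexists; eexists; split; first exact: sol.
  by move=> t w; exact: (discounted_minimal_ge0 usual kappa0 lbar0 eta0 a0 l00 cellE prmN).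
move=> T T0; split.
  apply: aeW => w.
  exact: (discounted_minimal_integral usual kappa0 lbar0 eta0 a0 l00 cellE prmN).
exact: (discounted_minimal_mean usual kappa0 lbar0 eta0 a0 l00 c0 cellE prmN).
Qed.
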